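(* Let $\Omega\subset\mathbb{R}^n$ be a domain. Let $h>0$ and suppose that $\mathcal{T}_h=\{\Omega_j\}_{j\in J}$ is a mesh of $\Omega$ such that $\operatorname{diam}(\Omega_j)\leq h$ for $j\in J$. Let $V_h$ be the set of piecewise constant functions on $\mathcal{T}_h$ that lie in $L_2(\Omega)$, and let $P_h:L_2(\Omega)\to V_h$ be the $L_2$-orthogonal projection onto $V_h$. Then, for any $u\in H^1(\Omega)$, and any $U\in H^1(\mathbb{R}^n)$ such that $U|_\Omega=u$, $$\|u-P_hu\|_{L_2(\Omega)}\leq Ch\|\nabla U\|_{L_2(\mathbb{R}^n)},$$ and $$\|u-P_hu\|_{L_2(\Omega)}\leq Ch\|u\|_{H^1(\Omega)},$$ where $$C=\frac{3^{1+n/2}\sqrt n}{\pi}.$$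
   Context: A domain in $\mathbb{R}^n$ means a non-empty open subset of $\mathbb{R}^n$. Given a countable (e.g. finite) index set $J$, $\mathcal{T}=\{T_j\}_{j\in J}$ is a mesh of a domain $\Omega$ if, for each $j\in J$, $T_j\subset\Omega$ is a bounded domain, $T_j\cap T_{j'}=\emptyset$ for $j'\neq j$, and $\big|\Omega\setminus\bigcup_{j\in J}T_j\big|=0$, where $|\cdot|$ is Lebesgue measure. $H^1(\mathbb{R}^n)$ has norm $\|u\|_{H^1(\mathbb{R}^n)}^2=\int_{\mathbb{R}^n}(1+|\xi|^2)|\hat u(\xi)|^2\,d\xi$, with $\hat u$ the (unitarily normalised) Fourier transform, so that $\|u\|_{H^1(\mathbb{R}^n)}^2=\|u\|_{L_2(\mathbb{R}^n)}^2+\|\nabla u\|_{L_2(\mathbb{R}^n)}^2$. $H^1(\Omega):=\{U|_\Omega:U\in H^1(\mathbb{R}^n)\}$, with quotient norm $\|u\|_{H^1(\Omega)}=\inf\{\|U\|_{H^1(\mathbb{R}^n)}:U\in H^1(\mathbb{R}^n),\ U|_\Omega=u\}$. *)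

(* Defs.v *)
From HB Require Import structures.
From mathcomp Require Import all_boot all_order all_algebra.
From mathcomp Require Import complex.
From mathcomp Require Import all_classical all_reals all_analysis.
From mathcomp Require Import measurable_realfun.

Set Implicit Arguments.
Unset Strict Implicit.
Unset Printing Implicit Defensive.

Import Order.TTheory GRing.Theory Num.Theory.
Import numFieldNormedType.Exports.

Local Open Scope classical_set_scope.
Local Open Scope ring_scope.

Definition measure_row_display : measure_display -> measure_display.
Proof. exact. Qed.

(* 'rV[T]_n carries the sigma-algebra generated by the coordinates, exactly as
   n.-tuple T does in the library; for T := R it contains the open sets of
   'rV[R]_n (lemma open_measurable_row), so it is the Borel sigma-algebra. *)
Section measurable_row.
Context {d} {T : measurableType d} (n : nat).

Let coors (i : 'I_n) (x : 'rV[T]_n) : T := x ord0 i.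

Let row_set0 : g_sigma_preimage coors set0.
Proof. exact: sigma_algebra0. Qed.

Let row_setC A : g_sigma_preimage coors A -> g_sigma_preimage coors (~` A).
Proof. exact: sigma_algebraC. Qed.

Let row_bigcup (F : (set 'rV[T]_n)^nat) :
  (forall i, g_sigma_preimage coors (F i)) ->
  g_sigma_preimage coors (\bigcup_i (F i)).
Proof. exact: sigma_algebra_bigcup. Qed.

HB.instance Definition _ := @isMeasurable.Build (measure_row_display d)
  'rV[T]_n (g_sigma_preimage coors) row_set0 row_setC row_bigcup.

Lemma measurable_row_coord (i : 'I_n) :
  measurable_fun [set: 'rV[T]_n] (fun x : 'rV[T]_n => x ord0 i).
Proof.
move=> _ Y mY; rewrite setTI; apply: sub_sigma_algebra => /=.
rewrite -bigcup_seq/=; exists i => /=; first by rewrite mem_index_enum.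
by exists Y => //; rewrite setTI.
Qed.

Lemma measurable_fun_rowP d' (S : measurableType d') (f : S -> 'rV[T]_n) :
  (forall i, measurable_fun [set: S] (fun x => f x ord0 i)) ->
  measurable_fun [set: S] f.
Proof.
move=> mf; apply: (@measurability _ _ _ _ _ _
  (\big[setU/set0]_(i < n) preimage_set_system setT (coors i) measurable)) => //.
move=> _ [B + <-]; rewrite -bigcup_seq => -[i _] [C mC <-].
rewrite !setTI -[X in measurable X]setTI -comp_preimage; exact: mf.
Qed.

End measurable_row.

Section lebesgue_row.
Context {R : realType}.

Definition row_cons n (x : R * 'rV[R]_n) : 'rV[R]_n.+1 :=
  row_mx (const_mx x.1 : 'rV_1) x.2.

Definition row_uncons n (x : 'rV[R]_n.+1) : R * 'rV[R]_n :=
  (x ord0 ord0, rsubmx (x : 'rV[R]_(1 + n))).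

Lemma row_consK n : cancel (@row_cons n) (@row_uncons n).
Proof.
move=> [a v]; rewrite /row_uncons /row_cons row_mxKr/=; congr pair.
by rewrite mxE; case: splitP => // j _; rewrite mxE.
Qed.

Lemma row_unconsK n : cancel (@row_uncons n) (@row_cons n).
Proof.
move=> v; apply/rowP => i; rewrite mxE.
by case: splitP => j ij; rewrite !mxE; congr (v _ _); apply/val_inj;
  rewrite /= ij// ord1.
Qed.

Lemma measurable_row_cons n : measurable_fun setT (@row_cons n).
Proof.
apply: measurable_fun_rowP => i.
case E : (fintype.split (i : 'I_(1 + n))) => [j|j].
- by apply: (eq_measurable_fun fst) => // -[a v] _; rewrite !mxE E mxE.
- apply: (eq_measurable_fun (fun x : R * 'rV[R]_n => x.2 ord0 j)) => [[a v] _ /=|].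
    by rewrite mxE E.
  by apply: (measurableT_comp (measurable_row_coord j)); exact: measurable_snd.
Qed.

Lemma measurable_row_uncons n : measurable_fun setT (@row_uncons n).
Proof.
apply/measurable_fun_pairP; split => /=.
  exact: measurable_row_coord.
apply: measurable_fun_rowP => i /=.
apply: (eq_measurable_fun (fun x : 'rV[R]_n.+1 => x ord0 (rshift 1 i))).
  by move=> x _; rewrite mxE.
exact: measurable_row_coord.
Qed.

Definition lebesgue_row0 : set 'rV[R]_0 -> \bar R := \d_(0 : 'rV[R]_0).

HB.instance Definition _ := FiniteMeasure.on lebesgue_row0.

Definition lebesgue_rowS n (m : {sigma_finite_measure set 'rV[R]_n -> \bar R})
    : set 'rV[R]_n.+1 -> \bar R :=
  pushforward (@lebesgue_measure R \x m)%E (@row_cons n).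

Section lebesgue_rowS.
Variables (n : nat) (m : {sigma_finite_measure set 'rV[R]_n -> \bar R}).

Let mpre (A : set 'rV[R]_n.+1) : measurable A ->
  measurable (@row_cons n @^-1` A).
Proof. by move=> mA; rewrite -[X in measurable X]setTI; exact: measurable_row_cons. Qed.

Let rowS0 : lebesgue_rowS m set0 = 0%E.
Proof. by rewrite /lebesgue_rowS /pushforward preimage_set0 measure0. Qed.

Let rowS_ge0 A : (0 <= lebesgue_rowS m A)%E.
Proof.
exact: (measure_ge0 (@lebesgue_measure R \x m)%E (@row_cons n @^-1` A)).
Qed.

Let rowS_additive : semi_sigma_additive (lebesgue_rowS m).
Proof.
move=> F mF tF mUF; rewrite /lebesgue_rowS /pushforward preimage_bigcup.
apply: measure_semi_sigma_additive.
- by move=> k; exact: mpre.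
- apply/trivIsetP => /= i j _ _ ij; rewrite -preimage_setI.
  by move/trivIsetP : tF => /(_ _ _ _ _ ij) ->//; rewrite preimage_set0.
- by rewrite -preimage_bigcup; exact: mpre.
Qed.

HB.instance Definition _ := isMeasure.Build _ _ _
  (lebesgue_rowS m) rowS0 rowS_ge0 rowS_additive.

Let lebesgue_rowS_sigma_finite : sigma_finite setT (lebesgue_rowS m).
Proof.
have /sigma_finiteP[F [TF ndF Foo]] := sigma_finiteT (@lebesgue_measure R).
have /sigma_finiteP[G [TG ndG Goo]] := sigma_finiteT m.
exists (fun k => @row_uncons n @^-1` (F k `*` G k)).
  apply/seteqP; split => // x _.
  have [k _ Fk] : (\bigcup_i F i) (row_uncons x).1 by rewrite -TF.
  have [l _ Gl] : (\bigcup_i G i) (row_uncons x).2 by rewrite -TG.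
  exists (maxn k l) => //; split.
  - by move: Fk; exact/subsetPset/ndF/leq_maxl.
  - by move: Gl; exact/subsetPset/ndG/leq_maxr.
move=> k; have [mF Fk] := Foo k; have [mG Gk] := Goo k; split.
  rewrite -[X in measurable X]setTI; apply: measurable_row_uncons => //.
  exact: measurableX.
rewrite /lebesgue_rowS /pushforward -comp_preimage.
rewrite (_ : _ \o _ = id); last by apply/funext => x; exact: row_consK.
rewrite preimage_id product_measure1E//.
by rewrite lte_mul_pinfty// ge0_fin_numE.
Qed.

HB.instance Definition _ := Measure_isSigmaFinite.Build _ _ _
  (lebesgue_rowS m) lebesgue_rowS_sigma_finite.

End lebesgue_rowS.

Fixpoint lebesgue_row n : {sigma_finite_measure set 'rV[R]_n -> \bar R} :=
  if n is k.+1 then lebesgue_rowS (lebesgue_row k) else lebesgue_row0.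

Lemma measurable_row_box n (A : 'I_n -> set R) : (forall i, measurable (A i)) ->
  measurable [set x : 'rV[R]_n | forall i, A i (x ord0 i)].
Proof.
move=> mA.
rewrite (_ : mkset _ = \bigcap_(i in setT)
    ((fun x : 'rV[R]_n => x ord0 i) @^-1` A i)); last first.
  by apply/seteqP; split => x /= Ax i => [_|]; exact: Ax.
apply: fin_bigcap_measurable => [|i _]; first exact: finite_finset.
by rewrite -[X in measurable X]setTI; exact: measurable_row_coord.
Qed.

Lemma lebesgue_row_box n (A : 'I_n -> set R) : (forall i, measurable (A i)) ->
  lebesgue_row n [set x | forall i, A i (x ord0 i)] =
  (\prod_(i < n) lebesgue_measure (A i))%E.
Proof.
elim: n A => [|n IHn] A mA.
  by rewrite big_ord0 /= /lebesgue_row0 diracE mem_set// => -[].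
have mA' := @measurable_row_box n _ (fun i => mA (lift ord0 i)).
rewrite big_ord_recl -IHn//; apply: etrans; last first.
  exact: (@product_measure1E _ _ _ _ R lebesgue_measure (lebesgue_row n)
    _ _ (mA ord0) mA').
rewrite /= /lebesgue_rowS /pushforward; congr (_ _).
have rc0 a (v : 'rV[R]_n) : row_cons (a, v) ord0 ord0 = a.
  by rewrite -[LHS]/(row_uncons (row_cons (a, v))).1 row_consK.
have rcS a (v : 'rV[R]_n) (i : 'I_n) : row_cons (a, v) ord0 (lift ord0 i) = v ord0 i.
  have /(congr1 (fun p : R * 'rV[R]_n => p.2 ord0 i)) := row_consK (a, v).
  rewrite /row_uncons mxE /= => <-.
  by congr (row_cons _ _ _); apply/val_inj.
apply/seteqP; split => -[a v] /=.
  move=> H; split => [|i]; first by have := H ord0; rewrite rc0.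
  by have := H (lift ord0 i); rewrite rcS.
by move=> [Aa Av] i; case: (unliftP ord0 i) => [j|] ->; rewrite ?rcS ?rc0.
Qed.

Lemma open_measurable_row n (A : set 'rV[R]_n) : open A -> measurable A.
Proof.
move=> oA.
pose q (p : 'rV[rat]_n * nat) : 'rV[R]_n := map_mx ratr p.1.
pose B p : set 'rV[R]_n := ball (q p) p.2.+1%:R^-1.
have mB p : measurable (B p).
  rewrite (_ : B p = [set x | forall i, ball (q p ord0 i) p.2.+1%:R^-1 (x ord0 i)]).
    apply: (@measurable_row_box n (fun i => ball (q p ord0 i) p.2.+1%:R^-1)).
    by move=> i; apply: open_measurable; apply: ball_open; rewrite invr_gt0.
  apply/seteqP; split => [x [_ px] i|x px]; first exact: px.
  by split => [|i j]; [rewrite invr_gt0|rewrite ord1; exact: px].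
rewrite (_ : A = \bigcup_p (if pselect (B p `<=` A) then B p else set0)).
  apply: countable_bigcupT_measurable => [|p]; first exact: countableP.
  by case: pselect => //= _; exact: mB.
apply/seteqP; split => [x Ax|x [p _]]; last by case: pselect => // pA /pA.
have /nbhs_ballP[e /= e0 eA] : nbhs x A by exact: open_nbhs_nbhs.
have [k _ /(_ k (leqnn _)) /= ke] :=
  near_infty_natSinv_lt (PosNum (divr_gt0 e0 (ltr0n R 2))).
pose r := k.+1%:R^-1 : R; have r0 : 0 < r by rewrite invr_gt0.
have /choice[f fP] (i : 'I_n) : exists q : rat, `|x ord0 i - ratr q| < r.
  have /rat_in_itvoo[p] : x ord0 i - r < x ord0 i + r by rewrite ltrD2l gtrN.
  by rewrite in_itv/= -ltr_distlC => xp; exists p.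
exists (\row_i f i, k) => //; have xB : B (\row_i f i, k) x.
  by split => // i j; rewrite !mxE ord1 /ball/= distrC.
case: pselect => // -[]; move=> y /(ball_triangle (ball_sym xB)) xy; apply: eA.
by apply: le_ball xy; rewrite /= [leRHS]splitr lerD// ltW.
Qed.

End lebesgue_row.

Section domains_and_meshes.
Context {R : realType} {n : nat}.
Local Notation mu := (@lebesgue_row R n).

Definition dot (x y : 'rV[R]_n) : R := \sum_i x ord0 i * y ord0 i.

(* The norm `|x| of 'rV[R]_n is the sup norm, hence this Euclidean one. *)
Definition enorm (x : 'rV[R]_n) : R := Num.sqrt (dot x x).

Definition diam (A : set 'rV[R]_n) : \bar R :=
  ereal_sup [set (enorm (x - y))%:E | x in A & y in A].

Definition domain (A : set 'rV[R]_n) : Prop := open A /\ A !=set0.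

Definition mesh (J : countType) (Omega : set 'rV[R]_n)
    (T : J -> set 'rV[R]_n) : Prop :=
  [/\ forall j, [/\ domain (T j), bounded_set (T j) & T j `<=` Omega],
      forall i j, i != j -> T i `&` T j = set0 &
      mu (Omega `\` \bigcup_j T j) = 0%E].

End domains_and_meshes.

(* Functions are complex valued.  Elements of Lebesgue and Sobolev spaces are
   represented by functions on the whole of R^n that are Borel measurable on the
   set at hand; only their values almost everywhere on that set are relevant. *)
Section L2.
Context {R : realType} {n : nat}.
Local Notation mu := (@lebesgue_row R n).
Implicit Types (D Omega : set 'rV[R]_n) (f g : 'rV[R]_n -> R[i]).

Definition cmeasurable D f : Prop :=
  measurable_fun D (fun x => complex.Re (f x)) /\
  measurable_fun D (fun x => complex.Im (f x)).

Definition cintegrable D f : Prop :=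
  mu.-integrable D (fun x => (complex.Re (f x))%:E) /\
  mu.-integrable D (fun x => (complex.Im (f x))%:E).

Definition cint D f : R[i] :=
  ((\int[mu]_(x in D) complex.Re (f x)) +i*
   (\int[mu]_(x in D) complex.Im (f x)))%C.

Definition L2norm D f : \bar R :=
  'N[mu]_2%:E[EFin \o ((fun x => Normc.normc (f x)) \_ D)]%E.

Definition L2 D f : Prop := cmeasurable D f /\ (L2norm D f < +oo)%E.

Definition L2dot D f g : R[i] := cint D (fun x => f x * conjc (g x)).

Definition pw_const (J : Type) Omega (T : J -> set 'rV[R]_n) :
    set ('rV[R]_n -> R[i]) :=
  [set v | L2 Omega v /\
    forall j, exists c : R[i], {ae mu, forall x, T j x -> v x = c}].

Definition orthogonal_projection Omega (V : set ('rV[R]_n -> R[i]))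
    (P : ('rV[R]_n -> R[i]) -> ('rV[R]_n -> R[i])) : Prop :=
  forall f, L2 Omega f ->
    V (P f) /\ forall v, V v -> L2dot Omega (f \- P f) v = 0.

End L2.

Section H1.
Context {R : realType} {n : nat}.
Local Notation mu := (@lebesgue_row R n).
Implicit Types (D Omega : set 'rV[R]_n) (U V u : 'rV[R]_n -> R[i]).

Definition fourier_integral D U (xi : 'rV[R]_n) : R[i] :=
  ((2 * pi) `^ (- (n%:R / 2)))%:C%C *
  cint D (fun x => U x * (cos (dot x xi) -i* sin (dot x xi))%C).

(* Plancherel's definition on L_2(R^n): V is the L_2-limit of the Fourier
   integrals of U over the balls of radius k. *)
Definition is_fourier U V : Prop :=
  L2 setT V /\
  (fun k : nat =>
     L2norm setT (fourier_integral [set x | enorm x <= k%:R] U \- V))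
    @ \oo --> 0%E.

Definition fourier U : 'rV[R]_n -> R[i] :=
  xget (fun=> 0) [set V | is_fourier U V].

Definition H1norm U : \bar R :=
  ((\int[mu]_xi ((1 + enorm xi ^+ 2) * Normc.normc (fourier U xi) ^+ 2)%:E)
     `^ 2^-1)%E.

(* By Plancherel's theorem the second condition follows from the first; it
   makes sure that fourier U is not the default value of xget. *)
Definition H1 U : Prop :=
  [/\ L2 setT U, is_fourier U (fourier U) & (H1norm U < +oo)%E].

Definition H1_on Omega u : Prop :=
  L2 Omega u /\ exists2 U, H1 U & ae_eq mu Omega U u.

Definition H1norm_on Omega u : \bar R :=
  ereal_inf [set H1norm U | U in [set U | H1 U /\ ae_eq mu Omega U u]].

Definition partial (j : 'I_n) (phi : 'rV[R]_n -> R) : 'rV[R]_n -> R :=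
  'D_(delta_mx ord0 j) phi.

Definition smooth (phi : 'rV[R]_n -> R) : Prop :=
  forall (s : seq 'I_n) x, differentiable (foldr partial phi s) x.

Definition test_function (phi : 'rV[R]_n -> R) : Prop :=
  smooth phi /\ compact (closure [set x | phi x != 0]).

(* Real-valued test functions suffice: the identity is linear in phi. *)
Definition weak_gradient U (G : 'I_n -> 'rV[R]_n -> R[i]) : Prop :=
  (forall j K, compact K -> cintegrable K (G j)) /\
  forall phi j, test_function phi ->
    cint setT (fun x => U x * (partial j phi x)%:C%C) =
    - cint setT (fun x => G j x * (phi x)%:C%C).

Definition grad_L2norm (G : 'I_n -> 'rV[R]_n -> R[i]) : \bar R :=
  'N[mu]_2%:E[EFin \o (fun x => Num.sqrt (\sum_j Normc.normc (G j x) ^+ 2)%R)]%E.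

End H1.

(* Main.v *)
From HB Require Import structures.
Require Import Defs.
From mathcomp Require Import all_boot all_order all_algebra.
From mathcomp Require Import complex.
From mathcomp Require Import all_classical all_reals all_analysis.
From mathcomp Require Import measurable_realfun ring lra.

(** As the mesh cell [T_j] has diameter at most [h], some point has sup-distance
    at most [h/2] to all points of [T_j] ([small_diam_center]).  Let [k_j] be the
    average of [U] over the cube of side [h/2] around it.  This cube lies in
    [x + [-3h/4, 3h/4]^n] for every [x] in [T_j], so that Cauchy-Schwarz bounds
    [|U(x) - k_j|^2] by [(h/2)^-n] times the integral of [|U(x + t) - U(x)|^2]
    over the cube [|t|_oo <= 3h/4] ([average_oscillation]).  This bound no longer mentions [j]; integrating it
    over [x] and exchanging the integrals ([integral_oscillation]) shows that
    the piecewise constant function with values [k_j] approximates [U] up to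
    [3^n] times the largest [||U(. + t) - U||^2] with [|t|_oo <= 3h/4].  The
    projection does at least as well ([orthogonal_projection_le]).

    It remains to prove [||U(. + t) - U||^2 <= n s^2 D^2] whenever
    [|t|_oo <= s], where [D] is either of the norms on the right hand sides.
    The square of the final constant is then [3^n n (3/4)^2], which is at most
    [C^2 = 3^(2 + n) n / pi^2] because [pi <= 4].

    For [D = ||U||_{H^1}] ([H1_translation]), write [F] for the unitary Fourier
    transform.  If [f] has compact support then [||f|| <= ||F f||]
    ([plancherel_row]).  This is applied to [f = U_k(. + t) - U_k], where [U_k]
    is [U] cut off outside the ball of radius [k]; here [F f] is
    [(e^{i t.xi} - 1) F U_k], the first factor is at most [|t| |xi|] in modulus,
    and [F U_k] tends to [F U] by the definition of the latter.  On the line the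
    inequality is obtained by Abel summation: damping [|F f|^2] by
    [exp(- e |xi|)] amounts to averaging the autocorrelation of [f] against the
    Poisson kernel, which concentrates at the origin as [e] tends to [0]
    ([plancherel_line_real]).  The passage to [n] dimensions transforms one
    coordinate after the other ([plancherel_step]).

    For [D = ||G||] with [G] the weak gradient ([weak_gradient_translation]),
    the translation is performed along one axis after the other.  Let [rho] be a
    product of smooth bumps and let [K] be the integral of [rho(. + r e_j)] over
    [0 <= r <= s].  Since [d_j K = rho(. + s e_j) - rho], testing the definition
    of [G] with reflected translates of [K] shows that the convolution of
    [W = U(. + s e_j) - U] with [rho] equals the convolution of [G_j] with [K]
    ([difference_convolution]).  If [rho] has mass [m] then [K] has mass [s m],
    whence [||W * rho|| <= s m ||G_j||]; and [W * rho] is close to [m W] when the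
    support of [rho] is small, because translations are continuous by the first
    case.  In the limit [||W|| <= s ||G_j||] ([weak_difference]). *)

Set Implicit Arguments.
Unset Strict Implicit.
Unset Printing Implicit Defensive.
Import Order.TTheory GRing.Theory Num.Theory.
Import numFieldNormedType.Exports.
Local Open Scope classical_set_scope.
Local Open Scope ring_scope.

(** * Measure preserving maps and Lebesgue measure on row vectors *)

Section measure_preserving.
Context d1 d2 (X : measurableType d1) (Y : measurableType d2) (R : realType).
Local Open Scope ereal_scope.

Definition measure_preserving (m1 : {measure set X -> \bar R})
    (m2 : {measure set Y -> \bar R}) (T : X -> Y) : Prop :=
  measurable_fun setT T /\ forall A, measurable A -> m1 (T @^-1` A) = m2 A.

Variables (m1 : {measure set X -> \bar R}) (m2 : {measure set Y -> \bar R}).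
Variables (T : X -> Y).
Hypothesis mT : measure_preserving m1 m2 T.

Lemma ge0_integral_preserving (f : Y -> \bar R) : measurable_fun setT f ->
  (forall y, 0 <= f y) -> \int[m2]_y f y = \int[m1]_x f (T x).
Proof.
case: mT => mmT pT mf f0.
transitivity (\int[pushforward m1 T]_y f y).
  by apply: eq_measure_integral => A mA _; rewrite -pT.
by rewrite ge0_integral_pushforward.
Qed.

Lemma integral_preserving (f : Y -> \bar R) : measurable_fun setT f ->
  \int[m2]_y f y = \int[m1]_x f (T x).
Proof.
move=> mf; rewrite integralE [RHS]integralE.
have mp := measurable_funepos mf; have mn := measurable_funeneg mf.
rewrite (ge0_integral_preserving mp)// (ge0_integral_preserving mn)//.
by congr (_ - _)%E; apply: eq_integral => x _; rewrite ?funeposE ?funenegE.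
Qed.

Lemma integrable_preserving (f : Y -> \bar R) : measurable_fun setT f ->
  m2.-integrable setT f <-> m1.-integrable setT (f \o T).
Proof.
case: (mT) => mmT _ mf; split => /integrableP[_ fi]; apply/integrableP; split.
- exact: measurableT_comp.
- rewrite -[X in X < _](ge0_integral_preserving (f := abse \o f))//; first exact: measurableT_comp.
  by move=> y; exact: abse_ge0.
- by [].
- rewrite [X in X < _](ge0_integral_preserving (f := abse \o f))//; first exact: measurableT_comp.
  by move=> y; exact: abse_ge0.
Qed.

Lemma Rintegral_preserving (f : Y -> R) : measurable_fun setT f ->
  Rintegral m2 setT f = Rintegral m1 setT (f \o T).
Proof.
by move=> mf; rewrite /Rintegral integral_preserving//; exact/measurable_EFinP.
Qed.

End measure_preserving.

Lemma measure_preserving_comp d1 d2 d3 (X : measurableType d1)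
    (Y : measurableType d2) (Z : measurableType d3) (R : realType)
    (m1 : {measure set X -> \bar R}) (m2 : {measure set Y -> \bar R})
    (m3 : {measure set Z -> \bar R}) (S : Y -> Z) (T : X -> Y) :
  measure_preserving m2 m3 S -> measure_preserving m1 m2 T ->
  measure_preserving m1 m3 (S \o T).
Proof.
move=> [mS pS] [mT pT]; split; first exact: measurableT_comp.
move=> A mA; rewrite comp_preimage pT ?pS//.
by rewrite -[X in measurable X]setTI; exact: mS.
Qed.

(** A product measure is determined by its values on measurable rectangles. *)
Lemma measure_preserving_prod d1 d2 d3 d4 (X : measurableType d1)
    (Y : measurableType d2) (X' : measurableType d3) (Y' : measurableType d4)
    (R : realType)
    (m1 : {sigma_finite_measure set X -> \bar R})
    (m2 : {sigma_finite_measure set Y -> \bar R})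
    (m1' : {sigma_finite_measure set X' -> \bar R})
    (m2' : {sigma_finite_measure set Y' -> \bar R})
    (S : X -> X') (T : Y -> Y') :
  measure_preserving m1 m1' S -> measure_preserving m2 m2' T ->
  measure_preserving (m1 \x m2)%E (m1' \x m2')%E (fun z => (S z.1, T z.2)).
Proof.
move=> [mS pS] [mT pT].
have mST : measurable_fun setT (fun z : X * Y => (S z.1, T z.2)).
  apply/measurable_fun_pairP; split => /=.
    by apply: (measurableT_comp mS); exact: measurable_fst.
  by apply: (measurableT_comp mT); exact: measurable_snd.
split => // A mA.
pose ST_mixin := isMeasurableFun.Build _ _ _ _ _ mST.
pose ST : {mfun _ >-> _} := HB.pack (fun z : X * Y => (S z.1, T z.2)) ST_mixin.
rewrite -[LHS]/(pushforward (m1 \x m2)%E ST A); apply/esym.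
apply: (product_measure_unique (m1 := m1') (m2 := m2')
  (m' := pushforward (m1 \x m2)%E ST)) => // B C mB mC.
rewrite -[LHS]/((m1 \x m2)%E ((S @^-1` B) `*` (T @^-1` C))).
rewrite product_measure1E//; last 2 first.
- by rewrite -[X in measurable X]setTI; exact: mS.
- by rewrite -[X in measurable X]setTI; exact: mT.
by rewrite pS// pT.
Qed.

Section preserving_lebesgue.
Context {R : realType}.
Local Notation leb := (@lebesgue_measure R).

(** Lebesgue measure is determined by its values on half-open intervals. *)
Lemma lebesgue_translation (t : R) : measure_preserving leb leb (fun x => x + t).
Proof.
have mt : measurable_fun setT (fun x : measurableTypeR R => x + t : measurableTypeR R).
  exact: measurable_funD.
split => // A mA.
pose T_mixin := isMeasurableFun.Build _ _ _ _ _ mt.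
pose T : {mfun _ >-> _} := HB.pack (fun x : measurableTypeR R => x + t : measurableTypeR R) T_mixin.
rewrite -[LHS]/(pushforward leb T A).
apply/esym/(lebesgue_measure_unique (mu := pushforward leb T)) => //= _ [[a b]] _ <-.
rewrite /pushforward /= (_ : _ @^-1` _ = `]a - t, b - t]%classic).
  rewrite !lebesgue_measure_itv/= !lte_fin ltrD2r.
  by case: ifPn => // _; rewrite -!EFinD opprB addrA subrK.
by apply/seteqP; split => x /=; rewrite !in_itv/= ltrBlDr lerBrDr.
Qed.

Lemma lebesgue_reflection : measure_preserving leb leb (-%R : R -> R).
Proof.
split => [|A mA]; first exact: measurable_funN.
exact: lebesgue_measureN.
Qed.

End preserving_lebesgue.

Section row_measure.
Context {R : realType}.
Local Notation leb := (@lebesgue_measure R).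
Local Open Scope ereal_scope.

Lemma row_cons_preserving n :
  measure_preserving (leb \x lebesgue_row n) (lebesgue_row n.+1) (@row_cons R n).
Proof. by split => //; exact: measurable_row_cons. Qed.

Lemma row_cons0 n a (v : 'rV[R]_n) : row_cons (a, v) ord0 ord0 = a.
Proof. by rewrite -[LHS]/(row_uncons (row_cons (a, v))).1 row_consK. Qed.

Lemma row_consS n a (v : 'rV[R]_n) (i : 'I_n) :
  row_cons (a, v) ord0 (lift ord0 i) = v ord0 i.
Proof.
have /(congr1 (fun p : R * 'rV[R]_n => p.2 ord0 i)) := row_consK (a, v).
rewrite /row_uncons mxE /= => <-.
by congr (row_cons _ _ _); apply/val_inj.
Qed.

Lemma row_cons_ext n a (v : 'rV[R]_n) (w : 'rV[R]_n.+1) :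
  w ord0 ord0 = a -> (forall i, w ord0 (lift ord0 i) = v ord0 i) ->
  w = row_cons (a, v).
Proof.
move=> wa wv; apply/rowP => i.
by case: (unliftP ord0 i) => [j|] ->; rewrite ?row_consS ?row_cons0.
Qed.

Lemma ge0_integral_rowS1 n (f : 'rV[R]_n.+1 -> \bar R) : measurable_fun setT f ->
  (forall x, 0 <= f x) ->
  \int[lebesgue_row n.+1]_x f x =
  \int[leb]_a \int[lebesgue_row n]_v f (row_cons (a, v)).
Proof.
move=> mf f0; rewrite (ge0_integral_preserving (row_cons_preserving n))//.
rewrite -[LHS]/(\int[leb \x lebesgue_row n]_z (f \o @row_cons R n) z).
rewrite fubini_tonelli1// => [|x]; last exact: f0.
by apply: measurableT_comp => //; exact: measurable_row_cons.
Qed.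

Lemma ge0_integral_rowS2 n (f : 'rV[R]_n.+1 -> \bar R) : measurable_fun setT f ->
  (forall x, 0 <= f x) ->
  \int[lebesgue_row n.+1]_x f x =
  \int[lebesgue_row n]_v \int[leb]_a f (row_cons (a, v)).
Proof.
move=> mf f0; rewrite (ge0_integral_preserving (row_cons_preserving n))//.
rewrite -[LHS]/(\int[leb \x lebesgue_row n]_z (f \o @row_cons R n) z).
rewrite fubini_tonelli2// => [|x]; last exact: f0.
by apply: measurableT_comp => //; exact: measurable_row_cons.
Qed.

Lemma integral_rowS2 n (f : 'rV[R]_n.+1 -> \bar R) :
  (lebesgue_row n.+1).-integrable setT f ->
  \int[lebesgue_row n.+1]_x f x =
  \int[lebesgue_row n]_v \int[leb]_a f (row_cons (a, v)).
Proof.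
move=> fi; have mf := measurable_int _ fi.
rewrite (integral_preserving (row_cons_preserving n))//.
rewrite -[LHS]/(\int[leb \x lebesgue_row n]_z (f \o @row_cons R n) z).
rewrite -integral21_prod_meas1//.
exact/(integrable_preserving (row_cons_preserving n)).
Qed.

(** Rows of length [n.+1] carry the image under [row_cons] of a product measure,
    so that translations can be treated one coordinate at a time. *)
Lemma row_translation n (t : 'rV[R]_n) :
  measure_preserving (lebesgue_row n) (lebesgue_row n) (fun x => (x + t)%R).
Proof.
elim: n t => [|n IHn] t.
  rewrite (_ : (fun _ => _) = id); last first.
    by apply/funext => x; apply/rowP => -[].
  by split => //; exact: measurable_id.
have mt : measurable_fun setT (fun x : 'rV[R]_n.+1 => (x + t)%R).
  apply: measurable_fun_rowP => i.
  apply: (eq_measurable_fun (fun x : 'rV[R]_n.+1 => x ord0 i + t ord0 i)%R).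
    by move=> x _; rewrite mxE.
  by apply: measurable_funD => //; exact: measurable_row_coord.
split => // A mA.
have [mP pP] := measure_preserving_prod (lebesgue_translation (t ord0 ord0))
  (IHn (row_uncons t).2).
have [mc pc] := row_cons_preserving n.
have mcA : measurable (@row_cons R n @^-1` A).
  by rewrite -[X in measurable X]setTI; exact: mc.
rewrite -[RHS]pc// -[RHS]pP// -pc; last first.
  by rewrite -[X in measurable X]setTI; exact: mt.
congr (_ _); apply/seteqP.
suff E (z : R * 'rV[R]_n) : (row_cons z + t)%R =
    row_cons ((z.1 + t ord0 ord0)%R, (z.2 + (row_uncons t).2)%R).
  by split => z /=; rewrite E.
case: z => a v; apply: row_cons_ext; first by rewrite mxE row_cons0.
move=> i; rewrite mxE row_consS !mxE; congr (_ + t _ _)%R.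
exact/val_inj.
Qed.

Lemma row_reflection n :
  measure_preserving (lebesgue_row n) (lebesgue_row n) (fun x : 'rV[R]_n => (- x)%R).
Proof.
elim: n => [|n IHn].
  rewrite (_ : (fun _ => _) = id); last first.
    by apply/funext => x; apply/rowP => -[].
  by split => //; exact: measurable_id.
have mt : measurable_fun setT (fun x : 'rV[R]_n.+1 => (- x)%R).
  apply: measurable_fun_rowP => i.
  apply: (eq_measurable_fun (fun x : 'rV[R]_n.+1 => - x ord0 i)%R).
    by move=> x _; rewrite mxE.
  by apply: measurableT_comp => //; exact: measurable_row_coord.
split => // A mA.
have [mP pP] := measure_preserving_prod lebesgue_reflection IHn.
have [mc pc] := row_cons_preserving n.
have mcA : measurable (@row_cons R n @^-1` A).
  by rewrite -[X in measurable X]setTI; exact: mc.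
rewrite -[RHS]pc// -[RHS]pP// -pc; last first.
  by rewrite -[X in measurable X]setTI; exact: mt.
congr (_ _); apply/seteqP.
suff E (z : R * 'rV[R]_n) : (- row_cons z)%R = row_cons ((- z.1)%R, (- z.2)%R).
  by split => z /=; rewrite E.
case: z => a v /=; apply: row_cons_ext; first by rewrite mxE row_cons0.
by move=> i; rewrite mxE row_consS mxE.
Qed.

Lemma row_subtraction n (t : 'rV[R]_n) :
  measure_preserving (lebesgue_row n) (lebesgue_row n) (fun x => (t - x)%R).
Proof.
rewrite (_ : (fun _ => _) = (fun x => x + t)%R \o -%R).
  exact: measure_preserving_comp (row_translation t) (row_reflection n).
by apply/funext => x /=; rewrite addrC.
Qed.

End row_measure.

(** * Real-valued integrals: bounds, Cauchy-Schwarz and Fubini *)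

Section integral_toolbox.
Context d (T : measurableType d) (R : realType) (mu : {measure set T -> \bar R}).
Implicit Types f g w k : T -> R.

Local Notation intg f := (mu.-integrable setT (EFin \o f)).

Lemma intg_measurable f : intg f -> measurable_fun setT f.
Proof. by move=> /measurable_int/measurable_EFinP. Qed.

Lemma intg_le f g : measurable_fun setT f -> intg g ->
  (forall x, `|f x| <= g x) -> intg f.
Proof.
move=> mf gi fg; apply: (le_integrable measurableT) gi; first exact/measurable_EFinP.
by move=> x _; rewrite /= lee_fin (le_trans (fg x))// ler_norm.
Qed.

Lemma intg_ge0P f : measurable_fun setT f -> (forall x, 0 <= f x) ->
  (\int[mu]_x (f x)%:E < +oo)%E -> intg f.
Proof.
move=> mf f0 fo; apply/integrableP; split; first exact/measurable_EFinP.
by under eq_integral do rewrite /= ger0_norm//.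
Qed.

Lemma intg_lty f : (forall x, 0 <= f x) -> intg f ->
  (\int[mu]_x (f x)%:E < +oo)%E.
Proof.
move=> f0 /integrableP[_].
by under eq_integral do rewrite /= ger0_norm//.
Qed.

Lemma intgMbdd f k C : intg f -> measurable_fun setT k ->
  (forall x, `|k x| <= C) -> intg (fun x => f x * k x).
Proof.
move=> fi mk kC; apply: (@intg_le _ (fun x => C * `|f x|)).
- by apply: measurable_funM => //; exact: intg_measurable.
- have := integrableZl measurableT C (integrable_norm fi).
  by apply: eq_integrable => // x _ /=.
- by move=> x; rewrite normrM mulrC ler_wpM2r.
Qed.

Lemma intgZ f c : intg f -> intg (fun x => c * f x).
Proof.
by move=> fi; have := integrableZl measurableT c fi; apply: eq_integrable.
Qed.

Lemma intgD f g : intg f -> intg g -> intg (fun x => f x + g x).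
Proof.
by move=> fi gi; have := integrableD measurableT fi gi; apply: eq_integrable.
Qed.

Lemma intgB f g : intg f -> intg g -> intg (fun x => f x - g x).
Proof.
by move=> fi gi; have := integrableB measurableT fi gi; apply: eq_integrable.
Qed.

Lemma ge0_integral_EFinD f g : measurable_fun setT f -> measurable_fun setT g ->
  (forall x, 0 <= f x) -> (forall x, 0 <= g x) ->
  (\int[mu]_x (f x + g x)%:E = \int[mu]_x (f x)%:E + \int[mu]_x (g x)%:E)%E.
Proof.
move=> mf mg f0 g0; under eq_integral do rewrite EFinD.
by rewrite ge0_integralD//;
  do ?[exact/measurable_EFinP]; move=> x _; rewrite lee_fin.
Qed.

Lemma ge0_integral_EFinZ f c : measurable_fun setT f ->
  (forall x, 0 <= f x) -> 0 <= c ->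
  (\int[mu]_x (c * f x)%:E = c%:E * \int[mu]_x (f x)%:E)%E.
Proof.
move=> mf f0 c0; under eq_integral do rewrite EFinM.
by rewrite ge0_integralZl//;
  do ?[exact/measurable_EFinP]; move=> x _; rewrite lee_fin.
Qed.

Lemma ge0_le_integral_EFin f g : measurable_fun setT f -> measurable_fun setT g ->
  (forall x, 0 <= f x) -> (forall x, f x <= g x) ->
  (\int[mu]_x (f x)%:E <= \int[mu]_x (g x)%:E)%E.
Proof.
by move=> mf mg f0 fg; apply: ge0_le_integral => //;
  do ?[exact/measurable_EFinP]; move=> x _; rewrite lee_fin.
Qed.

Lemma integral_sqr_ge0 f : (0 <= \int[mu]_x (f x ^+ 2)%:E)%E.
Proof. by apply: integral_ge0 => x _; rewrite lee_fin sqr_ge0. Qed.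

Lemma RintegralZ f c : intg f ->
  Rintegral mu setT (fun x => c * f x) = c * Rintegral mu setT f.
Proof. by move=> fi; rewrite RintegralZl. Qed.

Lemma EFin_Rintegral f : intg f ->
  (Rintegral mu setT f)%:E = (\int[mu]_x (f x)%:E)%E.
Proof. by move=> fi; rewrite /Rintegral fineK//; exact: integrable_fin_num. Qed.

Lemma normr_Rintegral_le f : measurable_fun setT f ->
  (`|Rintegral mu setT f|%:E <= \int[mu]_x `|f x|%:E)%E.
Proof.
move=> mf; apply: (@le_trans _ _ `|\int[mu]_x (f x)%:E|%E).
  by rewrite /Rintegral; case: (\int[mu]_x _)%E => //=; rewrite normr0 leey.
apply: le_trans (le_abse_integral _ _ _) _ => //; exact/measurable_EFinP.
Qed.

(** Hoelder's inequality for [f * sqrt w] and [sqrt w].  When [f * w] is not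
    integrable the left hand side is [0], the conventional value of the
    integral. *)
Lemma cauchy_schwarz_weight f w : measurable_fun setT f -> measurable_fun setT w ->
  (forall x, 0 <= w x) ->
  (((Rintegral mu setT (fun x => f x * w x)) ^+ 2)%:E <=
   \int[mu]_x (w x)%:E * \int[mu]_x (f x ^+ 2 * w x)%:E)%E.
Proof.
move=> mf mw w0.
have msw : measurable_fun setT (fun x => Num.sqrt (w x)).
  apply: (measurableT_comp _ mw); apply: continuous_measurable_fun.
  exact: sqrt_continuous.
have mfw := measurable_funM mf msw.
have := @hoelder _ _ _ mu _ _ 2 2 mfw msw (ltr0Sn R 1) (ltr0Sn R 1).
have -> : ((2 : R)^-1 + 2^-1 = 1)%R by field.
move=> /(_ erefl); rewrite Lnorm1.
have -> : (\int[mu]_x `|(EFin \o (f \* (fun x => Num.sqrt (w x)) \*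
    (fun x => Num.sqrt (w x)))%R) x| = \int[mu]_x `|f x * w x|%:E)%E.
  by apply: eq_integral => x _ /=; rewrite -mulrA -expr2 sqr_sqrtr.
rewrite unlock => h; have {h} := le_trans (normr_Rintegral_le (measurable_funM mf mw)) h.
have -> : (\int[mu]_x `|(EFin \o (f \* (fun x => Num.sqrt (w x)))%R) x| `^ 2 =
    \int[mu]_x (f x ^+ 2 * w x)%:E)%E.
  apply: eq_integral => x _ /=; rewrite powR_mulrn// real_normK ?num_real//.
  by rewrite exprMn sqr_sqrtr.
have -> : (\int[mu]_x `|(EFin \o (fun x => Num.sqrt (w x))) x| `^ 2 =
    \int[mu]_x (w x)%:E)%E.
  by apply: eq_integral => x _ /=; rewrite powR_mulrn// real_normK ?num_real// sqr_sqrtr.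
rewrite -poweRM; last 2 first.
- by apply: integral_ge0 => x _; rewrite lee_fin mulr_ge0// sqr_ge0.
- by apply: integral_ge0 => x _; rewrite lee_fin.
rewrite muleC; set A := (_ * _)%E => h.
have A0 : (0 <= A)%E.
  by apply: mule_ge0; apply: integral_ge0 => x _; rewrite lee_fin// mulr_ge0// sqr_ge0.
case: A A0 h => [r r0|_ _|//]; last by rewrite leey.
rewrite poweR_EFin !lee_fin powR12_sqrt// => h.
rewrite -real_normK ?num_real// -[leRHS](sqr_sqrtr r0).
by rewrite lerXn2r ?nnegrE ?sqrtr_ge0.
Qed.

End integral_toolbox.

Section square_integrable.
Context d (T : measurableType d) (R : realType) (mu : {measure set T -> \bar R}).
Variables (a b : T -> R).
Hypotheses (ma : measurable_fun setT a) (mb : measurable_fun setT b).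

(** Because [|a| <= 1_E + a^2]. *)
Lemma intg_of_sqr (E : set T) : mu.-integrable setT (EFin \o (fun x => a x ^+ 2)) ->
  measurable E -> (mu E < +oo)%E -> (forall x, ~ E x -> a x = 0) ->
  mu.-integrable setT (EFin \o a).
Proof.
move=> a2 mE Eoo aE.
have iE : mu.-integrable setT (EFin \o (\1_E : T -> R)).
  apply: intg_ge0P; first exact: measurable_indic.
    by move=> x; rewrite indicE.
  by rewrite integral_indic// setIT.
apply: (@intg_le _ _ _ mu a (fun x => \1_E x + a x ^+ 2) ma (intgD iE a2)) => x.
rewrite indicE; have [xE|xE] := boolP (x \in E); rewrite /= ?mulr1n ?mulr0n.
  have := sqr_ge0 (a x - 1); have := sqr_ge0 (a x + 1).
  by rewrite ler_norml => *; apply/andP; split; lra.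
by rewrite aE ?normr0 ?expr0n ?addr0// => Ex; move: xE; rewrite mem_set.
Qed.

Hypothesis ab2 : (\int[mu]_x (a x ^+ 2 + b x ^+ 2)%:E < +oo)%E.

Lemma sqr_intgD : mu.-integrable setT (EFin \o (fun x => a x ^+ 2 + b x ^+ 2)).
Proof.
apply: intg_ge0P => //; last by move=> x; rewrite addr_ge0 ?sqr_ge0.
by apply: measurable_funD; exact: measurable_funX.
Qed.

Lemma sqr_intgl : mu.-integrable setT (EFin \o (fun x => a x ^+ 2)).
Proof.
apply: (intg_le _ sqr_intgD) => [|x]; first exact: measurable_funX.
by rewrite ger0_norm ?sqr_ge0// lerDl sqr_ge0.
Qed.

Lemma sqr_intgr : mu.-integrable setT (EFin \o (fun x => b x ^+ 2)).
Proof.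
apply: (intg_le _ sqr_intgD) => [|x]; first exact: measurable_funX.
by rewrite ger0_norm ?sqr_ge0// lerDr sqr_ge0.
Qed.

End square_integrable.

Section fubini_toolbox.
Context d1 d2 (T1 : measurableType d1) (T2 : measurableType d2) (R : realType).
Variables (m1 : {sigma_finite_measure set T1 -> \bar R}).
Variables (m2 : {sigma_finite_measure set T2 -> \bar R}).

Lemma measurable_integral2 (f : T1 * T2 -> \bar R) : measurable_fun setT f ->
  measurable_fun setT (fun x => \int[m2]_y f (x, y))%E.
Proof.
move=> mf; rewrite (_ : (fun x => _) = (fun x => \int[m2]_y f^\+ (x, y) -
    \int[m2]_y f^\- (x, y))%E); last first.
  apply/funext => x; rewrite integralE.
  by congr (_ - _)%E; apply: eq_integral => y _; rewrite ?funeposE ?funenegE.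
apply: emeasurable_funB.
  apply: (measurable_fun_fubini_tonelli_F (m2 := m2) f^\+%E) => //.
  exact: measurable_funepos.
apply: (measurable_fun_fubini_tonelli_F (m2 := m2) f^\-%E) => //.
exact: measurable_funeneg.
Qed.

Lemma measurable_integral1 (f : T1 * T2 -> \bar R) : measurable_fun setT f ->
  measurable_fun setT (fun y => \int[m1]_x f (x, y))%E.
Proof.
move=> mf; rewrite (_ : (fun y => _) = (fun y => \int[m1]_x f^\+ (x, y) -
    \int[m1]_x f^\- (x, y))%E); last first.
  apply/funext => y; rewrite integralE.
  by congr (_ - _)%E; apply: eq_integral => x _; rewrite ?funeposE ?funenegE.
apply: emeasurable_funB.
  apply: (measurable_fun_fubini_tonelli_G (m1 := m1) f^\+%E) => //.
  exact: measurable_funepos.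
apply: (measurable_fun_fubini_tonelli_G (m1 := m1) f^\-%E) => //.
exact: measurable_funeneg.
Qed.

Lemma measurable_Rintegral2 (f : T1 * T2 -> R) : measurable_fun setT f ->
  measurable_fun setT (fun x => Rintegral m2 setT (fun y => f (x, y))).
Proof.
move=> /measurable_EFinP mf.
apply: (measurableT_comp (@fine_measurable R setT measurableT)) => //=.
exact: (measurable_integral2 mf).
Qed.

Lemma measurable_Rintegral1 (f : T1 * T2 -> R) : measurable_fun setT f ->
  measurable_fun setT (fun y => Rintegral m1 setT (fun x => f (x, y))).
Proof.
move=> /measurable_EFinP mf.
apply: (measurableT_comp (@fine_measurable R setT measurableT)) => //=.
exact: (measurable_integral1 mf).
Qed.

(** In Fubini's theorem the inner integral is finite only almost everywhere, and
    [fine] alters it on a null set. *)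
Lemma Rintegral_fine_integrable d (T : measurableType d)
    (m : {measure set T -> \bar R}) (F : T -> \bar R) : m.-integrable setT F ->
  (\int[m]_x F x)%E = (\int[m]_x (fine (F x))%:E)%E.
Proof.
move=> iF; apply: ae_eq_integral => //.
- exact: measurable_int iF.
- apply/measurable_EFinP; apply: measurableT_comp => //; exact: measurable_int iF.
- have := integrable_ae measurableT iF; apply: filterS => x /= Fx _.
  by rewrite fineK// Fx.
Qed.

Lemma Rintegral12_prod (f : T1 * T2 -> R) :
  (m1 \x m2)%E.-integrable setT (EFin \o f) ->
  Rintegral m1 setT (fun x => Rintegral m2 setT (fun y => f (x, y))) =
  Rintegral (m1 \x m2)%E setT f.
Proof.
move=> fi; have iF := integrable_fubini_F fi.
by congr fine; rewrite -(integral12_prod_meas1 fi) [RHS]Rintegral_fine_integrable.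
Qed.

Lemma Rintegral21_prod (f : T1 * T2 -> R) :
  (m1 \x m2)%E.-integrable setT (EFin \o f) ->
  Rintegral m2 setT (fun y => Rintegral m1 setT (fun x => f (x, y))) =
  Rintegral (m1 \x m2)%E setT f.
Proof.
move=> fi; have iG : m2.-integrable setT (fubini_G m1 (EFin \o f)).
  have mf := measurable_int _ fi; apply/integrableP; split.
    exact: (measurable_integral1 mf).
  apply: le_lt_trans ((integrable21ltyP m1 m2 mf).1 fi).
  apply: ge0_le_integral => //.
  - by apply: measurableT_comp => //; exact: (measurable_integral1 mf).
  - apply: (measurable_fun_fubini_tonelli_G (m1 := m1) (abse \o (EFin \o f))) => //=.
    exact: measurableT_comp.
  - by move=> y _; apply: le_abse_integral => //; exact: measurableT_comp mf (measurable_pair2 y).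
by congr fine; rewrite -(integral21_prod_meas1 fi) [RHS]Rintegral_fine_integrable.
Qed.

Lemma Rfubini (f : T1 * T2 -> R) :
  (m1 \x m2)%E.-integrable setT (EFin \o f) ->
  Rintegral m1 setT (fun x => Rintegral m2 setT (fun y => f (x, y))) =
  Rintegral m2 setT (fun y => Rintegral m1 setT (fun x => f (x, y))).
Proof. by move=> fi; rewrite Rintegral12_prod// Rintegral21_prod. Qed.

Lemma intg_prodM (f : T1 -> R) (g : T2 -> R) :
  m1.-integrable setT (EFin \o f) -> m2.-integrable setT (EFin \o g) ->
  (m1 \x m2)%E.-integrable setT (EFin \o (fun z => f z.1 * g z.2)).
Proof.
move=> fi gi; have mf := intg_measurable fi; have mg := intg_measurable gi.
apply/integrable12ltyP.
  apply/measurable_EFinP; apply: measurable_funM.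
    by apply: (measurableT_comp mf); exact: measurable_fst.
  by apply: (measurableT_comp mg); exact: measurable_snd.
under eq_integral => x _.
  under eq_integral do rewrite /= normrM EFinM.
  rewrite ge0_integralZl//; last first.
    by apply/measurable_EFinP; exact: measurableT_comp.
  over.
have /integrableP[_ fo] := fi; have /integrableP[_ go] := gi.
rewrite ge0_integralZr//; last 2 first.
- by apply/measurable_EFinP; exact: measurableT_comp.
- exact: integral_ge0.
by apply: lte_mul_pinfty => //; rewrite ?integral_ge0// ge0_fin_numE// integral_ge0.
Qed.

(** The form in which Fubini's theorem is applied to Fourier integrals: [k] is
    then built from sines and cosines. *)
Lemma Rfubini_bdd (f : T1 -> R) (g : T2 -> R) (k : T1 * T2 -> R) C :
  m1.-integrable setT (EFin \o f) -> m2.-integrable setT (EFin \o g) ->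
  measurable_fun setT k -> (forall z, `|k z| <= C) ->
  Rintegral m1 setT (fun x => f x * Rintegral m2 setT (fun y => g y * k (x, y))) =
  Rintegral m2 setT (fun y => g y * Rintegral m1 setT (fun x => f x * k (x, y))).
Proof.
move=> fi gi mk kC; have := Rfubini (intgMbdd (intg_prodM fi gi) mk kC) => /= E.
have gk x : m2.-integrable setT (EFin \o (fun y => g y * k (x, y))).
  by apply: (intgMbdd gi _ (fun y => kC (x, y))); exact: measurableT_comp mk (measurable_pair1 x).
have fk y : m1.-integrable setT (EFin \o (fun x => f x * k (x, y))).
  by apply: (intgMbdd fi _ (fun x => kC (x, y))); exact: measurableT_comp mk (measurable_pair2 y).
transitivity (Rintegral m1 setT (fun x => Rintegral m2 setT (fun y => f x * g y * k (x, y)))).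
  apply: eq_Rintegral => x _; rewrite -RintegralZl//.
  by apply: eq_Rintegral => y _; rewrite mulrA.
rewrite E; apply: eq_Rintegral => y _; rewrite -RintegralZl//.
by apply: eq_Rintegral => x _; rewrite mulrA [f x * _]mulrC.
Qed.

End fubini_toolbox.

Section trigonometric_kernels.
Context {R : realType}.
Implicit Types x : R.

Lemma norm_cos_le1 x : `|cos x| <= 1. Proof. by rewrite ler_norml cos_geN1 cos_le1. Qed.
Lemma norm_sin_le1 x : `|sin x| <= 1. Proof. by rewrite ler_norml sin_geN1 sin_le1. Qed.

Lemma measurable_cos : measurable_fun setT (@cos R).
Proof. by apply: continuous_measurable_fun; exact: continuous_cos. Qed.

Lemma measurable_sin : measurable_fun setT (@sin R).
Proof. by apply: continuous_measurable_fun; exact: continuous_sin. Qed.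

Lemma measurable_cosM2 : measurable_fun setT (fun z : R * R => cos (z.1 * z.2)).
Proof.
apply: (measurableT_comp measurable_cos).
by apply: measurable_funM; [exact: measurable_fst|exact: measurable_snd].
Qed.

Lemma measurable_sinM2 : measurable_fun setT (fun z : R * R => sin (z.1 * z.2)).
Proof.
apply: (measurableT_comp measurable_sin).
by apply: measurable_funM; [exact: measurable_fst|exact: measurable_snd].
Qed.

Lemma lebesgue_itv_lty (a b : R) : (@lebesgue_measure R (`[a, b]%classic : set R) < +oo)%E.
Proof. by rewrite lebesgue_measure_itv/=; case: ifPn; rewrite -?EFinD ltry. Qed.

End trigonometric_kernels.

(** * The Poisson kernel as a Fourier transform *)

Lemma is_derive1_continuous (R : realType) (f : R -> R) (x l : R) :
  is_derive x 1 f l -> {for x, continuous f}.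
Proof. by move=> [/derivable1_diffP/differentiable_continuous]. Qed.

Section poisson_kernel.
Let split_half {R : realType} (e I J P : R) : 2 / e + P = I + J ->
  4 / e = I + I -> J = P.
Proof. lra. Qed.

Context {R : realType}.
Local Notation leb := (@lebesgue_measure R).
Implicit Types (e t x d : R).

Let sqD_gt0 e t : 0 < e -> 0 < e ^+ 2 + t ^+ 2.
Proof. by move=> e0; rewrite ltr_wpDr ?sqr_ge0// exprn_gt0. Qed.

(** A primitive of [expR (- (e * x)) * (1 + cos (t * x))].  Adding [1] to the
    cosine makes the integrand nonnegative, so that its integral over a half line
    can be read off a primitive; the added term is known from the case [t = 0]. *)
Let abel_primitive e t x : R := - (expR (- (e * x)) / e) +
  expR (- (e * x)) * (t * sin (t * x) - e * cos (t * x)) / (e ^+ 2 + t ^+ 2).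

Let is_derive_abel_primitive e t x : 0 < e ->
  is_derive x 1 (abel_primitive e t) (expR (- (e * x)) * (1 + cos (t * x))).
Proof.
move=> e0; apply: is_derive_eq.
rewrite /GRing.scale /=; field.
by rewrite (gt_eqF e0) (gt_eqF (sqD_gt0 t e0)).
Qed.

Let cvg_expR_scale e : 0 < e -> expR (- (e * x)) @[x --> +oo] --> (0 : R).
Proof.
move=> e0; apply: (cvg_comp (fun x => e * x) (fun y => expR (- y))); last exact: cvgr_expR.
exact: (gt0_cvgMry e0 cvg_id).
Qed.

Let cvg_abel_primitive e t : 0 < e ->
  abel_primitive e t x @[x --> +oo] --> (0 : R).
Proof.
move=> e0; pose C := e^-1 + (`|t| + e) / (e ^+ 2 + t ^+ 2).
have cC : C * expR (- (e * x)) @[x --> +oo] --> (0 : R).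
  by rewrite -(mulr0 C); apply: cvgM; [exact: cvg_cst|exact: cvg_expR_scale].
apply/cvgr0Pnorm_le => d d0.
move/cvgr0Pnorm_le : cC => /(_ _ d0); apply: filterS => x; apply: le_trans.
rewrite normrM (gtr0_norm (expR_gt0 _)) ger0_norm; last first.
  by rewrite /C addr_ge0 ?invr_ge0 ?divr_ge0 ?addr_ge0 ?(ltW e0) ?sqr_ge0.
have -> : abel_primitive e t x = (- e^-1 + (t * sin (t * x) - e * cos (t * x)) /
    (e ^+ 2 + t ^+ 2)) * expR (- (e * x)).
  by rewrite /abel_primitive; ring.
rewrite normrM (gtr0_norm (expR_gt0 _)) ler_wpM2r ?expR_ge0//.
apply: (le_trans (ler_normD _ _)); rewrite normrN gtr0_norm ?invr_gt0// lerD2l.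
rewrite normrM (gtr0_norm (x := _^-1)) ?invr_gt0 ?sqD_gt0//.
rewrite ler_pM2r ?invr_gt0 ?sqD_gt0//.
apply: (le_trans (ler_normB _ _)); rewrite !normrM (gtr0_norm e0).
apply: lerD; first by rewrite ler_piMr// ler_norml sin_geN1 sin_le1.
by rewrite ler_piMr ?(ltW e0)// ler_norml cos_geN1 cos_le1.
Qed.

Let abel_fun e t x := expR (- (e * `|x|)) * (1 + cos (t * x)).

Let abel_fun_ge0 e t x : 0 <= abel_fun e t x.
Proof. by rewrite mulr_ge0 ?expR_ge0// -lerBlDl sub0r cos_geN1. Qed.

Let continuous_cosZ t : continuous (fun x => cos (t * x)).
Proof.
move=> x; apply: (@continuous_comp _ _ _ ( *%R t) cos); last exact: continuous_cos.
exact: mulrl_continuous.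
Qed.

Let continuous_expR_abs e : continuous (fun x => expR (- (e * `|x|))).
Proof.
move=> x; apply: (@continuous_comp _ _ _ (fun x => - (e * `|x|)) expR); last exact: continuous_expR.
apply: cvgN; apply: cvgM; first exact: cvg_cst.
exact: norm_continuous.
Qed.

Let continuous_abel_fun e t : continuous (abel_fun e t).
Proof.
rewrite /abel_fun => x; apply: cvgM; first exact: continuous_expR_abs.
by apply: cvgD; [exact: cvg_cst|exact: continuous_cosZ].
Qed.

Let integral_abel_fun e t : 0 < e ->
  (\int[leb]_x (abel_fun e t x)%:E = (2 / e + 2 * e / (e ^+ 2 + t ^+ 2))%:E)%E.
Proof.
move=> e0; rewrite ge0_symfun_integralT//; last first.
- by move=> x; rewrite /abel_fun /= normrN mulrN cosN.
rewrite -set_itvcy.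
have -> : (\int[leb]_(x in `[0%R, +oo[) (abel_fun e t x)%:E =
    \int[leb]_(x in `[0%R, +oo[) (expR (- (e * x)) * (1 + cos (t * x)))%:E)%E.
  apply: eq_integral => x; rewrite inE/= in_itv/= andbT => x0.
  by rewrite /abel_fun ger0_norm.
rewrite (@ge0_continuous_FTC2y _ _ (abel_primitive e t) 0 0).
- rewrite /abel_primitive !mulr0 oppr0 expR0 sin0 cos0 sub0e -EFinN -EFinM.
  congr EFin; field.
  by rewrite (gt_eqF e0) (gt_eqF (sqD_gt0 t e0)).
- by move=> x _; rewrite mulr_ge0 ?expR_ge0// -lerBlDl sub0r cos_geN1.
- apply: continuous_subspaceT => x; apply: cvgM.
    apply: (@continuous_comp _ _ _ (fun x => - (e * x)) expR); last exact: continuous_expR.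
    by apply: cvgN; exact: mulrl_continuous.
  by apply: cvgD; [exact: cvg_cst|exact: continuous_cosZ].
- exact: cvg_abel_primitive.
- by move=> x _; have [] := is_derive_abel_primitive t x e0.
- apply: cvg_at_right_filter.
  exact: (is_derive1_continuous (is_derive_abel_primitive t 0 e0)).
- by move=> x _; rewrite derive1E; have [_ ->] := is_derive_abel_primitive t x e0.
Qed.

(** The Fourier transform of [expR (- (e * `|x|))], by [Rintegral_abel]. *)
Definition poisson e t : R := 2 * e / (e ^+ 2 + t ^+ 2).

Lemma integrable_expR_abs e : 0 < e ->
  leb.-integrable setT (EFin \o (fun x => expR (- (e * `|x|)))).
Proof.
move=> e0.
have h : leb.-integrable setT (EFin \o abel_fun e 0).
  apply: intg_ge0P; last by rewrite integral_abel_fun// ltry.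
    by apply: continuous_measurable_fun; exact: continuous_abel_fun.
  exact: abel_fun_ge0.
apply: (intg_le _ h).
  by apply: continuous_measurable_fun; exact: continuous_expR_abs.
move=> x; rewrite ger0_norm ?expR_ge0// /abel_fun mul0r cos0.
by rewrite ler_peMr ?expR_ge0// lerDl.
Qed.

Lemma Rintegral_abel e t : 0 < e ->
  Rintegral leb setT (fun x => expR (- (e * `|x|)) * cos (t * x)) = poisson e t.
Proof.
move=> e0; have ie := integrable_expR_abs e0.
have icos s : leb.-integrable setT (EFin \o (fun x => expR (- (e * `|x|)) * cos (s * x))).
  apply: (@intgMbdd _ _ _ _ _ _ 1) => //.
    by apply: continuous_measurable_fun; exact: continuous_cosZ.
  by move=> x; rewrite ler_norml cos_geN1 cos_le1.
have E s : Rintegral leb setT (abel_fun e s) =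
    Rintegral leb setT (fun x => expR (- (e * `|x|))) +
    Rintegral leb setT (fun x => expR (- (e * `|x|)) * cos (s * x)).
  rewrite -RintegralD//.
  by apply: eq_Rintegral => x _; rewrite /abel_fun mulrDr mulr1.
have V s : Rintegral leb setT (abel_fun e s) = 2 / e + 2 * e / (e ^+ 2 + s ^+ 2).
  by rewrite /Rintegral integral_abel_fun.
have := E 0; rewrite V.
have -> : Rintegral leb setT (fun x => expR (- (e * `|x|)) * cos (0 * x)) =
    Rintegral leb setT (fun x => expR (- (e * `|x|))).
  by apply: eq_Rintegral => x _; rewrite mul0r cos0 mulr1.
have -> : 2 / e + 2 * e / (e ^+ 2 + 0 ^+ 2) = 4 / e.
  by rewrite expr0n addr0; field; rewrite (gt_eqF e0).
by have := E t; rewrite V => Et E0; exact: split_half Et E0.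
Qed.

Lemma poisson_ge0 e t : 0 < e -> 0 <= poisson e t.
Proof. by move=> e0; rewrite divr_ge0 ?mulr_ge0 ?ltW// sqD_gt0. Qed.

Lemma poisson_le e t : 0 < e -> `|poisson e t| <= 2 / e.
Proof.
move=> e0; rewrite ger0_norm ?poisson_ge0// /poisson ler_pdivrMr ?sqD_gt0//.
rewrite mulrDr (_ : 2 / e * e ^+ 2 = 2 * e); last by field; rewrite (gt_eqF e0).
by rewrite lerDl mulr_ge0 ?sqr_ge0// divr_ge0// ltW.
Qed.

Lemma poissonN e t : poisson e (- t) = poisson e t.
Proof. by rewrite /poisson sqrrN. Qed.

Lemma continuous_poisson e : 0 < e -> continuous (poisson e).
Proof.
rewrite /poisson => e0 x; apply: cvgM; first exact: cvg_cst.
apply: cvgV; first by rewrite gt_eqF ?sqD_gt0.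
apply: cvgD; first exact: cvg_cst.
exact: exprn_continuous.
Qed.

Lemma measurable_poisson e : 0 < e -> measurable_fun setT (poisson e).
Proof. by move=> e0; apply: continuous_measurable_fun; exact: continuous_poisson. Qed.

Let is_derive_poisson_primitive e x : 0 < e ->
  is_derive x 1 (fun x => 2 * atan (x / e)) (poisson e x).
Proof.
move=> e0; apply: is_derive_eq.
rewrite /poisson /GRing.scale /=; field.
by rewrite (gt_eqF e0) (gt_eqF (sqD_gt0 x e0)).
Qed.

Lemma integral_poisson e : 0 < e ->
  (\int[leb]_x (poisson e x)%:E = (2 * pi)%:E)%E.
Proof.
move=> e0; rewrite ge0_symfun_integralT//; last 3 first.
- by move=> x; exact: poisson_ge0.
- exact: continuous_poisson.
- by move=> x; rewrite /= poissonN.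
rewrite -set_itvcy.
rewrite (@ge0_continuous_FTC2y _ _ (fun x => 2 * atan (x / e)) 0 pi).
- by rewrite mul0r atan0 mulr0 sube0 -EFinM.
- by move=> x _; exact: poisson_ge0.
- by apply: continuous_subspaceT; exact: continuous_poisson.
- have -> : (pi : R) = 2 * (pi / 2) by field.
  apply: cvgM; first exact: cvg_cst.
  apply: (cvg_comp (fun x => x / e) atan); last exact: cvgy_atan.
  by apply: gt0_cvgMly => //; rewrite invr_gt0.
- by move=> x _; have [] := is_derive_poisson_primitive x e0.
- apply: cvg_at_right_filter.
  exact: (is_derive1_continuous (is_derive_poisson_primitive 0 e0)).
- by move=> x _; rewrite derive1E; have [_ ->] := is_derive_poisson_primitive x e0.
Qed.

Lemma integrable_poisson e : 0 < e ->
  leb.-integrable setT (EFin \o poisson e).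
Proof.
move=> e0; apply: intg_ge0P; first exact: measurable_poisson.
  by move=> t; exact: poisson_ge0.
by rewrite integral_poisson// ltry.
Qed.

(** At distance [d] from the origin the kernel is [O(e)] with respect to the fixed
    integrable function [poisson 1], so that its mass [2 * pi] concentrates at the
    origin as [e] tends to [0]. *)
Lemma poisson_far e d t : 0 < e -> 0 < d -> d <= `|t| ->
  poisson e t <= e * (1 + d^-2) * poisson 1 t.
Proof.
move=> e0 d0 dt; rewrite /poisson.
have d2 : d ^+ 2 <= t ^+ 2 by rewrite -(real_normK (num_real t)) lerXn2r ?nnegrE// ltW.
have dp : 0 < d ^+ 2 by rewrite exprn_gt0.
have tp : 0 < t ^+ 2 by exact: lt_le_trans d2.
have -> : e * (1 + d^-2) * (2 * 1 / (1 ^+ 2 + t ^+ 2)) =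
    2 * e * ((1 + d^-2) / (1 + t ^+ 2)) by rewrite expr1n; ring.
rewrite ler_pM2l; last by rewrite mulr_gt0.
apply: (@le_trans _ _ (t ^+ 2)^-1).
  by rewrite lef_pV2 ?posrE ?sqD_gt0// lerDr sqr_ge0.
rewrite ler_pdivlMr; last by rewrite ltr_wpDl// sqr_ge0.
rewrite mulrDr mulr1 mulVf ?gt_eqF// addrC lerD2l.
by rewrite lef_pV2.
Qed.

End poisson_kernel.

(** * Square-integrable approximation by continuous functions on the line *)

Section l2_translation.
Context {R : realType}.
Local Notation leb := (@lebesgue_measure R).
Implicit Types (a f g phi : R -> R) (M K t x e : R).

Lemma cvg0_near_lt (u : (\bar R)^nat) e : u @ \oo --> 0%E -> 0 < e ->
  \forall n \near \oo, (u n < e%:E)%E.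
Proof. move=> u0 e0; apply: (u0 (fun x : \bar R => (x < e%:E)%E)).
by apply: open_ereal_lt'; rewrite lte_fin. Qed.

Definition clip K x : R := Num.max (- K) (Num.min K x).

Lemma clip_norm K x : 0 <= K -> `|clip K x| <= K.
Proof.
move=> K0; rewrite ler_norml /clip le_max lexx/= ge_max ge_min lexx/= andbT.
by rewrite (le_trans _ K0)// oppr_le0.
Qed.

Lemma clip_id K x : `|x| <= K -> clip K x = x.
Proof. by rewrite ler_norml => /andP[h1 h2]; rewrite /clip min_r// max_r. Qed.

Lemma clip_lip K x y : 0 <= K -> `|clip K x - clip K y| <= `|x - y|.
Proof.
move=> K0; rewrite /clip /Num.max /Num.min.
by do !case: ifPn; rewrite ?ltNge ?negbK => *; rewrite ler_norml; apply/andP; split;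
  have := ler_norm (x - y); have := ler_norm (y - x); rewrite (distrC y x); lra.
Qed.

Lemma continuous_clip K : 0 <= K -> continuous (clip K).
Proof.
move=> K0 x; apply/cvgrPdist_le => e e0; near=> y.
apply: le_trans (clip_lip _ _ K0) _.
near: y; by apply: (@cvgr_dist_le _ _ _ _ _ _ _ (@cvg_id _ _)).
Unshelve. all: by end_near. Qed.

Lemma measurable_clip K : 0 <= K -> measurable_fun setT (clip K).
Proof. by move=> K0; apply: continuous_measurable_fun; exact: continuous_clip. Qed.

Section approximation.
Variables (a : R -> R) (M : R).
Hypotheses (ma : measurable_fun setT a) (aM : forall x, M < `|x| -> a x = 0).
Hypothesis a2 : (\int[leb]_x (a x ^+ 2)%:E < +oo)%E.

(** By dominated convergence, as clipping changes [a] by at most [|a|]. *)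
Let clip_approx e : 0 < e ->
  exists2 K, 0 <= K & (\int[leb]_x ((a x - clip K (a x)) ^+ 2)%:E < e%:E)%E.
Proof.
move=> e0; pose f_ n x := ((a x - clip n%:R (a x)) ^+ 2)%:E.
have mc n : measurable_fun setT (fun x => a x - clip n%:R (a x)).
  by apply: measurable_funB => //; apply: measurableT_comp => //; exact: measurable_clip.
have mf n : measurable_fun setT (f_ n).
  by apply/measurable_EFinP; apply: measurable_funX.
have [||||_ _] := @dominated_convergence _ _ _ leb setT measurableT f_ (cst 0%E) (fun x => (a x ^+ 2)%:E) mf.
- exact: measurable_cst.
- apply: aeW => x _; apply/cvg_ballP => d d0; near=> n.
  rewrite /f_ clip_id ?subrr ?expr0n; first exact: ballxx.
  near: n; exact: nbhs_infty_ger.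
- apply: intg_ge0P => //; first exact: measurable_funX.
  by move=> x; exact: sqr_ge0.
- apply: aeW => x n _; rewrite /f_ gee0_abs ?lee_fin ?sqr_ge0//.
  rewrite -(real_normK (num_real (a x))) -(real_normK (num_real (_ - _))).
  rewrite lerXn2r ?nnegrE// /clip /Num.max /Num.min.
  have n0 : (0 : R) <= n%:R by [].
  do !case: ifPn; rewrite ?ltNge ?negbK => *; rewrite ler_norml; apply/andP; split;
    have := ler_norm (a x); have := ler_norm (- a x); rewrite normrN; lra.
rewrite integral_cst// mul0e => /cvg0_near_lt /(_ e0)[N _ /(_ N (leqnn N))] /= h.
by exists N%:R.
Unshelve. all: by end_near. Qed.

(** A bounded function is close in [L1] to a continuous one, and the squared
    distance of two functions bounded by [K] is at most [2 * K] times their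
    distance.  Hence [a] is first clipped at a height [K], then approximated in
    [L1] and the approximation clipped at the same height. *)
Lemma continuous_l2_approx e : 0 < e -> exists phi K,
  [/\ continuous phi, forall x, `|phi x| <= K, forall x, M + 1 < `|x| -> phi x = 0 &
   (\int[leb]_x ((a x - phi x) ^+ 2)%:E < e%:E)%E].
Proof.
move=> e0; have e40 : 0 < e / 4 by rewrite divr_gt0.
have [K K0 aK] := clip_approx e40.
pose b x := clip K (a x).
have mb : measurable_fun setT b by apply: measurableT_comp => //; exact: measurable_clip.
have bK x : `|b x| <= K by exact: clip_norm.
have b0 x : M < `|x| -> b x = 0.
  by move=> /aM ax; rewrite /b ax clip_id// normr0.
pose E := `[- (M + 1), M + 1]%classic : set R.
have leE : (leb E < +oo)%E by exact: lebesgue_itv_lty.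
have ib : leb.-integrable E (EFin \o b).
  apply: measurable_bounded_integrable;
    [exact: measurable_itv|exact: leE|exact: measurable_funTS|].
  exists K; split; first exact: num_real.
  by move=> x Kx y _ /=; rewrite (le_trans (bK y))// ltW.
have [g_ [cg ig g0]] := approximation_continuous_integrable (measurable_itv _) leE ib.
have e8 : 0 < e / 4 / (2 * K + 1).
  by rewrite divr_gt0// ltr_wpDl// mulr_ge0.
have [N _ /(_ N (leqnn N))] /= := cvg0_near_lt g0 e8.
set g := g_ N => gN.
(* equal to [1] on [[-M, M]] and to [0] outside [[- (M + 1), M + 1]] *)
pose theta x := (1 + clip 1 (2 * (M + 1 - `|x|) - 1)) / 2.
have th01 x : 0 <= theta x <= 1.
  by have := clip_norm (2 * (M + 1 - `|x|) - 1) (@ler01 R); rewrite /theta ler_norml; lra.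
have thE x : `|x| <= M -> theta x = 1.
  move=> xM; rewrite /theta /clip min_l; last by lra.
  by rewrite max_r; [field|lra].
have th0 x : M + 1 < `|x| -> theta x = 0.
  move=> xM; rewrite /theta /clip max_l; first by field.
  by rewrite ge_min; apply/orP; right; lra.
have cth : continuous theta.
  move=> x; apply: cvgM; last exact: cvg_cst.
  apply: cvgD; first exact: cvg_cst.
  apply: (@continuous_comp _ _ _ (fun x => 2 * (M + 1 - `|x|) - 1) (clip 1)); last exact: continuous_clip.
  apply: cvgB; last exact: cvg_cst.
  apply: cvgM; first exact: cvg_cst.
  by apply: cvgB; [exact: cvg_cst|exact: norm_continuous].
pose psi x := clip K (g x).
have psiK x : `|psi x| <= K by exact: clip_norm.
have cpsi : continuous psi.
  by move=> x; apply: (@continuous_comp _ _ _ g (clip K)); [exact: cg|exact: continuous_clip].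
exists (fun x => theta x * psi x), K; split.
- by move=> x; apply: cvgM; [exact: cth|exact: cpsi].
- move=> x; rewrite normrM; have /andP[t0 t1] := th01 x.
  by rewrite (le_trans _ (psiK x))// ger0_norm// ler_piMl.
- by move=> x /th0 ->; rewrite mul0r.
have mphi : measurable_fun setT (fun x => theta x * psi x).
  by apply: measurable_funM; apply: continuous_measurable_fun.
have bphi x : (b x - theta x * psi x) ^+ 2 <= 2 * K * (\1_E x * `|b x - g x|).
  have /andP[t0 t1] := th01 x.
  have [xM1|xM1] := ltP (M + 1) `|x|.
    by rewrite th0// mul0r b0 ?subr0 ?expr0n; [rewrite !mulr_ge0|lra].
  rewrite indicE mem_set ?mul1r; last by rewrite /E/= in_itv/= -ler_norml.
  have h : `|b x - theta x * psi x| <= `|b x - g x|.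
    apply: (@le_trans _ _ `|b x - psi x|); last first.
      by rewrite -{1}(clip_id (bK x)); exact: clip_lip.
    have [xM|xM] := leP `|x| M; first by rewrite thE// mul1r.
    by rewrite b0// !sub0r !normrN normrM (ger0_norm t0) ler_piMl.
  have h2 : `|b x - theta x * psi x| <= 2 * K.
    rewrite (le_trans (ler_normB _ _))// mulr_natl mulr2n lerD// normrM (ger0_norm t0).
    by rewrite (le_trans _ (psiK x))// ler_piMl.
  rewrite -(real_normK (num_real (_ - _))) expr2.
  by apply: ler_pM.
have mg : measurable_fun setT g by apply: continuous_measurable_fun; exact: cg.
have mab : measurable_fun setT (fun x => (a x - b x) ^+ 2).
  by apply: measurable_funX; apply: measurable_funB.
have mbp : measurable_fun setT (fun x => (b x - theta x * psi x) ^+ 2).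
  by apply: measurable_funX; apply: measurable_funB.
have mbg : measurable_fun setT (fun x => \1_E x * `|b x - g x|).
  apply: measurable_funM; first by apply: measurable_indic; exact: measurable_itv.
  by apply: measurableT_comp => //; apply: measurable_funB.
have I1 : (\int[leb]_x ((b x - theta x * psi x) ^+ 2)%:E <= (e / 4)%:E)%E.
  apply: (@le_trans _ _ (\int[leb]_x (2 * K * (\1_E x * `|b x - g x|))%:E)%E).
    apply: (@ge0_le_integral_EFin _ _ R leb) => // [|x]; last exact: sqr_ge0.
    exact: measurable_funM.
  rewrite (@ge0_integral_EFinZ _ _ R leb)//; last by rewrite mulr_ge0.
  have -> : (\int[leb]_x (\1_E x * `|b x - g x|)%:E = \int[leb]_(x in E) `|(b x - g x)%:E|)%E.
    rewrite [RHS]integral_mkcond; apply: eq_integral => x _.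
    by rewrite patchE indicE; case: ifPn => _; rewrite ?mul1r ?mul0r.
  apply: (@le_trans _ _ ((2 * K)%:E * (e / 4 / (2 * K + 1))%:E)%E).
    by rewrite lee_wpmul2l ?lee_fin ?mulr_ge0// ltW.
  rewrite -EFinM lee_fin mulrCA ler_piMr ?(ltW e40)// ler_pdivrMr; last first.
    by rewrite ltr_wpDl// mulr_ge0.
  by rewrite mul1r lerDl.
apply: (@le_lt_trans _ _ (\int[leb]_x (2 * (a x - b x) ^+ 2 + 2 * (b x - theta x * psi x) ^+ 2)%:E)%E).
  apply: (@ge0_le_integral_EFin _ _ R leb).
  - by apply: measurable_funX; apply: measurable_funB.
  - by apply: measurable_funD; exact: measurable_funM.
  - by move=> x; exact: sqr_ge0.
  - by move=> x; have := sqr_ge0 ((a x - b x) - (b x - theta x * psi x)); lra.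
rewrite (@ge0_integral_EFinD _ _ R leb); last 4 first.
- exact: measurable_funM.
- exact: measurable_funM.
- by move=> x; rewrite mulr_ge0// sqr_ge0.
- by move=> x; rewrite mulr_ge0// sqr_ge0.
rewrite !(@ge0_integral_EFinZ _ _ R leb)//; last 2 first.
- by move=> x; exact: sqr_ge0.
- by move=> x; exact: sqr_ge0.
have -> : e%:E = (2%:E * (e / 4)%:E + 2%:E * (e / 4)%:E)%E.
  by rewrite -!EFinM -EFinD; congr EFin; field.
apply: lte_leD => //.
- rewrite fin_numM// ge0_fin_numE; last by apply: integral_ge0 => x _; rewrite lee_fin sqr_ge0.
  by rewrite (le_lt_trans I1)// ltry.
- by rewrite lte_pmul2l.
- by rewrite lee_pmul2l.
Unshelve. all: by end_near. Qed.

End approximation.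

End l2_translation.

(** * Plancherel's inequality on the line *)

Section l2_continuity.
Context {R : realType}.
Local Notation leb := (@lebesgue_measure R).
Implicit Types (a f g phi : R -> R) (M K t x e : R).

Lemma measurable_translate f t : measurable_fun setT f ->
  measurable_fun setT (fun x => f (x + t)).
Proof.
move=> mf; have [mt _] := lebesgue_translation t.
exact: (measurableT_comp mf mt).
Qed.

Lemma ge0_integral_translate f t : measurable_fun setT f -> (forall x, 0 <= f x) ->
  (\int[leb]_x (f (x + t))%:E = \int[leb]_x (f x)%:E)%E.
Proof.
move=> mf f0; rewrite [RHS](ge0_integral_preserving (lebesgue_translation t))//.
  exact/measurable_EFinP.
Qed.

Lemma intg_indic_itv r s : leb.-integrable setT (EFin \o (\1_(`[r, s]%classic : set R) : R -> R)).
Proof. exact: (integrable_indic_itv r s true false). Qed.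

(** By contradiction along a sequence of translations tending to [0], to which
    dominated convergence applies. *)
Lemma continuous_l2_translation phi K M e : continuous phi ->
  (forall x, `|phi x| <= K) -> (forall x, M < `|x| -> phi x = 0) -> 0 < e ->
  exists2 d, 0 < d & forall t, `|t| < d ->
    (\int[leb]_x ((phi (x + t) - phi x) ^+ 2)%:E < e%:E)%E.
Proof.
move=> cphi phiK phiM e0; apply: contrapT => H.
have K0 : 0 <= K by rewrite (le_trans _ (phiK 0)).
have {H} /choice[u uP] n : exists t, `|t| < n.+1%:R^-1 /\
    ~ (\int[leb]_x ((phi (x + t) - phi x) ^+ 2)%:E < e%:E)%E.
  apply: contrapT => /forallNP h; apply: H; exists n.+1%:R^-1 => // t tn.
  by apply: contrapT => th; exact: (h t).
have u0 : u @ \oo --> (0 : R).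
  apply/cvgrPdist_lt => d d0; near=> n; rewrite sub0r normrN.
  apply: lt_trans (uP n).1 _; near: n; exact: (near_infty_natSinv_lt (PosNum d0)).
have mphi : measurable_fun setT phi by apply: continuous_measurable_fun.
have mu n : measurable_fun setT (fun x => ((phi (x + u n) - phi x) ^+ 2)%:E).
  apply/measurable_EFinP; apply: measurable_funX; apply: measurable_funB => //.
  exact: measurable_translate.
pose E := `[- (M + 1), M + 1]%classic : set R.
have mE : measurable E by exact: measurable_itv.
have leE : (leb E < +oo)%E by exact: lebesgue_itv_lty.
have [||||_ _] := @dominated_convergence _ _ _ leb setT measurableT
   (fun n x => ((phi (x + u n) - phi x) ^+ 2)%:E) (cst 0%E)
   (fun x => ((2 * K) ^+ 2 * \1_E x)%:E) mu.
- exact: measurable_cst.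
- apply: aeW => x _; apply: cvg_EFin; first by apply: nearW.
  rewrite (_ : 0 = (phi (x + 0) - phi x) ^+ 2); last by rewrite addr0 subrr expr0n.
  apply: (@cvg_comp _ _ _ (fun n => phi (x + u n) - phi x) (fun y => y ^+ 2)); last exact: exprn_continuous.
  apply: cvgB; last exact: cvg_cst.
  apply: (@cvg_comp _ _ _ (fun n => x + u n) phi); last exact: cphi.
  by apply: cvgD => //; exact: cvg_cst.
- exact: intgZ (intg_indic_itv _ _).
- apply: aeW => x n _; rewrite gee0_abs ?lee_fin ?sqr_ge0//.
  rewrite indicE; have [xE|xE] := boolP (x \in E).
    rewrite mulr1 -(real_normK (num_real (_ - _))) lerXn2r ?nnegrE ?mulr_ge0//.
    by rewrite (le_trans (ler_normB _ _))// mulr_natl mulr2n lerD.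
  have xM : M + 1 < `|x|.
    by rewrite ltNge ler_norml; apply: contra xE => h; rewrite inE /E/= in_itv.
  rewrite (phiM x); last by lra.
  rewrite (phiM (x + u n)) ?subr0 ?expr0n ?mulr0//.
  have u1 : `|u n| < 1 by apply: lt_le_trans (uP n).1 _; rewrite invf_le1// ler1n.
  have := ler_normB (x + u n) (u n); rewrite addrK; lra.
rewrite integral_cst// mul0e => /cvg0_near_lt /(_ e0)[N _ /(_ N (leqnn N))] /= h.
by have [_] := uP N; apply.
Unshelve. all: by end_near. Qed.

Variables (a : R -> R) (M : R).
Hypotheses (ma : measurable_fun setT a) (aM : forall x, M < `|x| -> a x = 0).
Hypothesis a2 : (\int[leb]_x (a x ^+ 2)%:E < +oo)%E.

(** Three terms: [a] is replaced by a continuous function on both sides, and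
    translation preserves the error of this replacement. *)
Lemma l2_translation e : 0 < e -> exists2 d, 0 < d & forall t, `|t| < d ->
  (\int[leb]_x ((a (x + t) - a x) ^+ 2)%:E < e%:E)%E.
Proof.
move=> e0; have e9 : 0 < e / 9 by rewrite divr_gt0.
have [phi [K [cphi phiK phiM I1]]] := continuous_l2_approx ma aM a2 e9.
have [d d0 I2] := continuous_l2_translation cphi phiK phiM e9.
exists d => // t /I2 {}I2.
have mphi : measurable_fun setT phi by apply: continuous_measurable_fun.
pose f1 x := (a x - phi x) ^+ 2.
pose f2 x := (phi (x + t) - phi x) ^+ 2.
have mf1 : measurable_fun setT f1 by apply: measurable_funX; apply: measurable_funB.
have mf2 : measurable_fun setT f2.
  by apply: measurable_funX; apply: measurable_funB => //; exact: measurable_translate.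
have mf1t := measurable_translate t mf1.
have f1i : leb.-integrable setT (EFin \o f1).
  by apply: intg_ge0P => //; [move=> x; exact: sqr_ge0|exact: lt_trans I1 (ltry _)].
have f2i : leb.-integrable setT (EFin \o f2).
  by apply: intg_ge0P => //; [move=> x; exact: sqr_ge0|exact: lt_trans I2 (ltry _)].
have E1t : (\int[leb]_x (f1 (x + t))%:E = \int[leb]_x (f1 x)%:E)%E.
  by apply: ge0_integral_translate => // x; exact: sqr_ge0.
have f1ti : leb.-integrable setT (EFin \o (fun x => f1 (x + t))).
  apply: intg_ge0P => //; first by move=> x; exact: sqr_ge0.
  by rewrite E1t; exact: lt_trans I1 (ltry _).
have R1 : (Rintegral leb setT f1 < e / 9) by rewrite -lte_fin EFin_Rintegral.
have R1t : (Rintegral leb setT (fun x => f1 (x + t)) < e / 9).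
  by rewrite -lte_fin EFin_Rintegral// E1t.
have R2 : (Rintegral leb setT f2 < e / 9) by rewrite -lte_fin EFin_Rintegral.
have f3i := intgZ 3 (intgD (intgD f1ti f2i) f1i).
apply: (@le_lt_trans _ _ (\int[leb]_x (3 * (f1 (x + t) + f2 x + f1 x))%:E)%E).
  apply: ge0_le_integral => //.
  - by move=> x _; rewrite lee_fin sqr_ge0.
  - apply/measurable_EFinP; apply: measurable_funX; apply: measurable_funB => //.
    exact: measurable_translate.
  - by apply/measurable_EFinP; exact: intg_measurable f3i.
  - move=> x _; rewrite lee_fin /f1 /f2.
    set A := a (x + t); set B := phi (x + t); set C := phi x; set D := a x.
    have := sqr_ge0 ((A - B) - (B - C)); have := sqr_ge0 ((A - B) - (C - D)).
    have := sqr_ge0 ((B - C) - (C - D)); lra.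
rewrite -EFin_Rintegral// lte_fin RintegralZl//; last exact: intgD (intgD f1ti f2i) f1i.
rewrite RintegralD//; last exact: intgD.
rewrite RintegralD//; lra.
Qed.

End l2_continuity.

Section plancherel_line.
Context {R : realType}.
Local Notation leb := (@lebesgue_measure R).
Variables (a : R -> R) (M : R).
Hypotheses (ma : measurable_fun setT a) (aM : forall x, M < `|x| -> a x = 0).
Hypothesis a2 : (\int[leb]_x (a x ^+ 2)%:E < +oo)%E.

Let a2i : leb.-integrable setT (EFin \o (fun x => a x ^+ 2)).
Proof.
by apply: intg_ge0P => //; [exact: measurable_funX|move=> x; exact: sqr_ge0].
Qed.

Let L := Rintegral leb setT (fun x => a x ^+ 2).

Let ai : leb.-integrable setT (EFin \o a).
Proof.
apply: (@intg_of_sqr _ _ R leb a ma _ a2i (measurable_itv _) (lebesgue_itv_lty (- M) M)) => x xE.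
by apply: aM; rewrite ltNge ler_norml; apply/negP => h; apply: xE; rewrite /= in_itv.
Qed.

Let autocorr t := Rintegral leb setT (fun x => a x * a (x + t)).

Let translate_sq t : leb.-integrable setT (EFin \o (fun x => a (x + t) ^+ 2)) /\
  Rintegral leb setT (fun x => a (x + t) ^+ 2) = L.
Proof.
have ms : measurable_fun setT (fun x => a x ^+ 2) by exact: measurable_funX.
have s0 x : 0 <= a x ^+ 2 by exact: sqr_ge0.
have E := ge0_integral_translate t ms s0.
split; last by rewrite /L /Rintegral E.
apply: intg_ge0P => //; last by rewrite E.
exact: measurable_translate t ms.
Qed.

Let autocorrE t : leb.-integrable setT (EFin \o (fun x => a x * a (x + t))) /\
  leb.-integrable setT (EFin \o (fun x => (a (x + t) - a x) ^+ 2)) /\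
  autocorr t = L - 2^-1 * Rintegral leb setT (fun x => (a (x + t) - a x) ^+ 2).
Proof.
have [ti tE] := translate_sq t.
have mat := measurable_translate t ma.
have i1 : leb.-integrable setT (EFin \o (fun x => (a (x + t) - a x) ^+ 2)).
  apply: (intg_le _ (intgZ 2 (intgD ti a2i))).
    by apply: measurable_funX; apply: measurable_funB.
  move=> x; rewrite ger0_norm ?sqr_ge0//.
  have := sqr_ge0 (a (x + t) + a x); lra.
have i2 : leb.-integrable setT (EFin \o (fun x => a x * a (x + t))).
  apply: (intg_le _ (intgD ti a2i)); first exact: measurable_funM.
  move=> x /=; have := sqr_ge0 (a (x + t) - a x); have := sqr_ge0 (a (x + t) + a x).
  have := sqr_ge0 (a (x + t)); have := sqr_ge0 (a x).
  by rewrite ler_norml => *; apply/andP; split; lra.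
split => //; split => //.
have : Rintegral leb setT (fun x => (a (x + t) - a x) ^+ 2) =
  Rintegral leb setT (fun x => a (x + t) ^+ 2 + a x ^+ 2) - Rintegral leb setT (fun x => 2 * (a x * a (x + t))).
  rewrite -RintegralB//; last 2 first.
  - exact: intgD.
  - exact: intgZ.
  by apply: eq_Rintegral => x _; ring.
rewrite RintegralD// RintegralZl// tE -/L -/(autocorr t); lra.
Qed.

Let L_ge0 : 0 <= L. Proof. by apply: Rintegral_ge0 => x _; exact: sqr_ge0. Qed.

Let autocorr_geN t : - L <= autocorr t.
Proof.
have [ti tE] := translate_sq t; have [i2 _] := autocorrE t.
have : 0 <= Rintegral leb setT (fun x => (2^-1 * (a (x + t) ^+ 2 + a x ^+ 2)) + a x * a (x + t)).
  by apply: Rintegral_ge0 => x _; have := sqr_ge0 (a (x + t) + a x); lra.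
rewrite RintegralD//; last exact: intgZ (intgD ti a2i).
rewrite RintegralZl//; last exact: intgD.
rewrite RintegralD// tE -/L -/(autocorr t); lra.
Qed.

(** By [autocorrE] the defect [L - autocorr t] is half the squared distance of [a]
    to its translate. *)
Let autocorr_near e : 0 < e -> exists2 d, 0 < d & forall t, `|t| < d -> L - e <= autocorr t.
Proof.
move=> e0; have [d d0 h] := l2_translation ma aM a2 e0; exists d => // t /h.
have [_ [i1 ->]] := autocorrE t.
rewrite -EFin_Rintegral// lte_fin; lra.
Qed.

Let Ac xi := Rintegral leb setT (fun x => a x * cos (x * xi)).
Let As xi := Rintegral leb setT (fun x => a x * sin (x * xi)).

Let mAc : measurable_fun setT Ac.
Proof.
apply: (@measurable_Rintegral1 _ _ _ _ R leb (fun z : R * R => a z.1 * cos (z.1 * z.2))).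
apply: measurable_funM; last exact: measurable_cosM2.
by apply: (measurableT_comp ma); exact: measurable_fst.
Qed.

Let mAs : measurable_fun setT As.
Proof.
apply: (@measurable_Rintegral1 _ _ _ _ R leb (fun z : R * R => a z.1 * sin (z.1 * z.2))).
apply: measurable_funM; last exact: measurable_sinM2.
by apply: (measurableT_comp ma); exact: measurable_fst.
Qed.

Let icos xi : leb.-integrable setT (EFin \o (fun x => a x * cos (x * xi))).
Proof.
apply: (intgMbdd (C := 1) ai); last by move=> x; rewrite ler_norml cos_geN1 cos_le1.
exact: (measurableT_comp measurable_cosM2 (measurable_pair2 xi)).
Qed.

Let isin xi : leb.-integrable setT (EFin \o (fun x => a x * sin (x * xi))).
Proof.
apply: (intgMbdd (C := 1) ai); last by move=> x; rewrite ler_norml sin_geN1 sin_le1.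
exact: (measurableT_comp measurable_sinM2 (measurable_pair2 xi)).
Qed.

Let inner x xi : Rintegral leb setT (fun y => a y * cos ((x - y) * xi)) =
  cos (x * xi) * Ac xi + sin (x * xi) * As xi.
Proof.
rewrite -[_ * Ac xi]RintegralZl// -[_ * As xi]RintegralZl// -RintegralD//; last 2 first.
- exact: intgZ (icos xi).
- exact: intgZ (isin xi).
by apply: eq_Rintegral => y _; rewrite mulrBl cosB; ring.
Qed.

Let A1 := Rintegral leb setT (fun x => `|a x|).

Let Ac_le xi : `|Ac xi| <= A1.
Proof.
apply: (le_trans (le_normr_Rintegral _ (icos xi))) => //.
apply: le_Rintegral => //; [exact: integrable_norm (icos xi)|exact: integrable_norm ai|].
by move=> x _; rewrite normrM ler_piMr// ler_norml cos_geN1 cos_le1.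
Qed.

Let As_le xi : `|As xi| <= A1.
Proof.
apply: (le_trans (le_normr_Rintegral _ (isin xi))) => //.
apply: le_Rintegral => //; [exact: integrable_norm (isin xi)|exact: integrable_norm ai|].
by move=> x _; rewrite normrM ler_piMr// ler_norml sin_geN1 sin_le1.
Qed.

Let spectral xi := Ac xi ^+ 2 + As xi ^+ 2.

Let mspectral : measurable_fun setT spectral.
Proof. by apply: measurable_funD; exact: measurable_funX. Qed.

Let spectral_ge0 xi : 0 <= spectral xi.
Proof. by rewrite addr_ge0 ?sqr_ge0. Qed.

Let spectralE xi : spectral xi = Rintegral leb setT (fun x => a x *
  (cos (x * xi) * Ac xi + sin (x * xi) * As xi)).
Proof.
transitivity (Rintegral leb setT (fun x => Ac xi * (a x * cos (x * xi)) +
  As xi * (a x * sin (x * xi)))); last by apply: eq_Rintegral => x _; ring.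
rewrite RintegralD//; [|exact: intgZ (icos xi)|exact: intgZ (isin xi)].
by rewrite RintegralZl// RintegralZl// /spectral !expr2.
Qed.

Let spectral_le xi : `|spectral xi| <= A1 ^+ 2 + A1 ^+ 2.
Proof.
have h y : `|y| <= A1 -> y ^+ 2 <= A1 ^+ 2.
  move=> yA; rewrite -(real_normK (num_real y)) lerXn2r ?nnegrE//.
  exact: le_trans yA.
by rewrite ger0_norm//; apply: lerD; apply: h.
Qed.

(** The factor [expR (- (e * `|xi|))] makes all exchanges of integrals legitimate;
    integrating it first against the cosine of [(x - y) * xi] produces the Poisson
    kernel at [x - y]. *)
Let damped_spectral e : 0 < e ->
  Rintegral leb setT (fun xi => expR (- (e * `|xi|)) * spectral xi) =
  Rintegral leb setT (fun t => poisson e t * autocorr t).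
Proof.
move=> e0; have ei := integrable_expR_abs e0; have pi := integrable_poisson e0.
transitivity (Rintegral leb setT (fun xi => expR (- (e * `|xi|)) *
    Rintegral leb setT (fun x => a x *
      (cos (x * xi) * Ac xi + sin (x * xi) * As xi)))).
  by apply: eq_Rintegral => xi _; rewrite spectralE.
have -> := @Rfubini_bdd _ _ _ _ R leb leb _ a
   (fun z : R * R => cos (z.2 * z.1) * Ac z.1 + sin (z.2 * z.1) * As z.1) (A1 + A1) ei ai.
- transitivity (Rintegral leb setT (fun x => a x *
      Rintegral leb setT (fun t => poisson e t * a (x + t)))).
    apply: eq_Rintegral => x _; congr (_ * _).
    transitivity (Rintegral leb setT (fun xi => expR (- (e * `|xi|)) *
        Rintegral leb setT (fun y => a y * cos ((x - y) * xi)))).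
      by apply: eq_Rintegral => xi _; rewrite inner.
    have -> := @Rfubini_bdd _ _ _ _ R leb leb _ a
      (fun z : R * R => cos ((x - z.2) * z.1)) 1 ei ai.
    + transitivity (Rintegral leb setT (fun y => a y * poisson e (y - x))).
        by apply: eq_Rintegral => y _; rewrite /= Rintegral_abel// -poissonN opprB.
      rewrite (Rintegral_preserving (lebesgue_translation x)).
        by apply: eq_Rintegral => y _; rewrite /= addrK mulrC [y + x]addrC.
      apply: measurable_funM => //.
      exact: measurable_translate (- x) (measurable_poisson e0).
    + apply: (measurableT_comp measurable_cos).
      apply: measurable_funM; last exact: measurable_fst.
      by apply: measurable_funB => //; exact: measurable_snd.
    + by move=> z; rewrite ler_norml cos_geN1 cos_le1.
  have ip : (leb \x leb)%E.-integrable setT (EFin \o (fun z : R * R => a z.1 * (poisson e z.2 * a (z.1 + z.2)))).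
    have maa : measurable_fun setT (fun z : R * R => a (z.1 + z.2)).
      apply: (measurableT_comp ma); apply: measurable_funD.
        exact: measurable_fst.
      exact: measurable_snd.
    have ma1 : measurable_fun setT (fun z : R * R => a z.1).
      by apply: (measurableT_comp ma); exact: measurable_fst.
    have mp2 : measurable_fun setT (fun z : R * R => poisson e z.2).
      by apply: (measurableT_comp (measurable_poisson e0)); exact: measurable_snd.
    have ii : (leb \x leb)%E.-integrable setT (EFin \o (fun z : R * R => a z.1 * a (z.1 + z.2))).
      apply/integrable12ltyP; first by apply/measurable_EFinP; exact: measurable_funM.
      apply: (@le_lt_trans _ _ (\int[leb]_x (`|a x|%:E * A1%:E))%E).
        apply: ge0_le_integral => //.
        - by move=> x _; apply: integral_ge0.
        - apply: (measurable_fun_fubini_tonelli_F (m2 := leb) (fun z : R * R => `|(a z.1 * a (z.1 + z.2))%:E|%E)) => //.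
          by apply: measurableT_comp => //; apply/measurable_EFinP; exact: measurable_funM.
        - by apply: emeasurable_funM => //; apply/measurable_EFinP; exact: measurableT_comp.
        - move=> x _.
          under eq_integral do rewrite /= normrM EFinM.
          rewrite ge0_integralZl//; last first.
            apply/measurable_EFinP; apply: measurableT_comp => //.
            exact: (measurableT_comp maa (measurable_pair1 x)).
          rewrite lee_wpmul2l// /A1 EFin_Rintegral; last exact: integrable_norm ai.
          rewrite -(ge0_integral_translate x (f := fun y => `|a y|))//; last exact: measurableT_comp.
          by under eq_integral do rewrite addrC.
      rewrite ge0_integralZr//; last 2 first.
      - by apply/measurable_EFinP; exact: measurableT_comp.
      - by rewrite lee_fin; exact: Rintegral_ge0.
      rewrite -EFin_Rintegral; last exact: integrable_norm ai.
      by rewrite -EFinM ltry.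
    rewrite (_ : (fun z : R * R => _) = (fun z : R * R => a z.1 * a (z.1 + z.2) * poisson e z.2)).
      exact: intgMbdd ii mp2 (fun z => poisson_le z.2 e0).
    by apply/funext => z; ring.
  transitivity (Rintegral leb setT (fun x =>
      Rintegral leb setT (fun t => a x * (poisson e t * a (x + t))))).
    apply: eq_Rintegral => x _; rewrite -RintegralZl//.
    have -> : (fun t => poisson e t * a (x + t)) = (fun t => a (t + x) * poisson e t).
      by apply/funext => t; rewrite mulrC addrC.
    apply: (intgMbdd (C := 2 / e)); [|exact: measurable_poisson|move=> t; exact: poisson_le].
    have /= := integrable_preserving (lebesgue_translation x) (f := EFin \o a).
    by move=> [|+ _]; [exact/measurable_EFinP|apply].
  rewrite (Rfubini ip) /=.
  apply: eq_Rintegral => t _; rewrite -RintegralZl//; last by have [] := autocorrE t.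
  by apply: eq_Rintegral => x _; ring.
- apply: measurable_funD; apply: measurable_funM.
  + apply: (measurableT_comp measurable_cos).
    by apply: measurable_funM; [exact: measurable_snd|exact: measurable_fst].
  + by apply: (measurableT_comp mAc); exact: measurable_fst.
  + apply: (measurableT_comp measurable_sin).
    by apply: measurable_funM; [exact: measurable_snd|exact: measurable_fst].
  + by apply: (measurableT_comp mAs); exact: measurable_fst.
- move=> z; rewrite (le_trans (ler_normD _ _))// !normrM; apply: lerD.
    by rewrite (le_trans _ (Ac_le z.1))// ler_piMl// ler_norml cos_geN1 cos_le1.
  by rewrite (le_trans _ (As_le z.1))// ler_piMl// ler_norml sin_geN1 sin_le1.
Qed.

Let autocorr_le t : `|autocorr t| <= L.
Proof.
rewrite ler_norml autocorr_geN/=; have [_ [_ ->]] := autocorrE t.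
rewrite gerBl mulr_ge0//; apply: Rintegral_ge0 => x _; exact: sqr_ge0.
Qed.

Let mautocorr : measurable_fun setT autocorr.
Proof.
apply: (@measurable_Rintegral1 _ _ _ _ R leb (fun z : R * R => a z.1 * a (z.1 + z.2))).
apply: measurable_funM; first by apply: (measurableT_comp ma); exact: measurable_fst.
apply: (measurableT_comp ma); apply: measurable_funD; first exact: measurable_fst.
exact: measurable_snd.
Qed.

(** On [|t| < d] the autocorrelation is at least [L - eta]; elsewhere it is at
    least [- L], where the kernel is small by [poisson_far]. *)
Let spectral_lower e eta d : 0 < e -> 0 < eta -> 0 < d ->
  (forall t, `|t| < d -> L - eta <= autocorr t) ->
  (((L - eta) * (2 * pi) - 2 * L * (e * (1 + d^-2)) * (2 * pi))%:E <=
   \int[leb]_xi (spectral xi)%:E)%E.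
Proof.
move=> e0 eta0 d0 near.
have pe := integrable_poisson e0; have p1 := integrable_poisson (@ltr01 R).
have Ipe : Rintegral leb setT (poisson e) = 2 * pi by rewrite /Rintegral integral_poisson.
have Ip1 : Rintegral leb setT (poisson (1 : R)) = 2 * pi by rewrite /Rintegral integral_poisson.
have -> : (L - eta) * (2 * pi) - 2 * L * (e * (1 + d^-2)) * (2 * pi) =
    Rintegral leb setT (fun t => (L - eta) * poisson e t - (2 * L * (e * (1 + d^-2))) * poisson 1 t).
  rewrite RintegralB//; [|exact: intgZ pe|exact: intgZ p1].
  by rewrite (RintegralZ _ pe) (RintegralZ _ p1) Ipe Ip1.
apply: (@le_trans _ _ (Rintegral leb setT (fun t => poisson e t * autocorr t))%:E).
  rewrite lee_fin; apply: le_Rintegral => //.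
  - exact: intgB (intgZ _ pe) (intgZ _ p1).
  - exact: intgMbdd pe mautocorr autocorr_le.
  - move=> t _; have P0 := poisson_ge0 t e0; have Q0 := poisson_ge0 t (@ltr01 R).
    have e1 : 0 <= e * (1 + d^-2).
      by rewrite mulr_ge0 ?(ltW e0)// addr_ge0// invr_ge0 exprn_ge0// ltW.
    have [td|td] := ltP `|t| d.
      have := near _ td => h.
      apply: (@le_trans _ _ ((L - eta) * poisson e t)).
        by rewrite gerBl mulr_ge0// mulr_ge0// mulr_ge0.
      by rewrite mulrC ler_wpM2l.
    have h := autocorr_geN t; have := poisson_far e0 d0 td => h2.
    have h3 : 0 <= poisson e t * (autocorr t + L) by rewrite mulr_ge0//; lra.
    have h4 : 0 <= 2 * L * (e * (1 + d^-2) * poisson 1 t - poisson e t).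
      by rewrite !mulr_ge0// subr_ge0.
    have h5 : 0 <= eta * poisson e t by rewrite mulr_ge0// ltW.
    move: h3 h4 h5; set X := e * (1 + _); lra.
rewrite -damped_spectral// EFin_Rintegral; last first.
  exact: intgMbdd (integrable_expR_abs e0) mspectral spectral_le.
apply: ge0_le_integral => //.
- by move=> xi _; rewrite lee_fin mulr_ge0// expR_ge0.
- apply/measurable_EFinP; apply: intg_measurable.
  exact: intgMbdd (integrable_expR_abs e0) mspectral spectral_le.
- exact/measurable_EFinP.
- move=> xi _; rewrite lee_fin ler_piMl// expR_le1 oppr_le0.
  by rewrite mulr_ge0// ltW.
Qed.

(** Undamping increases the integral, and the lower bound of [spectral_lower] tends
    to [2 * pi * L] when [eta], and then [e] for the resulting [d], tend to [0]. *)
Lemma plancherel_line_real :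
  ((2 * pi)%:E * \int[leb]_x (a x ^+ 2)%:E <= \int[leb]_xi (
    Rintegral leb setT (fun x => a x * cos (x * xi)) ^+ 2 +
    Rintegral leb setT (fun x => a x * sin (x * xi)) ^+ 2)%:E)%E.
Proof.
rewrite -EFin_Rintegral// -/L -EFinM.
have I0 : (0 <= \int[leb]_xi (spectral xi)%:E)%E.
  by apply: integral_ge0 => x _; rewrite lee_fin.
rewrite -/(Ac _) -/(As _) -[leRHS]/(\int[leb]_xi (spectral xi)%:E)%E.
rewrite leNgt; apply/negP => H.
move: I0 H spectral_lower; case: (\int[leb]_xi _)%E => [r r0|_|//]; last first.
  by rewrite ltNge leey.
rewrite lte_fin => rL low.
pose D := 2 * pi * L - r; have D0 : 0 < D by rewrite /D subr_gt0.
have p0 : 0 < (pi : R) := pi_gt0 R.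
have eta0 : 0 < D / (8 * pi) by rewrite divr_gt0// mulr_gt0.
have [d d0 near] := autocorr_near eta0.
pose X := 2 * L * (1 + d^-2) * (2 * pi).
have X0 : 0 <= X.
  rewrite /X !mulr_ge0//; last exact: ltW.
  by rewrite addr_ge0// invr_ge0 exprn_ge0// ltW.
have e0 : 0 < D / (4 * (X + 1)) by rewrite divr_gt0// mulr_gt0// ltr_wpDl.
have := low _ _ _ e0 eta0 d0 near; rewrite lee_fin.
have -> : (L - D / (8 * pi)) * (2 * pi) = 2 * pi * L - D / 4.
  by move: (pi : R) p0 => p p0; field; rewrite (gt_eqF p0).
have -> : 2 * L * (D / (4 * (X + 1)) * (1 + d^-2)) * (2 * pi) = D / 4 * (X / (X + 1)).
  have : X + 1 != 0 by rewrite gt_eqF// ltr_wpDl.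
  move: (X + 1) => Y Y0; rewrite /X; move: (1 + _) (pi : R) => q p.
  by field.
have : X / (X + 1) <= 1 by rewrite ler_pdivrMr ?ltr_wpDl// mul1r lerDl.
have D4 : 0 < D / 4 by rewrite divr_gt0.
move=> /(ler_wpM2l (ltW D4)); rewrite mulr1.
move: (D / 4 * _) => Y; rewrite {1}/D in D4 *; rewrite /D; lra.
Qed.

End plancherel_line.

Section plancherel_line_complex.
Context {R : realType}.
Local Notation leb := (@lebesgue_measure R).
Variables (a b : R -> R) (M : R).
Hypotheses (ma : measurable_fun setT a) (mb : measurable_fun setT b).
Hypotheses (aM : forall x, M < `|x| -> a x = 0) (bM : forall x, M < `|x| -> b x = 0).
Hypothesis ab2 : (\int[leb]_x (a x ^+ 2 + b x ^+ 2)%:E < +oo)%E.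

Let a2i := @sqr_intgl _ _ R leb a b ma mb ab2.
Let b2i := @sqr_intgr _ _ R leb a b ma mb ab2.

Let suppE f : (forall x, M < `|x| -> f x = 0) -> forall x, ~ `[- M, M]%classic x -> f x = 0 :> R.
Proof.
move=> fM x /negP xE; apply: fM; rewrite ltNge; apply: contra xE.
by rewrite ler_norml /= in_itv.
Qed.

Lemma intg_line_l : leb.-integrable setT (EFin \o a).
Proof.
exact: (@intg_of_sqr _ _ R leb a ma _ a2i (measurable_itv _) (lebesgue_itv_lty (- M) M) (suppE aM)).
Qed.

Let ai := intg_line_l.

Let bi : leb.-integrable setT (EFin \o b).
Proof.
exact: (@intg_of_sqr _ _ R leb b mb _ b2i (measurable_itv _) (lebesgue_itv_lty (- M) M) (suppE bM)).
Qed.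

Let mcos xi := measurableT_comp (@measurable_cosM2 R) (measurable_pair2 xi).
Let msin xi := measurableT_comp (@measurable_sinM2 R) (measurable_pair2 xi).

Let fc (f : R -> R) xi := Rintegral leb setT (fun x => f x * cos (x * xi)).
Let fs (f : R -> R) xi := Rintegral leb setT (fun x => f x * sin (x * xi)).

Let mfc f : measurable_fun setT f -> measurable_fun setT (fc f).
Proof.
move=> mf; apply: (@measurable_Rintegral1 _ _ _ _ R leb (fun z : R * R => f z.1 * cos (z.1 * z.2))).
apply: measurable_funM; last exact: measurable_cosM2.
by apply: (measurableT_comp mf); exact: measurable_fst.
Qed.

Let mfs f : measurable_fun setT f -> measurable_fun setT (fs f).
Proof.
move=> mf; apply: (@measurable_Rintegral1 _ _ _ _ R leb (fun z : R * R => f z.1 * sin (z.1 * z.2))).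
apply: measurable_funM; last exact: measurable_sinM2.
by apply: (measurableT_comp mf); exact: measurable_fst.
Qed.

Let fcN f xi : fc f (- xi) = fc f xi.
Proof. by apply: eq_Rintegral => x _; rewrite mulrN cosN. Qed.

Let fsN f xi : leb.-integrable setT (EFin \o f) -> fs f (- xi) = - fs f xi.
Proof.
move=> fi; rewrite -[RHS]mulN1r -RintegralZ; last exact: intgMbdd fi (msin xi) (fun x => norm_sin_le1 _).
by apply: eq_Rintegral => x _; rewrite mulrN sinN; ring.
Qed.

(** The cosine transform is even and the sine transform is odd in [xi].  Averaging
    the integrand over [xi] and [- xi] therefore removes the cross terms between
    [a] and [b], leaving the two real cases. *)
Lemma plancherel_line :
  ((2 * pi)%:E * \int[leb]_x (a x ^+ 2 + b x ^+ 2)%:E <= \int[leb]_xi (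
    Rintegral leb setT (fun x => a x * cos (x * xi) + b x * sin (x * xi)) ^+ 2 +
    Rintegral leb setT (fun x => b x * cos (x * xi) - a x * sin (x * xi)) ^+ 2)%:E)%E.
Proof.
have mac := mfc ma; have mbc := mfc mb; have mas := mfs ma; have mbs := mfs mb.
pose S xi := (fc a xi + fs b xi) ^+ 2 + (fc b xi - fs a xi) ^+ 2.
have mS : measurable_fun setT S.
  by apply: measurable_funD; apply: measurable_funX; [apply: measurable_funD|apply: measurable_funB].
have S0 xi : 0 <= S xi by rewrite addr_ge0 ?sqr_ge0.
rewrite [leRHS](_ : _ = \int[leb]_xi (S xi)%:E)%E; last first.
  apply: eq_integral => xi _; congr (_ ^+ 2 + _ ^+ 2)%:E.
    rewrite RintegralD//.
      exact: intgMbdd ai (mcos xi) (fun x => norm_cos_le1 _).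
    exact: intgMbdd bi (msin xi) (fun x => norm_sin_le1 _).
  rewrite RintegralB//.
    exact: intgMbdd bi (mcos xi) (fun x => norm_cos_le1 _).
  exact: intgMbdd ai (msin xi) (fun x => norm_sin_le1 _).
rewrite -(@lee_pmul2l _ 2%:E)// ?lte_fin//.
have -> : (2%:E * \int[leb]_xi (S xi)%:E = \int[leb]_xi (S xi + S (- xi))%:E)%E.
  under [RHS]eq_integral do rewrite EFinD.
  have mSN : measurable_fun setT (fun x : R => S (- x)%R).
    exact: (measurableT_comp mS lebesgue_reflection.1).
  rewrite ge0_integralD//; last 4 first.
  - by move=> xi _; rewrite lee_fin.
  - exact/measurable_EFinP.
  - by move=> xi _; rewrite lee_fin.
  - exact/measurable_EFinP.
  rewrite -(ge0_integral_preserving lebesgue_reflection (f := EFin \o S))//; last first.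
    exact/measurable_EFinP.
  by rewrite mule_natl mule2n.
have mA : measurable_fun setT (fun xi => (fc a xi ^+ 2 + fs a xi ^+ 2)%:E).
  by apply/measurable_EFinP; apply: measurable_funD; exact: measurable_funX.
have mB : measurable_fun setT (fun xi => (fc b xi ^+ 2 + fs b xi ^+ 2)%:E).
  by apply/measurable_EFinP; apply: measurable_funD; exact: measurable_funX.
have A0 xi : (0 <= (fc a xi ^+ 2 + fs a xi ^+ 2)%:E)%E by rewrite lee_fin addr_ge0 ?sqr_ge0.
have B0 xi : (0 <= (fc b xi ^+ 2 + fs b xi ^+ 2)%:E)%E by rewrite lee_fin addr_ge0 ?sqr_ge0.
have -> : (\int[leb]_xi (S xi + S (- xi))%:E = \int[leb]_xi (2%:E *
    ((fc a xi ^+ 2 + fs a xi ^+ 2)%:E + (fc b xi ^+ 2 + fs b xi ^+ 2)%:E)))%E.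
  apply: eq_integral => xi _; rewrite -EFinD -EFinM; congr EFin.
  by rewrite /S !fcN !fsN//; ring.
rewrite ge0_integralZl//; last 2 first.
- exact: emeasurable_funD.
- by move=> xi _; rewrite adde_ge0.
rewrite lee_pmul2l ?lte_fin//.
rewrite ge0_integralD//.
rewrite (@ge0_integral_EFinD _ _ _ leb (fun x => a x ^+ 2) (fun x => b x ^+ 2));
  [|exact: measurable_funX|exact: measurable_funX|by move=> x; exact: sqr_ge0|by move=> x; exact: sqr_ge0].
rewrite ge0_muleDr; [|exact: integral_sqr_ge0|exact: integral_sqr_ge0].
apply: leeD; apply: (plancherel_line_real (M := M)) => //.
- by rewrite intg_lty// => x; exact: sqr_ge0.
- by rewrite intg_lty// => x; exact: sqr_ge0.
Qed.

End plancherel_line_complex.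

(** * Plancherel's inequality in several variables *)

Section fourier_row.
Context {R : realType}.
Local Notation leb := (@lebesgue_measure R).

(** [fourier_re] and [fourier_im] are the real and imaginary parts of the integral
    of [(a + i b)(x) exp(- i x.xi)]. *)
Definition fourier_re n (a b : 'rV[R]_n -> R) (xi : 'rV[R]_n) : R :=
  Rintegral (lebesgue_row n) setT (fun x => a x * cos (dot x xi) + b x * sin (dot x xi)).

Definition fourier_im n (a b : 'rV[R]_n -> R) (xi : 'rV[R]_n) : R :=
  Rintegral (lebesgue_row n) setT (fun x => b x * cos (dot x xi) - a x * sin (dot x xi)).

Lemma dot_row_cons n r (v : 'rV[R]_n) s w :
  dot (row_cons (r, v)) (row_cons (s, w)) = r * s + dot v w.
Proof.
rewrite /dot big_ord_recl !row_cons0; congr (_ + _).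
by apply: eq_bigr => i _; rewrite !row_consS.
Qed.

Lemma measurable_dot2 n :
  measurable_fun setT (fun z : 'rV[R]_n * 'rV[R]_n => dot z.1 z.2).
Proof.
apply: measurable_sum => i; apply: measurable_funM.
  by apply: (measurableT_comp (measurable_row_coord i)); exact: measurable_fst.
by apply: (measurableT_comp (measurable_row_coord i)); exact: measurable_snd.
Qed.

Lemma measurable_cos_dot2 n :
  measurable_fun setT (fun z : 'rV[R]_n * 'rV[R]_n => cos (dot z.1 z.2)).
Proof.
exact: (measurableT_comp measurable_cos (@measurable_dot2 n)).
Qed.

Lemma measurable_sin_dot2 n :
  measurable_fun setT (fun z : 'rV[R]_n * 'rV[R]_n => sin (dot z.1 z.2)).
Proof.
exact: (measurableT_comp measurable_sin (@measurable_dot2 n)).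
Qed.

Lemma measurable_cos_dot n (xi : 'rV[R]_n) : measurable_fun setT (fun x => cos (dot x xi)).
Proof. exact: (measurableT_comp (@measurable_cos_dot2 n) (measurable_pair2 xi)). Qed.

Lemma measurable_sin_dot n (xi : 'rV[R]_n) : measurable_fun setT (fun x => sin (dot x xi)).
Proof. exact: (measurableT_comp (@measurable_sin_dot2 n) (measurable_pair2 xi)). Qed.

Lemma measurable_fourier_re n (a b : 'rV[R]_n -> R) :
  measurable_fun setT a -> measurable_fun setT b -> measurable_fun setT (fourier_re a b).
Proof.
move=> ma mb; apply: (@measurable_Rintegral1 _ _ _ _ R (lebesgue_row n)
  (fun z => a z.1 * cos (dot z.1 z.2) + b z.1 * sin (dot z.1 z.2))).
apply: measurable_funD; apply: measurable_funM.
- by apply: (measurableT_comp ma); exact: measurable_fst.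
- exact: measurable_cos_dot2.
- by apply: (measurableT_comp mb); exact: measurable_fst.
- exact: measurable_sin_dot2.
Qed.

Lemma measurable_fourier_im n (a b : 'rV[R]_n -> R) :
  measurable_fun setT a -> measurable_fun setT b -> measurable_fun setT (fourier_im a b).
Proof.
move=> ma mb; apply: (@measurable_Rintegral1 _ _ _ _ R (lebesgue_row n)
  (fun z => b z.1 * cos (dot z.1 z.2) - a z.1 * sin (dot z.1 z.2))).
apply: measurable_funB; apply: measurable_funM.
- by apply: (measurableT_comp mb); exact: measurable_fst.
- exact: measurable_cos_dot2.
- by apply: (measurableT_comp ma); exact: measurable_fst.
- exact: measurable_sin_dot2.
Qed.

Definition box_support n M (a : 'rV[R]_n -> R) : Prop :=
  forall x : 'rV[R]_n, (exists i, M < `|x ord0 i|) -> a x = 0.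

Definition box n M : set 'rV[R]_n := [set x | forall i, `[- M, M]%classic (x ord0 i)].

Lemma measurable_box n M : measurable (@box n M).
Proof. by apply: (measurable_row_box (A := fun=> `[- M, M]%classic)) => i; exact: measurable_itv. Qed.

Lemma box_lty n M : (lebesgue_row n (@box n M) < +oo)%E.
Proof.
rewrite (lebesgue_row_box (A := fun=> `[- M, M]%classic)); last by move=> i; exact: measurable_itv.
rewrite -ge0_fin_numE; last by apply: prode_ge0 => i _.
apply: (big_ind (fun x : \bar R => x \is a fin_num)) => // [x y|i _]; first exact: fin_numM.
by rewrite ge0_fin_numE// lebesgue_itv_lty.
Qed.

Lemma box_supportE n M (a : 'rV[R]_n -> R) : box_support M a ->
  forall x, ~ box M x -> a x = 0.
Proof.
move=> aM x /existsNP[i xi]; apply: aM; exists i.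
by rewrite ltNge; apply/negP => h; apply: xi; rewrite /= in_itv/= -ler_norml.
Qed.

Lemma intg_row n (a : 'rV[R]_n -> R) M : measurable_fun setT a -> box_support M a ->
  (lebesgue_row n).-integrable setT (EFin \o (fun x => a x ^+ 2)) ->
  (lebesgue_row n).-integrable setT (EFin \o a).
Proof.
move=> ma aM a2.
exact: (intg_of_sqr ma a2 (@measurable_box n M) (@box_lty n M) (box_supportE aM)).
Qed.

Let plancherel_statement n := forall (a b : 'rV[R]_n -> R) M,
  measurable_fun setT a -> measurable_fun setT b -> box_support M a -> box_support M b ->
  (\int[lebesgue_row n]_x (a x ^+ 2 + b x ^+ 2)%:E < +oo)%E ->
  (((2 * pi) ^+ n)%:E * \int[lebesgue_row n]_x (a x ^+ 2 + b x ^+ 2)%:E <=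
   \int[lebesgue_row n]_xi (fourier_re a b xi ^+ 2 + fourier_im a b xi ^+ 2)%:E)%E.

Let plancherel_row0 : plancherel_statement 0.
Proof.
move=> a b M ma mb aM bM ab2; rewrite expr0 mul1e.
have re0 xi : fourier_re a b xi = a 0.
  rewrite /fourier_re /Rintegral /= integral_dirac//; last first.
    apply/measurable_EFinP; apply: measurable_funD; apply: measurable_funM => //.
      exact: measurable_cos_dot.
    exact: measurable_sin_dot.
  by rewrite diracT mul1e/= /dot big_ord0 cos0 sin0 mulr1 mulr0 addr0.
have im0 xi : fourier_im a b xi = b 0.
  rewrite /fourier_im /Rintegral /= integral_dirac//; last first.
    apply/measurable_EFinP; apply: measurable_funB; apply: measurable_funM => //.
      exact: measurable_cos_dot.
    exact: measurable_sin_dot.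
  by rewrite diracT mul1e/= /dot big_ord0 cos0 sin0 mulr1 mulr0 subr0.
rewrite le_eqVlt; apply/orP; left; apply/eqP; apply: eq_integral => xi _; rewrite re0 im0.
by rewrite (_ : xi = 0)//; apply/rowP => -[].
Qed.

(** The transform in [n.+1] variables is the transform in the first variable, with
    real and imaginary parts [re1] and [im1], followed by the one in the others.
    Plancherel's inequality on the line holds for the slices of finite [energy],
    that is for almost every slice; the induction hypothesis is then applied to
    [re1 s] and [im1 s] for each frequency [s]. *)
Section step.
Variable n : nat.
Hypothesis IHn : plancherel_statement n.
Variables (a b : 'rV[R]_n.+1 -> R) (M : R).
Hypotheses (ma : measurable_fun setT a) (mb : measurable_fun setT b).
Hypotheses (aM : box_support M a) (bM : box_support M b).
Hypothesis ab2 : (\int[lebesgue_row n.+1]_x (a x ^+ 2 + b x ^+ 2)%:E < +oo)%E.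

Let re1 s (v : 'rV[R]_n) := Rintegral leb setT (fun r =>
  a (row_cons (r, v)) * cos (r * s) + b (row_cons (r, v)) * sin (r * s)).
Let im1 s (v : 'rV[R]_n) := Rintegral leb setT (fun r =>
  b (row_cons (r, v)) * cos (r * s) - a (row_cons (r, v)) * sin (r * s)).

Let energy (v : 'rV[R]_n) : \bar R := (\int[leb]_r
  (a (row_cons (r, v)) ^+ 2 + b (row_cons (r, v)) ^+ 2)%:E)%E.

Let mab : measurable_fun setT (fun x => a x ^+ 2 + b x ^+ 2).
Proof. by apply: measurable_funD; exact: measurable_funX. Qed.

Let ab_ge0 x : 0 <= a x ^+ 2 + b x ^+ 2.
Proof. by rewrite addr_ge0 ?sqr_ge0. Qed.

Let energy_ge0 v : (0 <= energy v)%E.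
Proof. by apply: integral_ge0 => r _; rewrite lee_fin. Qed.

Let menergy : measurable_fun setT energy.
Proof.
apply: (@measurable_integral1 _ _ _ _ R leb (fun z => (a (row_cons z) ^+ 2 + b (row_cons z) ^+ 2)%:E)).
by apply/measurable_EFinP; exact: (measurableT_comp mab (@measurable_row_cons R n)).
Qed.

Let energyE : (\int[lebesgue_row n.+1]_x (a x ^+ 2 + b x ^+ 2)%:E =
  \int[lebesgue_row n]_v energy v)%E.
Proof. by rewrite ge0_integral_rowS2//; exact/measurable_EFinP. Qed.

Let mslice (f : 'rV[R]_n.+1 -> R) v : measurable_fun setT f ->
  measurable_fun setT (fun r => f (row_cons (r, v))).
Proof.
move=> mf; have mrc : measurable_fun setT (fun r => row_cons (r, v) : 'rV[R]_n.+1).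
  exact: (measurableT_comp (@measurable_row_cons R n) (measurable_pair2 v)).
exact: (measurableT_comp mf mrc).
Qed.

Let slice_support (f : 'rV[R]_n.+1 -> R) v : box_support M f ->
  forall r, M < `|r| -> f (row_cons (r, v)) = 0.
Proof. by move=> fM r rM; apply: fM; exists ord0; rewrite row_cons0. Qed.

Let energy_fin : {ae lebesgue_row n, forall v, (energy v < +oo)%E}.
Proof.
have ie : (lebesgue_row n).-integrable setT energy.
  apply/integrableP; split => //; under eq_integral do rewrite gee0_abs//.
  by rewrite -energyE.
by have := integrable_ae measurableT ie; apply: filterS => v /(_ I); rewrite ge0_fin_numE.
Qed.

Let mtrig (g : R -> R) : measurable_fun setT g ->
  measurable_fun setT (fun z : (R * 'rV[R]_n) * R => g (z.2 * z.1.1)).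
Proof.
move=> mg; apply: (measurableT_comp mg); apply: measurable_funM; first exact: measurable_snd.
by apply: (measurableT_comp measurable_fst); exact: measurable_fst.
Qed.

Let mfull (f : 'rV[R]_n.+1 -> R) : measurable_fun setT f ->
  measurable_fun setT (fun z : (R * 'rV[R]_n) * R => f (row_cons (z.2, z.1.2))).
Proof.
move=> mf; apply: (measurableT_comp mf); apply: (measurableT_comp (@measurable_row_cons R n)).
apply/measurable_fun_pairP; split => /=; first exact: measurable_snd.
exact: (measurableT_comp measurable_snd measurable_fst).
Qed.

Let mre1 : measurable_fun setT (fun z : R * 'rV[R]_n => re1 z.1 z.2).
Proof.
apply: (@measurable_Rintegral2 _ _ _ _ R leb (fun z : (R * 'rV[R]_n) * R =>
  a (row_cons (z.2, z.1.2)) * cos (z.2 * z.1.1) + b (row_cons (z.2, z.1.2)) * sin (z.2 * z.1.1))).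
by apply: measurable_funD; apply: measurable_funM;
  do ?[exact: mfull|exact: (mtrig measurable_cos)|exact: (mtrig measurable_sin)].
Qed.

Let mim1 : measurable_fun setT (fun z : R * 'rV[R]_n => im1 z.1 z.2).
Proof.
apply: (@measurable_Rintegral2 _ _ _ _ R leb (fun z : (R * 'rV[R]_n) * R =>
  b (row_cons (z.2, z.1.2)) * cos (z.2 * z.1.1) - a (row_cons (z.2, z.1.2)) * sin (z.2 * z.1.1))).
by apply: measurable_funB; apply: measurable_funM;
  do ?[exact: mfull|exact: (mtrig measurable_cos)|exact: (mtrig measurable_sin)].
Qed.

Let slice_le v : ((2 * pi)%:E * energy v <= \int[leb]_s (re1 s v ^+ 2 + im1 s v ^+ 2)%:E)%E \/ energy v = +oo%E.
Proof.
have [eoo|eoo] := eqVneq (energy v) +oo%E; [by right|left].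
apply: (plancherel_line (M := M)).
- exact: mslice.
- exact: mslice.
- exact: slice_support.
- exact: slice_support.
- by rewrite ltey.
Qed.

(** Cauchy-Schwarz on the interval that carries the slice: this is what makes the
    partial transforms square-integrable, as the induction hypothesis demands. *)
Let slice_bound v (f : R -> R) : measurable_fun setT f ->
  (forall r, M < `|r| -> f r = 0) ->
  (forall r, f r ^+ 2 <= a (row_cons (r, v)) ^+ 2 + b (row_cons (r, v)) ^+ 2) ->
  ((Rintegral leb setT f ^+ 2)%:E <= (2 * `|M|)%:E * energy v)%E.
Proof.
move=> mf fM fle; pose E := `[(- `|M|), `|M|]%classic : set R.
have mE : measurable E by exact: measurable_itv.
have mw : measurable_fun setT (\1_E : R -> R) by exact: measurable_indic.
have fE : f = (fun r => f r * \1_E r).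
  apply/funext => r; rewrite indicE; have [|rE] := boolP (r \in E); first by rewrite mulr1.
  rewrite fM ?mul0r// (le_lt_trans (ler_norm M))// ltNge; apply: contra rE.
  by rewrite ler_norml inE /E/= in_itv.
have w0 r : 0 <= (\1_E r : R) by rewrite indicE.
rewrite {1}fE; apply: le_trans (cauchy_schwarz_weight leb mf mw w0) _.
have IE : (\int[leb]_r (\1_E r)%:E <= (2 * `|M|)%:E)%E.
  apply: (@le_trans _ _ (lebesgue_measure E)); first by rewrite integral_indic// setIT.
  rewrite /E lebesgue_measure_itv/= lte_fin.
  by case: ifPn => _; rewrite -?EFinD lee_fin ?mulr_ge0// opprK mulr_natl mulr2n.
have g0 r : 0 <= f r ^+ 2 * \1_E r by rewrite mulr_ge0 ?sqr_ge0.
have mg : measurable_fun setT (fun r => f r ^+ 2 * \1_E r).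
  by apply: measurable_funM => //; exact: measurable_funX.
have gle r : f r ^+ 2 * \1_E r <= a (row_cons (r, v)) ^+ 2 + b (row_cons (r, v)) ^+ 2.
  by rewrite (le_trans _ (fle r))// ler_piMr ?sqr_ge0// indicE; case: (_ \in _).
have h1 := ge0_le_integral_EFin leb mg (mslice v mab) g0 gle.
have h0 : (0 <= \int[leb]_r (f r ^+ 2 * \1_E r)%:E)%E.
  by apply: integral_ge0 => r _; rewrite lee_fin.
apply: lee_pmul => //.
by apply: integral_ge0 => r _; rewrite lee_fin.
Qed.

Let trig_sqr_le (p q t : R) : (p * cos t + q * sin t) ^+ 2 <= p ^+ 2 + q ^+ 2.
Proof.
have := sqr_ge0 (p * sin t - q * cos t); have : cos t ^+ 2 + sin t ^+ 2 = 1 := cos2Dsin2 t.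
move=> cs; have -> : p ^+ 2 + q ^+ 2 = (p ^+ 2 + q ^+ 2) * (cos t ^+ 2 + sin t ^+ 2) by rewrite cs mulr1.
lra.
Qed.

Let re1_le s v : ((re1 s v ^+ 2)%:E <= (2 * `|M|)%:E * energy v)%E.
Proof.
apply: slice_bound.
- apply: measurable_funD; apply: measurable_funM; do ?[exact: mslice];
    [apply: (measurableT_comp measurable_cos)|apply: (measurableT_comp measurable_sin)];
  by apply: measurable_funM.
- by move=> r rM; rewrite !slice_support// !mul0r addr0.
- by move=> r; exact: trig_sqr_le.
Qed.

Let im1_le s v : ((im1 s v ^+ 2)%:E <= (2 * `|M|)%:E * energy v)%E.
Proof.
apply: slice_bound.
- apply: measurable_funB; apply: measurable_funM; do ?[exact: mslice];
    [apply: (measurableT_comp measurable_cos)|apply: (measurableT_comp measurable_sin)];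
  by apply: measurable_funM.
- by move=> r rM; rewrite !slice_support// !mul0r subr0.
- move=> r; rewrite [leRHS]addrC -mulNr -[a _ ^+ 2]sqrrN; exact: trig_sqr_le.
Qed.

Let mre1s s : measurable_fun setT (re1 s).
Proof. exact: (measurableT_comp mre1 (measurable_pair1 s)). Qed.
Let mim1s s : measurable_fun setT (im1 s).
Proof. exact: (measurableT_comp mim1 (measurable_pair1 s)). Qed.

Let slice_lty s : (\int[lebesgue_row n]_v (re1 s v ^+ 2 + im1 s v ^+ 2)%:E < +oo)%E.
Proof.
apply: (@le_lt_trans _ _ (\int[lebesgue_row n]_v ((4 * `|M|)%:E * energy v))%E).
  apply: ge0_le_integral => //.
  - by move=> v _; rewrite lee_fin addr_ge0 ?sqr_ge0.
  - by apply/measurable_EFinP; apply: measurable_funD; exact: measurable_funX.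
  - by apply: emeasurable_funM.
  - move=> v _; rewrite EFinD.
    have -> : (4 * `|M|)%:E = ((2 * `|M|)%:E + (2 * `|M|)%:E)%E.
      by rewrite -EFinD; congr EFin; ring.
    by rewrite ge0_muleDl ?lee_fin ?mulr_ge0//; apply: leeD.
rewrite ge0_integralZl//.
by rewrite -energyE lte_mul_pinfty// lee_fin mulr_ge0.
Qed.

Let slice_box (F : 'rV[R]_n -> R) :
  (forall v, (forall r, a (row_cons (r, v)) = 0) -> (forall r, b (row_cons (r, v)) = 0) -> F v = 0) ->
  box_support M F.
Proof.
move=> F0 v [i vi]; apply: F0 => r; [apply: aM|apply: bM];
  by exists (lift ord0 i); rewrite row_consS.
Qed.

Let ai := intg_row ma aM (sqr_intgl ma mb ab2).
Let bi := intg_row mb bM (sqr_intgr ma mb ab2).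

Let re1_box s : box_support M (re1 s).
Proof.
apply: slice_box => v a0 b0; rewrite /re1 (@eq_Rintegral _ _ _ leb setT (cst 0)).
  by rewrite Rintegral_cst// mul0r.
by move=> r _; rewrite a0 b0 !mul0r addr0.
Qed.

Let im1_box s : box_support M (im1 s).
Proof.
apply: slice_box => v a0 b0; rewrite /im1 (@eq_Rintegral _ _ _ leb setT (cst 0)).
  by rewrite Rintegral_cst// mul0r.
by move=> r _; rewrite a0 b0 !mul0r subr0.
Qed.

Let slice_intg v : (energy v < +oo)%E ->
  leb.-integrable setT (EFin \o (fun r => a (row_cons (r, v)))) /\
  leb.-integrable setT (EFin \o (fun r => b (row_cons (r, v)))).
Proof.
move=> ev; have mav := mslice v ma; have mbv := mslice v mb.
split; first exact: (intg_line_l mav mbv (slice_support v aM) ev).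
apply: (intg_line_l mbv mav (slice_support v bM)).
by under eq_integral do rewrite addrC.
Qed.

(** The slices of infinite energy form a null set. *)
Let slice_ae (h : 'rV[R]_n.+1 -> R) (F : 'rV[R]_n -> R) :
  (lebesgue_row n.+1).-integrable setT (EFin \o h) -> measurable_fun setT F ->
  (forall v, (energy v < +oo)%E -> (\int[leb]_r (h (row_cons (r, v)))%:E)%E = (F v)%:E) ->
  Rintegral (lebesgue_row n.+1) setT h = Rintegral (lebesgue_row n) setT F.
Proof.
move=> hi mF hF; congr fine; rewrite integral_rowS2//.
have mh := measurable_int _ hi.
apply: ae_eq_integral => //.
- apply: (measurable_integral1 leb (f := fun z => (h (row_cons z))%:E)).
  exact: (measurableT_comp mh (@measurable_row_cons R n)).
- exact/measurable_EFinP.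
- by apply: filterS energy_fin => v ev _; exact: hF.
Qed.

Let fourier_slice s w :
  fourier_re (re1 s) (im1 s) w = fourier_re a b (row_cons (s, w)) /\
  fourier_im (re1 s) (im1 s) w = fourier_im a b (row_cons (s, w)).
Proof.
have mcd := measurable_cos_dot; have msd := measurable_sin_dot.
have cb m (x y : 'rV[R]_m) : `|cos (dot x y)| <= 1 by exact: norm_cos_le1.
have sb m (x y : 'rV[R]_m) : `|sin (dot x y)| <= 1 by exact: norm_sin_le1.
have mcs : measurable_fun setT (fun r : R => cos (r * s)).
  by apply: (measurableT_comp measurable_cos); exact: measurable_funM.
have mss : measurable_fun setT (fun r : R => sin (r * s)).
  by apply: (measurableT_comp measurable_sin); exact: measurable_funM.
have cbs r : `|cos (r * s)| <= 1 by exact: norm_cos_le1.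
have sbs r : `|sin (r * s)| <= 1 by exact: norm_sin_le1.
split; apply/esym; apply: slice_ae.
- exact: intgD (intgMbdd ai (mcd _ _) (cb _ ^~ _)) (intgMbdd bi (msd _ _) (sb _ ^~ _)).
- by apply: measurable_funD; apply: measurable_funM; [exact: mre1s|exact: mcd|exact: mim1s|exact: msd].
- move=> v ev; have [iav ibv] := slice_intg ev.
  have i1 := intgD (intgMbdd iav mcs cbs) (intgMbdd ibv mss sbs).
  have i2 := intgB (intgMbdd ibv mcs cbs) (intgMbdd iav mss sbs).
  have -> : re1 s v * cos (dot v w) + im1 s v * sin (dot v w) =
      cos (dot v w) * re1 s v + sin (dot v w) * im1 s v by ring.
  rewrite EFinD !EFinM !EFin_Rintegral//.
  rewrite -!integralZl// -integralD//=; last 2 first.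
  + exact: intgZ i1.
  + exact: intgZ i2.
  by apply: eq_integral => r _; rewrite dot_row_cons cosD sinD -!EFinM -EFinD; congr EFin; ring.
- exact: intgB (intgMbdd bi (mcd _ _) (cb _ ^~ _)) (intgMbdd ai (msd _ _) (sb _ ^~ _)).
- by apply: measurable_funB; apply: measurable_funM; [exact: mim1s|exact: mcd|exact: mre1s|exact: msd].
- move=> v ev; have [iav ibv] := slice_intg ev.
  have i1 := intgD (intgMbdd iav mcs cbs) (intgMbdd ibv mss sbs).
  have i2 := intgB (intgMbdd ibv mcs cbs) (intgMbdd iav mss sbs).
  have -> : im1 s v * cos (dot v w) - re1 s v * sin (dot v w) =
      cos (dot v w) * im1 s v + (- sin (dot v w)) * re1 s v by ring.
  rewrite EFinD !EFinM !EFin_Rintegral//.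
  rewrite -!integralZl// -integralD//=; last 2 first.
  + exact: intgZ i2.
  + exact: intgZ i1.
  by apply: eq_integral => r _; rewrite dot_row_cons cosD sinD -!EFinM -EFinD; congr EFin; ring.
Qed.

Lemma plancherel_step :
  (((2 * pi) ^+ n.+1)%:E * \int[lebesgue_row n.+1]_x (a x ^+ 2 + b x ^+ 2)%:E <=
   \int[lebesgue_row n.+1]_xi (fourier_re a b xi ^+ 2 + fourier_im a b xi ^+ 2)%:E)%E.
Proof.
have pi2 : 0 <= 2 * (pi : R) by rewrite mulr_ge0// pi_ge0.
have mRI : measurable_fun setT (fun z : R * 'rV[R]_n => (re1 z.1 z.2 ^+ 2 + im1 z.1 z.2 ^+ 2)%:E).
  by apply/measurable_EFinP; apply: measurable_funD; exact: measurable_funX.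
have RI0 (z : R * 'rV[R]_n) : (0 <= (re1 z.1 z.2 ^+ 2 + im1 z.1 z.2 ^+ 2)%:E)%E.
  by rewrite lee_fin addr_ge0 ?sqr_ge0.
have mF : measurable_fun setT (fun xi => fourier_re a b xi ^+ 2 + fourier_im a b xi ^+ 2).
  apply: measurable_funD; apply: measurable_funX.
    exact: measurable_fourier_re.
  exact: measurable_fourier_im.
rewrite energyE exprS EFinM [X in (X * _)%E]muleC -muleA -ge0_integralZl//.
apply: (@le_trans _ _ (((2 * pi) ^+ n)%:E *
    \int[lebesgue_row n]_v \int[leb]_s (re1 s v ^+ 2 + im1 s v ^+ 2)%:E)%E).
  apply: lee_wpmul2l; first by rewrite lee_fin exprn_ge0.
  apply: ae_ge0_le_integral => //.
  - by move=> v _; rewrite mule_ge0// lee_fin.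
  - exact: measurable_funeM.
  - by move=> v _; apply: integral_ge0 => s _; exact: (RI0 (s, v)).
  - exact: (measurable_integral1 leb mRI).
  - apply: filterS energy_fin => v ev _; case: (slice_le v) => // eoo.
    by move: ev; rewrite eoo.
rewrite -(fubini_tonelli (m1 := leb) (m2 := lebesgue_row n)
  (fun z : R * 'rV[R]_n => (re1 z.1 z.2 ^+ 2 + im1 z.1 z.2 ^+ 2)%:E))//=.
rewrite ge0_integral_rowS1//; [|exact/measurable_EFinP|]; last first.
  by move=> x; rewrite lee_fin addr_ge0 ?sqr_ge0.
rewrite -ge0_integralZl//; last 3 first.
- exact: (measurable_integral2 (lebesgue_row n) mRI).
- by move=> s _; apply: integral_ge0 => v _; exact: (RI0 (s, v)).
- by rewrite lee_fin exprn_ge0.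
apply: ge0_le_integral => //.
- move=> s _; apply: mule_ge0; first by rewrite lee_fin exprn_ge0.
  by apply: integral_ge0 => v _; exact: (RI0 (s, v)).
- by apply: measurable_funeM; exact: (measurable_integral2 (lebesgue_row n) mRI).
- apply: (measurable_integral2 (lebesgue_row n) (f := fun z =>
    (fourier_re a b (row_cons z) ^+ 2 + fourier_im a b (row_cons z) ^+ 2)%:E)).
  by apply/measurable_EFinP; exact: (measurableT_comp mF (@measurable_row_cons R n)).
- move=> s _; apply: (le_trans (IHn (mre1s s) (mim1s s) (@re1_box s) (@im1_box s) (slice_lty s))).
  rewrite le_eqVlt; apply/orP; left; apply/eqP; apply: eq_integral => w _.
  by have [-> ->] := fourier_slice s w.
Qed.

End step.

Lemma plancherel_row n (a b : 'rV[R]_n -> R) M :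
  measurable_fun setT a -> measurable_fun setT b -> box_support M a -> box_support M b ->
  (\int[lebesgue_row n]_x (a x ^+ 2 + b x ^+ 2)%:E < +oo)%E ->
  (((2 * pi) ^+ n)%:E * \int[lebesgue_row n]_x (a x ^+ 2 + b x ^+ 2)%:E <=
   \int[lebesgue_row n]_xi (fourier_re a b xi ^+ 2 + fourier_im a b xi ^+ 2)%:E)%E.
Proof.
elim: n a b M => [|n IHn] a b M ma mb aM bM ab2; first exact: (plancherel_row0 ma mb aM bM ab2).
exact: (plancherel_step IHn ma mb aM bM ab2).
Qed.

End fourier_row.

(** * Complex L2 norms and the Euclidean norm *)

Section complex_l2.
Context {R : realType} {n : nat}.
Local Notation mu := (@lebesgue_row R n).
Implicit Types (D : set 'rV[R]_n) (f g : 'rV[R]_n -> R[i]).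

Definition sqmod (z : R[i]) : R := complex.Re z ^+ 2 + complex.Im z ^+ 2.

Lemma sqmod_ge0 z : 0 <= sqmod z.
Proof. by rewrite addr_ge0 ?sqr_ge0. Qed.

Lemma normc_sqr z : Normc.normc z ^+ 2 = sqmod z.
Proof. by case: z => x y; rewrite /Normc.normc sqr_sqrtr//= addr_ge0 ?sqr_ge0. Qed.

Lemma measurable_sqmod D f : cmeasurable D f -> measurable_fun D (fun x => sqmod (f x)).
Proof. by move=> [mr mi]; apply: measurable_funD; exact: measurable_funX. Qed.

Lemma L2norm_sqr D f : (L2norm D f `^ 2 = \int[mu]_(x in D) (sqmod (f x))%:E)%E.
Proof.
rewrite /L2norm poweR_Lnorm// [RHS]integral_mkcond; apply: eq_integral => x _ /=.
rewrite !patchE; case: ifPn => _; last by rewrite normr0 powR0.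
rewrite powR_mulrn// ?normr_ge0// real_normK ?num_real// normc_sqr//.
Qed.

Lemma L2normE D f : (L2norm D f = (\int[mu]_(x in D) (sqmod (f x))%:E) `^ 2^-1)%E.
Proof.
rewrite -L2norm_sqr -poweRrM mulfV// poweRe1//; exact: Lnorm_ge0.
Qed.

Lemma L2norm_lty D f : (L2norm D f < +oo)%E ->
  (\int[mu]_(x in D) (sqmod (f x))%:E < +oo)%E.
Proof. by rewrite -L2norm_sqr => h; rewrite poweR_lty. Qed.

Lemma L2norm_lt D f e : 0 <= e -> (L2norm D f <= e%:E)%E ->
  (\int[mu]_(x in D) (sqmod (f x))%:E <= (e ^+ 2)%:E)%E.
Proof.
move=> e0 h; rewrite -L2norm_sqr -powR_mulrn// -poweR_EFin.
by apply: gt0_ler_poweR => //; rewrite in_itv/= ?leey ?andbT ?lee_fin//; exact: Lnorm_ge0.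
Qed.

Lemma L2norm_le D f (C : R) (X : \bar R) : 0 <= C -> (0 <= X)%E ->
  (\int[mu]_(x in D) (sqmod (f x))%:E <= (C ^+ 2)%:E * X)%E ->
  (L2norm D f <= C%:E * X `^ 2^-1)%E.
Proof.
move=> C0 X0 h; rewrite L2normE.
have -> : (C%:E * X `^ 2^-1 = ((C ^+ 2)%:E * X) `^ 2^-1)%E.
  rewrite poweRM ?lee_fin ?sqr_ge0// poweR_EFin powR12_sqrt ?sqr_ge0// sqrtr_sqr.
  by rewrite ger0_norm.
apply: gt0_ler_poweR => //; rewrite ?in_itv/= ?andbT ?leey ?andbT//.
- by apply: integral_ge0 => x _; rewrite lee_fin sqmod_ge0.
- by rewrite mule_ge0// lee_fin sqr_ge0.
Qed.

End complex_l2.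

Section dot_facts.
Context {R : realType} {n : nat}.
Implicit Types x y t : 'rV[R]_n.

Lemma dot_ge0 x : 0 <= dot x x.
Proof. by apply: sumr_ge0 => i _; rewrite -expr2 sqr_ge0. Qed.

Lemma enorm_sqr x : enorm x ^+ 2 = dot x x.
Proof. by rewrite sqr_sqrtr// dot_ge0. Qed.

Lemma enorm_ge0 x : 0 <= enorm x.
Proof. exact: sqrtr_ge0. Qed.

(** The quadratic [dot (x - l *: y) (x - l *: y)] in [l] is nonnegative. *)
Lemma dot_sqr_le x y : dot x y ^+ 2 <= dot x x * dot y y.
Proof.
have H l : 2 * l * dot x y <= dot x x + l ^+ 2 * dot y y.
  rewrite /dot !mulr_sumr -big_split/=; apply: ler_sum => i _.
  by have := sqr_ge0 (x ord0 i - l * y ord0 i); lra.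
have [y0|y0] := ltP 0 (dot y y).
  have := H (dot x y / dot y y).
  have -> : 2 * (dot x y / dot y y) * dot x y = 2 * (dot x y ^+ 2 / dot y y).
    by field; rewrite gt_eqF.
  have -> : (dot x y / dot y y) ^+ 2 * dot y y = dot x y ^+ 2 / dot y y.
    by field; rewrite gt_eqF.
  by move=> h; rewrite -ler_pdivrMr//; lra.
have {}y0 : dot y y = 0 by apply/eqP; rewrite eq_le y0 dot_ge0.
rewrite y0 mulr0; have [->|xy0] := eqVneq (dot x y) 0; first by rewrite expr0n.
(* a value of [l] for which the linear bound [H] would fail *)
have := H ((dot x x + 1) / (2 * dot x y)); rewrite y0 mulr0 addr0.
have -> : 2 * ((dot x x + 1) / (2 * dot x y)) * dot x y = dot x x + 1 by field.
lra.
Qed.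

Lemma coord_le_enorm x i : `|x ord0 i| <= enorm x.
Proof.
rewrite -(@ler_pXn2r _ 2)// ?nnegrE ?enorm_ge0// enorm_sqr real_normK ?num_real//.
rewrite /dot (bigD1 i)//= -expr2 lerDl; apply: sumr_ge0 => j _.
by rewrite -expr2 sqr_ge0.
Qed.

Lemma dot_le_sup x s : (forall i, `|x ord0 i| <= s) -> dot x x <= n%:R * s ^+ 2.
Proof.
move=> xs; have -> : n%:R * s ^+ 2 = \sum_(i < n) s ^+ 2.
  by rewrite sumr_const card_ord mulr_natl.
apply: ler_sum => i _; rewrite -expr2 -(real_normK (num_real _)).
by rewrite lerXn2r ?nnegrE// (le_trans _ (xs i)).
Qed.

Lemma dotDl x y t : dot (x + y) t = dot x t + dot y t.
Proof. by rewrite /dot -big_split/=; apply: eq_bigr => i _; rewrite mxE mulrDl. Qed.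

Lemma measurable_enorm : measurable_fun setT (@enorm R n).
Proof.
apply: (@measurableT_comp _ _ _ _ _ _ (Num.sqrt : R -> R) _ (fun x : 'rV[R]_n => dot x x)).
  by apply: continuous_measurable_fun; exact: sqrt_continuous.
apply: measurable_sum => i; apply: measurable_funM; exact: measurable_row_coord.
Qed.

Lemma measurable_eball (r : R) : measurable [set x : 'rV[R]_n | enorm x <= r].
Proof.
have -> : [set x : 'rV[R]_n | enorm x <= r] = setT `&` (@enorm R n) @^-1` `]-oo, r].
  by apply/seteqP; split => x /=; rewrite in_itv/=; [split|case].
by apply: measurable_enorm => //; exact: measurable_itv.
Qed.

End dot_facts.

Lemma norm_sin_le (R : realType) (x : R) : `|sin x| <= `|x|.
Proof.
wlog x0 : x / 0 < x => [H|].
  have [x0|x0|->] := ltgtP x 0; [|exact: H|by rewrite sin0].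
  by rewrite -normrN -sinN -[leRHS]normrN; apply: H; rewrite oppr_gt0.
have [|c _] := @MVT R sin cos 0 x x0 (fun y _ => is_derive_sin y).
  by apply: continuous_subspaceT => y; exact: continuous_sin.
rewrite sin0 !subr0 => ->; rewrite normrM ler_piMl// ler_norml.
by rewrite cos_geN1 cos_le1.
Qed.

(** That is, [|e^{ix} - 1|^2 <= x^2]. *)
Lemma two_sub_cos_le (R : realType) (x : R) : 2 - 2 * cos x <= x ^+ 2.
Proof.
have -> : cos x = 1 - 2 * sin (x / 2) ^+ 2.
  have {1}-> : x = x / 2 + x / 2 by field.
  rewrite cosD -!expr2; have := cos2Dsin2 (x / 2); lra.
have : sin (x / 2) ^+ 2 <= (x / 2) ^+ 2.
  rewrite -(real_normK (num_real (sin _))) -[leRHS](real_normK (num_real _)).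
  by rewrite lerXn2r ?nnegrE// norm_sin_le.
have -> : (x / 2) ^+ 2 = x ^+ 2 / 4 by field.
lra.
Qed.

(** * Translations of functions in H1 *)

Section fourier_translation.
Context {R : realType} {n : nat}.
Local Notation mu := (@lebesgue_row R n).
Implicit Types (f g : 'rV[R]_n -> R) (t xi : 'rV[R]_n).

Lemma measurable_row_translate f t : measurable_fun setT f ->
  measurable_fun setT (fun x : 'rV[R]_n => f (x + t)).
Proof. by move=> mf; have [mt _] := row_translation t; exact: (measurableT_comp mf mt). Qed.

Lemma ge0_integral_row_translate f t : measurable_fun setT f -> (forall x, 0 <= f x) ->
  (\int[mu]_x (f (x + t))%:E = \int[mu]_x (f x)%:E)%E.
Proof.
move=> mf f0; rewrite [RHS](ge0_integral_preserving (row_translation t))//.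
exact/measurable_EFinP.
Qed.

Lemma intg_row_translate f t : mu.-integrable setT (EFin \o f) ->
  mu.-integrable setT (EFin \o (fun x => f (x + t))).
Proof.
move=> fi; have [+ _] := integrable_preserving (row_translation t) (f := EFin \o f) (measurable_int _ fi).
exact.
Qed.

Lemma intg_cos_dot f xi : mu.-integrable setT (EFin \o f) ->
  mu.-integrable setT (EFin \o (fun x => f x * cos (dot x xi))).
Proof.
move=> fi; apply: (intgMbdd (C := 1) fi (measurable_cos_dot xi)) => x.
exact: norm_cos_le1.
Qed.

Lemma intg_sin_dot f xi : mu.-integrable setT (EFin \o f) ->
  mu.-integrable setT (EFin \o (fun x => f x * sin (dot x xi))).
Proof.
move=> fi; apply: (intgMbdd (C := 1) fi (measurable_sin_dot xi)) => x.
exact: norm_sin_le1.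
Qed.

Section shift.
Variables f g : 'rV[R]_n -> R.
Hypotheses (fi : mu.-integrable setT (EFin \o f)) (gi : mu.-integrable setT (EFin \o g)).

Let ire xi := intgD (intg_cos_dot xi fi) (intg_sin_dot xi gi).
Let iim xi := intgB (intg_cos_dot xi gi) (intg_sin_dot xi fi).

Lemma fourier_re_shift t xi : fourier_re (fun x => f (x + t)) (fun x => g (x + t)) xi =
  cos (dot t xi) * fourier_re f g xi - sin (dot t xi) * fourier_im f g xi.
Proof.
rewrite -(RintegralZ _ (ire xi)) -(RintegralZ _ (iim xi)).
rewrite -RintegralB//; [|exact: intgZ (ire xi)|exact: intgZ (iim xi)].
rewrite [RHS](Rintegral_preserving (row_translation t)).
  by apply: eq_Rintegral => x _ /=; rewrite dotDl cosD sinD;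
    have := cos2Dsin2 (dot t xi) => /(congr1 (fun z => z * (f (x + t) * cos (dot x xi) + g (x + t) * sin (dot x xi))));
    rewrite mul1r => <-; ring.
exact: intg_measurable (intgB (intgZ _ (ire xi)) (intgZ _ (iim xi))).
Qed.

Lemma fourier_im_shift t xi : fourier_im (fun x => f (x + t)) (fun x => g (x + t)) xi =
  sin (dot t xi) * fourier_re f g xi + cos (dot t xi) * fourier_im f g xi.
Proof.
rewrite -(RintegralZ _ (ire xi)) -(RintegralZ _ (iim xi)).
rewrite -RintegralD//; [|exact: intgZ (ire xi)|exact: intgZ (iim xi)].
rewrite [RHS](Rintegral_preserving (row_translation t)).
  by apply: eq_Rintegral => x _ /=; rewrite dotDl cosD sinD;
    have := cos2Dsin2 (dot t xi) => /(congr1 (fun z => z * (g (x + t) * cos (dot x xi) - f (x + t) * sin (dot x xi))));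
    rewrite mul1r => <-; ring.
exact: intg_measurable (intgD (intgZ _ (ire xi)) (intgZ _ (iim xi))).
Qed.

(** Translation by [t] multiplies the transform by [e^{i t.xi}], and
    [2 - 2 * cos (dot t xi)] is the square of [|e^{i t.xi} - 1|]. *)
Lemma fourier_difference_sqr t xi :
  fourier_re (fun x => f (x + t) - f x) (fun x => g (x + t) - g x) xi ^+ 2 +
  fourier_im (fun x => f (x + t) - f x) (fun x => g (x + t) - g x) xi ^+ 2 =
  (2 - 2 * cos (dot t xi)) * (fourier_re f g xi ^+ 2 + fourier_im f g xi ^+ 2).
Proof.
have fti := intg_row_translate t fi; have gti := intg_row_translate t gi.
have -> : fourier_re (fun x => f (x + t) - f x) (fun x => g (x + t) - g x) xi =
    fourier_re (fun x => f (x + t)) (fun x => g (x + t)) xi - fourier_re f g xi.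
  rewrite -RintegralB//; last first.
    exact: intgD (intg_cos_dot xi fti) (intg_sin_dot xi gti).
  by apply: eq_Rintegral => x _; ring.
have -> : fourier_im (fun x => f (x + t) - f x) (fun x => g (x + t) - g x) xi =
    fourier_im (fun x => f (x + t)) (fun x => g (x + t)) xi - fourier_im f g xi.
  rewrite -RintegralB//; last first.
    exact: intgB (intg_cos_dot xi gti) (intg_sin_dot xi fti).
  by apply: eq_Rintegral => x _; ring.
rewrite fourier_re_shift fourier_im_shift.
move: (fourier_re f g xi) (fourier_im f g xi) (cos2Dsin2 (dot t xi)) => p q.
move: (cos _) (sin _) => c s cs.
have -> : (c * p - s * q - p) ^+ 2 + (s * p + c * q - q) ^+ 2 =
  ((c ^+ 2 + s ^+ 2) + 1 - 2 * c) * (p ^+ 2 + q ^+ 2) by ring.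
by rewrite cs; ring.
Qed.

End shift.

Lemma fourier_integral_Re (D : set 'rV[R]_n) (U : 'rV[R]_n -> R[i]) xi : measurable D ->
  complex.Re (fourier_integral D U xi) = ((2 * pi) `^ (- (n%:R / 2))) *
  fourier_re (fun x => complex.Re (U x) * \1_D x) (fun x => complex.Im (U x) * \1_D x) xi.
Proof.
move=> mD; rewrite /fourier_integral /cint /= mul0r subr0; congr (_ * _).
rewrite Rintegral_mkcond; apply: eq_Rintegral => x _.
rewrite patchE indicE; case: ifPn => _; last by rewrite !mulr0 !mul0r addr0.
by case: (U x) => p q /=; ring.
Qed.

Lemma fourier_integral_Im (D : set 'rV[R]_n) (U : 'rV[R]_n -> R[i]) xi : measurable D ->
  complex.Im (fourier_integral D U xi) = ((2 * pi) `^ (- (n%:R / 2))) *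
  fourier_im (fun x => complex.Re (U x) * \1_D x) (fun x => complex.Im (U x) * \1_D x) xi.
Proof.
move=> mD; rewrite /fourier_integral /cint /= mul0r addr0; congr (_ * _).
rewrite Rintegral_mkcond; apply: eq_Rintegral => x _.
rewrite patchE indicE; case: ifPn => _; last by rewrite !mulr0 !mul0r subr0.
by case: (U x) => p q /=; ring.
Qed.

Lemma fourier_constant_sqr : ((2 * pi) `^ (- (n%:R / 2))) ^+ 2 = ((2 * pi : R) ^+ n)^-1.
Proof.
have pi0 : 0 <= 2 * pi :> R by rewrite mulr_ge0// pi_ge0.
rewrite -powR_mulrn ?powR_ge0// -powRrM mulNr -[n%:R / 2 * 2]mulrA mulVf// mulr1.
by rewrite powRN powR_mulrn.
Qed.

End fourier_translation.

(** The difference of [U] is approximated by those of its truncations to balls,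
    which have compact support; their transforms [W k] converge to [V] in [L2].
    The errors are absorbed by [p^2 <= (1 + d) q^2 + (1 + 1/d) (p - q)^2]. *)
Section h1_translation.
Context {R : realType} {n : nat}.
Local Notation mu := (@lebesgue_row R n).
Variables (U : 'rV[R]_n -> R[i]) (t : 'rV[R]_n).
Hypothesis HU : H1 U.

Let a x := complex.Re (U x).
Let b x := complex.Im (U x).
Let V := fourier U.
Let energy := (\int[mu]_xi ((1 + enorm xi ^+ 2) * Normc.normc (V xi) ^+ 2)%:E)%E.

Let ma : measurable_fun setT a. Proof. by have [[[]]] := HU. Qed.
Let mb : measurable_fun setT b. Proof. by have [[[]]] := HU. Qed.
Let ab2 : (\int[mu]_x (a x ^+ 2 + b x ^+ 2)%:E < +oo)%E.
Proof. by have [[_ /L2norm_lty]] := HU. Qed.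
Let mV : cmeasurable setT V. Proof. by have [_ [[]]] := HU. Qed.

Let energy_lty : (energy < +oo)%E.
Proof.
have [_ _] := HU; rewrite /H1norm => h.
by apply: (@lty_poweRy _ _ 2^-1) => //; rewrite invr_eq0.
Qed.

Let energy_ge0 : (0 <= energy)%E.
Proof.
apply: integral_ge0 => xi _; rewrite lee_fin mulr_ge0 ?sqr_ge0//.
by rewrite addr_ge0 ?sqr_ge0.
Qed.

Let B (k : nat) : set 'rV[R]_n := [set x | enorm x <= k%:R].
Let mB k : measurable (B k). Proof. exact: measurable_eball. Qed.

Let ak k x := a x * \1_(B k) x.
Let bk k x := b x * \1_(B k) x.

Let mak k : measurable_fun setT (ak k).
Proof. by apply: measurable_funM => //; exact: measurable_indic. Qed.
Let mbk k : measurable_fun setT (bk k).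
Proof. by apply: measurable_funM => //; exact: measurable_indic. Qed.

Let supp_trunc (f : 'rV[R]_n -> R) k : box_support k%:R (fun x => f x * \1_(B k) x).
Proof.
move=> x [i xi]; rewrite indicE memNset ?mulr0// /B/= => xk.
by have := coord_le_enorm x i; rewrite leNgt (le_lt_trans xk).
Qed.

Let trunc_lty k : (\int[mu]_x (ak k x ^+ 2 + bk k x ^+ 2)%:E < +oo)%E.
Proof.
apply: le_lt_trans ab2; apply: ge0_le_integral_EFin => [|||x].
- by apply: measurable_funD; exact: measurable_funX.
- by apply: measurable_funD; exact: measurable_funX.
- by move=> x; rewrite addr_ge0 ?sqr_ge0.
- rewrite /ak /bk indicE; case: (_ \in _); rewrite ?mulr1// !mulr0 expr0n addr0.
  by rewrite addr_ge0 ?sqr_ge0.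
Qed.

Let aki k : mu.-integrable setT (EFin \o ak k).
Proof. exact: (intg_row (mak k) (@supp_trunc a k) (sqr_intgl (mak k) (mbk k) (trunc_lty k))). Qed.
Let bki k : mu.-integrable setT (EFin \o bk k).
Proof. exact: (intg_row (mbk k) (@supp_trunc b k) (sqr_intgr (mak k) (mbk k) (trunc_lty k))). Qed.

Let W k := fourier_integral (B k) U.

Let sqmodW k xi : sqmod (W k xi) =
  ((2 * pi) ^+ n)^-1 * (fourier_re (ak k) (bk k) xi ^+ 2 + fourier_im (ak k) (bk k) xi ^+ 2).
Proof.
have E (c x y : R) : (c * x) ^+ 2 + (c * y) ^+ 2 = c ^+ 2 * (x ^+ 2 + y ^+ 2) by ring.
by rewrite /W /sqmod fourier_integral_Re// fourier_integral_Im// E fourier_constant_sqr.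
Qed.

Let mW k : cmeasurable setT (W k).
Proof.
split; rewrite /W.
  under eq_fun do rewrite fourier_integral_Re//.
  apply: measurable_funM; first exact: measurable_cst.
  exact: (measurable_fourier_re (mak k) (mbk k)).
under eq_fun do rewrite fourier_integral_Im//.
apply: measurable_funM; first exact: measurable_cst.
exact: (measurable_fourier_im (mak k) (mbk k)).
Qed.

Let diff_box (f : 'rV[R]_n -> R) k : box_support k%:R f ->
  box_support (k%:R + enorm t) (fun x => f (x + t) - f x).
Proof.
move=> fk x [i xi]; have ti := coord_le_enorm t i.
rewrite (fk x); last by exists i; have := enorm_ge0 t; lra.
rewrite (fk (x + t)) ?subrr//; exists i; rewrite mxE.
have := ler_normB (x ord0 i + t ord0 i) (t ord0 i); rewrite addrK; lra.
Qed.

Let Dk k (x : 'rV[R]_n) : R := (ak k (x + t) - ak k x) ^+ 2 + (bk k (x + t) - bk k x) ^+ 2.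
Let D (x : 'rV[R]_n) : R := (a (x + t) - a x) ^+ 2 + (b (x + t) - b x) ^+ 2.

Let mD : measurable_fun setT D.
Proof.
by apply: measurable_funD; apply: measurable_funX; apply: measurable_funB => //;
  exact: measurable_row_translate.
Qed.

Let mdiff (f : 'rV[R]_n -> R) : measurable_fun setT f ->
  measurable_fun setT (fun x : 'rV[R]_n => f (x + t) - f x).
Proof. by move=> mf; apply: measurable_funB => //; exact: measurable_row_translate. Qed.

Let mDk k : measurable_fun setT (Dk k).
Proof. by apply: measurable_funD; apply: measurable_funX; exact: mdiff. Qed.

Let Dk_lty k : (\int[mu]_x (Dk k x)%:E < +oo)%E.
Proof.
have i2 := sqr_intgD (mak k) (mbk k) (trunc_lty k).
have i3 := intgZ 2 (intgD (intg_row_translate t i2) i2).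
apply: (@le_lt_trans _ _ _ _ _ _ (intg_lty _ i3)); last first.
  by move=> x; rewrite mulr_ge0// !addr_ge0 ?sqr_ge0.
apply: ge0_le_integral_EFin.
- exact: mDk.
- exact: intg_measurable i3.
- by move=> x; rewrite addr_ge0 ?sqr_ge0.
- move=> x; rewrite /Dk; move: (ak k (x + t)) (ak k x) (bk k (x + t)) (bk k x) => p q r s.
  have := sqr_ge0 (p + q); have := sqr_ge0 (r + s); lra.
Qed.

Let Dk_le k : (\int[mu]_x (Dk k x)%:E <=
  \int[mu]_xi ((2 - 2 * cos (dot t xi)) * sqmod (W k xi))%:E)%E.
Proof.
have p0 : 0 < (2 * pi : R) ^+ n by rewrite exprn_gt0// mulr_gt0// pi_gt0.
have := plancherel_row (mdiff (mak k)) (mdiff (mbk k)) (diff_box (@supp_trunc a k))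
  (diff_box (@supp_trunc b k)) (Dk_lty k).
rewrite -(@lee_pmul2l _ ((2 * pi) ^+ n)^-1%:E)//; last by rewrite lte_fin invr_gt0.
rewrite muleA -EFinM mulVf ?gt_eqF// mul1e => /le_trans; apply.
rewrite -ge0_integral_EFinZ; last 3 first.
- by apply: measurable_funD; apply: measurable_funX;
    [apply: measurable_fourier_re|apply: measurable_fourier_im]; exact: mdiff.
- by move=> xi; rewrite addr_ge0 ?sqr_ge0.
- by rewrite invr_ge0 ltW.
rewrite le_eqVlt; apply/orP; left; apply/eqP; apply: eq_integral => xi _.
by rewrite sqmodW mulrCA -(fourier_difference_sqr (aki k) (bki k)).
Qed.

Let c4 xi : 0 <= 2 - 2 * cos (dot t xi) <= 4.
Proof. by have := cos_geN1 (dot t xi); have := cos_le1 (dot t xi); lra. Qed.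

Let symbol_bound k xi d : 0 < d -> (2 - 2 * cos (dot t xi)) * sqmod (W k xi) <=
  (1 + d) * (dot t t * ((1 + enorm xi ^+ 2) * Normc.normc (V xi) ^+ 2)) +
  4 * (1 + d^-1) * sqmod (W k xi - V xi).
Proof.
move=> d0; rewrite normc_sqr; have /andP[c0 c1] := c4 xi.
have h1 : sqmod (W k xi) <= (1 + d) * sqmod (V xi) + (1 + d^-1) * sqmod (W k xi - V xi).
  case: (W k xi) (V xi) => p q [r s]; rewrite /sqmod /=.
  have h (x y : R) : x ^+ 2 <= (1 + d) * y ^+ 2 + (1 + d^-1) * (x - y) ^+ 2.
    have -> : (1 + d) * y ^+ 2 + (1 + d^-1) * (x - y) ^+ 2 =
      x ^+ 2 + d^-1 * (d * y - (x - y)) ^+ 2 by field; rewrite gt_eqF.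
    by rewrite lerDl mulr_ge0 ?sqr_ge0// invr_ge0 ltW.
  have := h p r; have := h q s; lra.
apply: le_trans (ler_wpM2l c0 h1) _; rewrite mulrDr; apply: lerD.
  rewrite mulrCA ler_pM2l ?ltr_wpDl// ?ltr_wpDr// mulrA ler_wpM2r ?sqmod_ge0//.
  apply: (le_trans (two_sub_cos_le _)); apply: (le_trans (dot_sqr_le _ _)).
  by rewrite ler_wpM2l ?dot_ge0// enorm_sqr lerDr.
rewrite -[leRHS]mulrA ler_wpM2r// mulr_ge0 ?sqmod_ge0// addr_ge0// invr_ge0 ltW//.
Qed.

Let mWV k : measurable_fun setT (fun xi => sqmod (W k xi - V xi)).
Proof.
have [rV iV] := mV; have [rW iW] := mW k.
have -> : (fun xi => sqmod (W k xi - V xi)) = (fun xi =>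
  (complex.Re (W k xi) - complex.Re (V xi)) ^+ 2 + (complex.Im (W k xi) - complex.Im (V xi)) ^+ 2).
  by apply/funext => xi; case: (W k xi) (V xi) => p q [r s].
by apply: measurable_funD; apply: measurable_funX; apply: measurable_funB.
Qed.

Let menergy : measurable_fun setT (fun xi => (1 + enorm xi ^+ 2) * Normc.normc (V xi) ^+ 2).
Proof.
under eq_fun do rewrite normc_sqr.
apply: measurable_funM; last exact: measurable_sqmod.
by apply: measurable_funD => //; apply: measurable_funX; exact: measurable_enorm.
Qed.

Let Dk_bound k d : 0 < d -> (\int[mu]_x (Dk k x)%:E <=
  (1 + d)%:E * ((dot t t)%:E * energy) +
  (4 * (1 + d^-1))%:E * \int[mu]_xi (sqmod (W k xi - V xi))%:E)%E.
Proof.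
move=> d0; apply: (le_trans (Dk_le k)).
have en0 xi : 0 <= (1 + enorm xi ^+ 2) * Normc.normc (V xi) ^+ 2.
  by rewrite mulr_ge0 ?sqr_ge0// addr_ge0 ?sqr_ge0.
have d1 : 0 <= 1 + d by rewrite addr_ge0// ltW.
have d2 : 0 <= 4 * (1 + d^-1) by rewrite mulr_ge0// addr_ge0// invr_ge0 ltW.
rewrite -ge0_integral_EFinZ//; last exact: dot_ge0.
rewrite -(ge0_integral_EFinZ mu (mWV k) (fun xi => sqmod_ge0 _) d2).
rewrite -ge0_integral_EFinZ//; last 2 first.
- exact: measurable_funM.
- by move=> xi; rewrite mulr_ge0// dot_ge0.
rewrite -ge0_integral_EFinD//; last 4 first.
- by do 2 apply: measurable_funM => //.
- exact: measurable_funM.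
- by move=> xi; rewrite mulr_ge0// mulr_ge0// dot_ge0.
- by move=> xi; rewrite mulr_ge0// sqmod_ge0.
apply: ge0_le_integral_EFin.
- apply: measurable_funM; last exact: measurable_sqmod (mW k).
  apply: measurable_funB => //; apply: measurable_funM => //.
  have -> : (fun x => cos (dot t x)) = (fun x => cos (dot x t)).
    by apply/funext => x; congr cos; rewrite /dot; apply: eq_bigr => i _; rewrite mulrC.
  exact: measurable_cos_dot.
- by apply: measurable_funD; [do 2 apply: measurable_funM => //|exact: measurable_funM].
- by move=> xi; rewrite mulr_ge0 ?sqmod_ge0//; have /andP[] := c4 xi.
- by move=> xi; exact: symbol_bound.
Qed.

Let WV_cvg e : 0 < e -> \forall k \near \oo, (\int[mu]_xi (sqmod (W k xi - V xi))%:E <= e%:E)%E.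
Proof.
move=> e0; have [_ [_ cW] _] := HU.
have s0 : 0 < Num.sqrt e by rewrite sqrtr_gt0.
have := cvg0_near_lt cW s0; apply: filterS => k /ltW /(L2norm_lt (ltW s0)).
by rewrite sqr_sqrtr// ltW.
Qed.

(** On [S m] the truncations of index at least [m] agree with [U] both at [x] and
    at [x + t]; as [m] grows these sets exhaust the space. *)
Let S (m : nat) : set 'rV[R]_n := [set x | enorm x <= m%:R] `&` [set x | enorm (x + t) <= m%:R].

Let mS m : measurable (S m).
Proof.
apply: measurableI; first exact: measurable_eball.
have [mt _] := row_translation t.
by have := mt measurableT _ (measurable_eball m%:R); rewrite setTI.
Qed.

Let S_cover : \bigcup_m S m = setT.
Proof.
apply/seteqP; split => // x _.
pose M := Num.max (enorm x) (enorm (x + t)).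
have M0 : 0 <= M by rewrite le_max enorm_ge0.
have h := ltW (archi_boundP M0); exists (Num.bound M) => //.
by split; rewrite /= (le_trans _ h)// le_max lexx ?orbT.
Qed.

(** On [S m] the integral is bounded by [Dk_bound] with [d] small and then [k]
    large; monotone convergence in [m] gives the integral over the whole space. *)
Lemma H1_translation : (\int[mu]_x (D x)%:E <= (dot t t)%:E * energy)%E.
Proof.
have X0 : (0 <= (dot t t)%:E * energy)%E by rewrite mule_ge0// lee_fin dot_ge0.
have Xfin : ((dot t t)%:E * energy)%E \is a fin_num.
  by rewrite fin_numM// ge0_fin_numE.
have H m e : 0 < e -> (\int[mu]_(x in S m) (D x)%:E <= (dot t t)%:E * energy + e%:E)%E.
  move=> e0; set X := (_ * energy)%E in X0 Xfin *.
  have X1 : 0 <= fine X by exact: fine_ge0.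
  (* both error terms [d * X] and [4 * (1 + d^-1) * eta] are at most [e / 2] *)
  pose d := e / (2 * (fine X + 1)).
  have d0 : 0 < d by rewrite divr_gt0// mulr_gt0// ltr_wpDl.
  pose eta := e / (8 * (1 + d^-1)).
  have d10 : 0 < 1 + d^-1 by rewrite ltr_wpDr// invr_ge0 ltW.
  have eta0 : 0 < eta by rewrite divr_gt0// mulr_gt0.
  have [N _ hN] := WV_cvg eta0.
  pose k := maxn N m.
  apply: (@le_trans _ _ (\int[mu]_x (Dk k x)%:E)%E).
    rewrite integral_mkcond; apply: ge0_le_integral => //.
    - by move=> x _; apply: erestrict_ge0 => y _; rewrite lee_fin addr_ge0 ?sqr_ge0.
    - by apply/(measurable_restrictT _ (mS m)); apply/measurable_EFinP; exact: measurable_funTS.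
    - exact/measurable_EFinP.
    - move=> x _; rewrite patchE; case: ifPn => xS; last by rewrite lee_fin addr_ge0 ?sqr_ge0.
      have [x1 x2] : S m x by move: xS; rewrite inE.
      have mk : (m%:R : R) <= k%:R by rewrite ler_nat leq_maxr.
      rewrite /Dk /ak /bk !indicE !mem_set ?mulr1//.
        exact: le_trans mk.
      exact: le_trans mk.
  apply: (le_trans (Dk_bound k d0)); rewrite -/X.
  apply: (@le_trans _ _ ((1 + d)%:E * X + (4 * (1 + d^-1))%:E * eta%:E)%E).
    apply: leeD => //; apply: lee_wpmul2l; first by rewrite lee_fin mulr_ge0// ltW.
    exact: (hN _ (leq_maxl _ _)).
  rewrite -(fineK Xfin) -!EFinM -!EFinD lee_fin mulrDl mul1r -addrA lerD2l.
  have -> : 4 * (1 + d^-1) * eta = e / 2.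
    by rewrite /eta; move: (1 + d^-1) d10 => q q0; field; rewrite gt_eqF.
  have : d * fine X <= e / 2.
    have -> : d * fine X = e / 2 * (fine X / (fine X + 1)).
      by rewrite /d; field; rewrite gt_eqF// ltr_wpDl.
    rewrite ler_piMr ?divr_ge0 ?(ltW e0)// ler_pdivrMr ?ltr_wpDl// mul1r lerDl//.
  lra.
have ndS : nondecreasing_seq S.
  move=> i j ij; apply/subsetPset => x [x1 x2]; have ij' : (i%:R : R) <= j%:R by rewrite ler_nat.
  by split; [exact: le_trans x1 _|exact: le_trans x2 _].
have := @ge0_nondecreasing_set_cvg_integral _ _ _ S (EFin \o D) mu ndS mS.
rewrite S_cover => /(_ _ _)/cvg_lim <-//; last 2 first.
- by move=> i; apply/measurable_EFinP; exact: measurable_funTS.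
- by move=> i x _ /=; rewrite lee_fin addr_ge0 ?sqr_ge0.
apply/lee_addgt0Pr => e e0.
apply: lime_le; last by apply: nearW => m; exact: H.
apply: ereal_nondecreasing_is_cvgn; apply: ge0_nondecreasing_set_nondecreasing_integral => //.
- by move=> i; apply/measurable_EFinP; exact: measurable_funTS.
- by move=> i x _ /=; rewrite lee_fin addr_ge0 ?sqr_ge0.
Qed.

End h1_translation.

(** * Smooth functions on the line *)

Section smooth_line.
Context {R : realType}.
Implicit Types (p q : {poly R}) (f g : R -> R).

(** All derivatives of [exp(-1/x)] are polynomials in [1/x] times [exp(-1/x)]; the
    family [flat] is stable under differentiation ([flat_deriv]). *)
Definition flat p (x : R) : R := if 0 < x then p.[x^-1] * expR (- x^-1) else 0.

Lemma exprn_le_fact_expR (y : R) k : 0 <= y -> y ^+ k <= k`!%:R * expR y.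
Proof.
move=> y0; case: k => [|k]; first by rewrite expr0 mul1r -[leLHS]addr0 (le_trans _ (expR_ge1Dx y))// lerD2l.
have := expR_ge1Dxn k y0; have : 0 < (k.+1`!%:R : R) by rewrite ltr0n fact_gt0.
move=> f0 h; rewrite mulrC -ler_pdivrMr//; lra.
Qed.

(** Coefficient by coefficient, as [y^k <= k! e^y] for [y >= 0]. *)
Lemma poly_expRN_bounded p :
  exists2 C, 0 <= C & forall y, 0 <= y -> `|p.[y]| * expR (- y) <= C.
Proof.
exists (\sum_(i < size p) `|p`_i| * i`!%:R); first by apply: sumr_ge0 => i _; rewrite mulr_ge0.
move=> y y0; rewrite expRN ler_pdivrMr ?expR_gt0// horner_coef.
apply: (le_trans (ler_norm_sum _ _ _)); rewrite mulr_suml; apply: ler_sum => i _.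
rewrite normrM -mulrA ler_wpM2l// ger0_norm ?exprn_ge0//; exact: exprn_le_fact_expR.
Qed.

Lemma is_derive_sqr_small f (C : R) : 0 <= C -> (forall x, `|f x| <= C * x ^+ 2) ->
  is_derive (0 : R) (1 : R) f 0.
Proof.
move=> C0 fC; have f0 : f 0 = 0.
  by apply/eqP; rewrite -normr_le0 (le_trans (fC 0))// expr0n mulr0.
have H : h^-1 *: (f (h *: 1 + 0) - f 0) @[h --> (0:R)^'] --> (0 : R).
  apply/cvgr0Pnorm_le => e e0; near=> x.
  have x0 : x != 0 by near: x; exact: nbhs_dnbhs_neq.
  rewrite f0 subr0 addr0 [_ *: 1]mulr1 normrM normfV.
  rewrite ler_pdivrMl ?normr_gt0//; apply: (le_trans (fC x)).
  rewrite -(real_normK (num_real x)) expr2 mulrA [leRHS]mulrC ler_wpM2r//.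
  have : `|x| <= e / (C + 1).
    by near: x; apply: dnbhs0_le; rewrite divr_gt0// ltr_wpDl.
  rewrite ler_pdivlMr ?ltr_wpDl// mulrC; apply: le_trans.
  by rewrite ler_wpM2r// lerDl.
by apply: DeriveDef; [apply/cvg_ex; exists 0|exact: cvg_lim H].
Unshelve. all: by end_near.
Qed.

Lemma flat_deriv p (x : R) : is_derive x (1 : R) (flat p) (flat ('X^2 * (p - p^`())) x).
Proof.
have [x0|x0|->] := ltgtP x 0.
- apply: (near_eq_is_derive (f := cst 0)).
    near=> y; rewrite /flat ifN// -leNgt; apply/ltW; near: y; exact: lt_nbhsl.
  by apply: is_derive_eq; rewrite /flat ifN// -leNgt ltW.
- apply: (near_eq_is_derive (f := fun y : R => p.[y^-1] * expR (- y^-1) : R)).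
    near=> y; rewrite /flat ifT//; near: y; exact: lt_nbhsr.
  have xn : x != 0 by rewrite gt_eqF.
  have dV : is_derive x (1 : R) (fun y : R => y^-1) (- (x ^- 2)).
    have := is_deriveV xn (is_derive_id x (1 : R)) => /= h.
    by apply: is_derive_eq; rewrite [_ *: _]mulr1.
  have dp := is_derive1_comp (is_derive_poly p x^-1) dV.
  have de := @is_derive1_comp R expR (fun y : R => - y^-1) x _ _ (is_derive_expR (- x^-1)) (is_deriveN dV).
  have := is_deriveM dp de => /= h; apply: is_derive_eq.
  rewrite /flat x0 !hornerE /= /GRing.scale /=.
  by move: (expR _) => q; field.
- rewrite {2}/flat ltxx; have [C C0 pC] := poly_expRN_bounded ('X^2 * p).
  apply: (is_derive_sqr_small C0) => z; rewrite /flat; case: ifPn => x0; last first.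
    by rewrite normr0 mulr_ge0 ?sqr_ge0.
  have xV : 0 <= z^-1 by rewrite invr_ge0 ltW.
  have := pC _ xV; rewrite !hornerE /= !normrM [`|expR _|]ger0_norm ?expR_ge0//.
  rewrite [`|z^-1|]ger0_norm// => h.
  have -> : `|p.[z^-1]| * expR (- z^-1) = z^-1 * z^-1 * `|p.[z^-1]| * expR (- z^-1) * z ^+ 2.
    by move: (expR _) `|_| => q r; field; rewrite gt_eqF.
  by rewrite -[leRHS]mulrA -expr2 ler_wpM2r ?sqr_ge0.
Unshelve. all: by end_near.
Qed.

(** Every member has a derivative in the class ([smooth_line_deriv]), hence
    derivatives of all orders.  Primitives are included for the sake of sliding
    integrals of bumps. *)
Inductive smooth_line : (R -> R) -> Prop :=
| smooth_line_cst c : smooth_line (cst c)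
| smooth_line_flat p : smooth_line (flat p)
| smooth_line_affine f c d : smooth_line f -> smooth_line (fun x => f (c + d * x))
| smooth_lineD f g : smooth_line f -> smooth_line g -> smooth_line (fun x => f x + g x)
| smooth_lineM f g : smooth_line f -> smooth_line g -> smooth_line (fun x => f x * g x)
| smooth_line_primitive f g : (forall x : R, is_derive x (1 : R) f (g x)) -> smooth_line g ->
    smooth_line f.

Lemma smooth_line_deriv f : smooth_line f ->
  exists2 g, smooth_line g & forall x : R, is_derive x (1 : R) f (g x).
Proof.
elim=> {f} [c|p|f c d fs [g gs gd]|f1 f2 fs1 [g1 gs1 gd1] fs2 [g2 gs2 gd2]
  |f1 f2 fs1 [g1 gs1 gd1] fs2 [g2 gs2 gd2]|f g fg gs _].
- by exists (cst 0) => [|x]; [exact: smooth_line_cst|exact: is_derive_cst].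
- by exists (flat ('X^2 * (p - p^`()))) => [|x]; [exact: smooth_line_flat|exact: flat_deriv].
- exists (fun x => d * g (c + d * x)) => [|x].
    by apply: smooth_lineM; [exact: smooth_line_cst|exact: smooth_line_affine].
  have da : is_derive x (1 : R) (fun x : R => c + d * x) d.
    have := is_deriveD (is_derive_cst c x (1 : R)) (is_deriveZ d (is_derive_id x (1 : R))).
    by rewrite add0r [_ *: _]mulr1.
  by rewrite mulrC; exact: (@is_derive1_comp R f (fun y => c + d * y) x _ _ (gd (c + d * x)) da).
- exists (fun x => g1 x + g2 x) => [|x]; first exact: smooth_lineD.
  exact: is_deriveD.
- exists (fun x => f1 x * g2 x + f2 x * g1 x) => [|x].
    by apply: smooth_lineD; exact: smooth_lineM.
  exact: is_deriveM.
- by exists g.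
Qed.

Lemma smooth_line_continuous f : smooth_line f -> continuous f.
Proof.
move=> /smooth_line_deriv[g _ fg] x; apply: differentiable_continuous.
by apply/derivable1_diffP; have [] := fg x.
Qed.

Lemma smooth_line_measurable f : smooth_line f -> measurable_fun setT f.
Proof. by move=> /smooth_line_continuous; exact: continuous_measurable_fun. Qed.

End smooth_line.

(** * Bumps and their sliding integrals *)

Lemma integral_indic_itv (R : realType) (a b : R) (x y : bool) :
  (\int[@lebesgue_measure R]_z (\1_([set` Interval (BSide x a) (BSide y b)] : set R) z)%:E =
   (if (a < b)%R then b - a else 0)%:E)%E.
Proof.
transitivity (@lebesgue_measure R [set` Interval (BSide x a) (BSide y b)]).
  by rewrite (@integral_indic _ _ R lebesgue_measure setT measurableT _ (measurable_itv _)) setIT.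
by rewrite lebesgue_measure_itv/= lte_fin; case: ifP => // _; rewrite -EFinD.
Qed.

Section window.
Context {R : realType}.
Local Notation leb := (@lebesgue_measure R).
Implicit Types (f : R -> R) (s z e : R).

Definition window s f z : R := \int[leb]_(r in `]z, z + s]) f r.

Let cumul f z : R := \int[leb]_(r in `]-oo, z]) f r.

Variables (s : R) (f : R -> R).
Hypotheses (s0 : 0 <= s) (fs : smooth_line f) (f0 : forall x, 0 <= f x).
Hypothesis (fi : leb.-integrable setT (EFin \o f)).

Let mf : measurable_fun setT f. Proof. exact: smooth_line_measurable. Qed.

Let windowE z : window s f z = cumul f (z + s) - cumul f z.
Proof.
rewrite /window /cumul (@Rintegral_itvB R f -oo%O (BRight (z + s)) z) ?bnd_simp//.
  exact: (@integrableS _ _ _ leb setT).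
by rewrite lerDl.
Qed.

Let cumul_deriv z : is_derive z (1 : R) (cumul f) (f z).
Proof.
have ioo : leb.-integrable [set` Interval -oo%O (BRight (z + 1))] (EFin \o f).
  by apply: (@integrableS _ _ _ leb setT).
have z1 : z < z + 1 by rewrite ltrDl.
have [d dE] := @continuous_FTC1 R f -oo%O z (z + 1) z1 ioo (ltNyr _) (@smooth_line_continuous R f fs z).
by rewrite -dE derive1E; apply: DeriveDef.
Qed.

Lemma window_deriv z : is_derive z (1 : R) (window s f) (f (z + s) - f z).
Proof.
have -> : window s f = (cumul f \o (fun z => z + s)) - cumul f.
  by apply/funext => y; exact: windowE.
have da : is_derive z (1 : R) (fun z => z + s) (1 : R).
  by have := is_deriveD (is_derive_id z (1 : R)) (is_derive_cst s z (1 : R)); rewrite addr0.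
have := @is_derive1_comp R (cumul f) (fun z => z + s) z _ _ (cumul_deriv (z + s)) da.
by rewrite mulr1 => h; exact: (is_deriveB h (cumul_deriv z)).
Qed.

Lemma smooth_line_window : smooth_line (window s f).
Proof.
apply: (smooth_line_primitive window_deriv).
apply: (smooth_lineD (f := fun z => f (z + s)) (g := fun z => - f z)).
  rewrite (_ : (fun z => f (z + s)) = (fun z => f (s + 1 * z))).
    exact: smooth_line_affine.
  by apply/funext => z; rewrite mul1r addrC.
rewrite (_ : (fun z => - f z) = (fun z => cst (-1) z * f z)).
  by apply: smooth_lineM => //; exact: smooth_line_cst.
by apply/funext => z; rewrite mulN1r.
Qed.

Lemma window_ge0 z : 0 <= window s f z.
Proof. by apply: Rintegral_ge0 => // x _. Qed.

Lemma window_eq0 e z : (forall x, e <= `|x| -> f x = 0) -> e + s <= `|z| -> window s f z = 0.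
Proof.
move=> fe ez; rewrite /window (@eq_Rintegral _ _ _ leb _ (cst 0)) ?Rintegral_cst ?mul0r//.
move=> x; rewrite inE/= in_itv/= => /andP[zx xz]; apply: fe.
move: ez; rewrite !ler_normr => /orP[h|h]; apply/orP; [left|right]; lra.
Qed.

Let windowE_indic z : (window s f z)%:E =
  (\int[leb]_r (f r * \1_(`]0%R, s]%classic : set R) (r - z))%:E)%E.
Proof.
rewrite -EFin_Rintegral; last first.
  apply: (intgMbdd (C := 1) fi) => [|x]; last by rewrite indicE; case: (_ \in _); rewrite ?normr1 ?normr0.
  apply: (@measurableT_comp _ _ _ _ _ _ (\1_(`]0%R, s]%classic : set R) : R -> R) _ (fun r : R => r - z)).
    exact: measurable_indic.
  by apply: measurable_funB.
rewrite /window Rintegral_mkcond; congr EFin; apply: eq_Rintegral => r _; rewrite patchE indicE.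
have -> : (r - z \in (`]0%R, s]%classic : set R)) = (r \in (`]z, (z + s)%R]%classic : set R)).
  apply/idP/idP; rewrite !inE/= !in_itv/= => /andP[h1 h2]; apply/andP; split; lra.
by case: ifPn => _; rewrite ?mulr1 ?mulr0.
Qed.

(** By Tonelli, since each [r] lies in [`]z, z + s]] for a set of [z] of length [s]. *)
Lemma integral_window : (\int[leb]_z (window s f z)%:E = s%:E * \int[leb]_x (f x)%:E)%E.
Proof.
pose k (z : R * R) := f z.2 * \1_(`]0%R, s]%classic : set R) (z.2 - z.1).
have mk : measurable_fun setT k.
  apply: measurable_funM; first exact: (measurableT_comp mf (@measurable_snd _ _ R R)).
  apply: (@measurableT_comp _ _ _ _ _ _ (\1_(`]0%R, s]%classic : set R) : R -> R) _ (fun z : R * R => z.2 - z.1)).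
    exact: measurable_indic.
  by apply: measurable_funB; [exact: measurable_snd|exact: measurable_fst].
have k0 (z : R * R) : 0 <= k z by rewrite mulr_ge0.
transitivity (\int[leb]_z \int[leb]_r (k (z, r))%:E)%E.
  by apply: eq_integral => z _; exact: windowE_indic.
rewrite (fubini_tonelli (m1 := leb) (m2 := leb) (EFin \o k))/=; last 2 first.
- exact/measurable_EFinP.
- by move=> z; rewrite lee_fin.
rewrite -ge0_integral_EFinZ//; apply: eq_integral => r _.
rewrite /k /= ge0_integral_EFinZ//; last first.
  apply: (@measurableT_comp _ _ _ _ _ _ (\1_(`]0%R, s]%classic : set R) : R -> R) _ (fun z : R => r - z)).
    exact: measurable_indic.
  by apply: measurable_funB.
rewrite EFinM muleC; congr (_ * _)%E.
transitivity (\int[leb]_z (\1_(`[(r - s)%R, r[%classic : set R) z)%:E)%E.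
  apply: eq_integral => z _; rewrite !indicE; congr ((_ : bool)%:R%:E).
  by apply/idP/idP; rewrite !inE/= !in_itv/= => /andP[h1 h2]; apply/andP; split; lra.
rewrite integral_indic_itv ltrBlDr ltrDl opprB addrC subrK.
by case: ltP => // s0'; congr EFin; apply/eqP; rewrite eq_le s0 s0'.
Qed.

End window.

Section bump_function.
Context {R : realType}.
Local Notation leb := (@lebesgue_measure R).
Variable e : R.
Hypothesis e0 : 0 < e.

Definition bump (z : R) : R := flat 1 (1 + (- e^-1) * z) * flat 1 (1 + e^-1 * z).

Lemma smooth_line_bump : smooth_line bump.
Proof. by apply: smooth_lineM; apply: smooth_line_affine; exact: smooth_line_flat. Qed.

Lemma flat1_ge0 (x : R) : 0 <= flat 1 x.
Proof. by rewrite /flat; case: ifP => // _; rewrite hornerE mul1r expR_ge0. Qed.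

Lemma flat1_le1 (x : R) : flat 1 x <= 1.
Proof.
rewrite /flat; case: ifP => // x0; rewrite hornerE mul1r -[leRHS]expR0 ler_expR.
by rewrite oppr_le0 invr_ge0 ltW.
Qed.

Lemma bump_ge0 z : 0 <= bump z.
Proof. by rewrite mulr_ge0// flat1_ge0. Qed.

Lemma bump_le1 z : bump z <= 1.
Proof. by rewrite mulr_ile1 ?flat1_ge0 ?flat1_le1. Qed.

Lemma bump_eq0 z : e <= `|z| -> bump z = 0.
Proof.
rewrite ler_normr => /orP[h|h]; rewrite /bump /flat.
  rewrite ifN ?mul0r// -leNgt mulNr subr_le0 mulrC ler_pdivlMr// mul1r//.
rewrite mulrC ifN ?mul0r// -leNgt -[e^-1 * z]opprK -mulrN subr_le0 mulrC ler_pdivlMr// mul1r//.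
Qed.

(** At points at most [e / 2] away from [0] both factors of the bump are values of
    [exp(-1/y)] with [y >= 1/2]. *)
Lemma bump_lower_bound z : expR (- 2) ^+ 2 * \1_(`[- (e / 2), e / 2]%classic : set R) z <= bump z.
Proof.
rewrite indicE; case: (boolP (_ \in _)); rewrite ?mulr0 ?bump_ge0// mulr1 inE/= in_itv/= => /andP[h1 h2].
have h (y : R) : 2^-1 <= y -> expR (- 2) <= flat 1 y.
  move=> y2; have y0 : 0 < y by apply: lt_le_trans y2; rewrite invr_gt0.
  by rewrite /flat y0 hornerE mul1r ler_expR lerN2 -[leRHS]invrK lef_pV2// posrE invr_gt0.
have h3 : e^-1 * z <= 2^-1 by rewrite mulrC ler_pdivrMr// mulrC.
have h4 : - 2^-1 <= e^-1 * z by rewrite mulrC ler_pdivlMr// mulNr mulrC.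
by rewrite expr2 /bump ler_pM ?expR_ge0//; apply: h; lra.
Qed.

Lemma intg_bump : leb.-integrable setT (EFin \o bump).
Proof.
have mb := smooth_line_measurable smooth_line_bump.
apply: (@intg_le _ _ R leb bump _ mb (intg_indic_itv (- e) e)) => z.
rewrite ger0_norm ?bump_ge0// indicE; case: (boolP (_ \in _)); rewrite ?bump_le1//.
rewrite notin_setE/= in_itv/= -ler_norml => /negP; rewrite -ltNge => /ltW/bump_eq0 ->//.
Qed.

Lemma bump_mass_gt0 : (0 < \int[leb]_z (bump z)%:E)%E.
Proof.
have mb := smooth_line_measurable smooth_line_bump.
have mi : measurable_fun setT (\1_(`[- (e / 2), e / 2]%classic : set R) : R -> R).
  exact: measurable_indic.
have p0 : 0 <= expR (- 2 : R) ^+ 2 by rewrite sqr_ge0.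
apply: (@lt_le_trans _ _ (\int[leb]_z (expR (- 2) ^+ 2 * \1_(`[- (e / 2), e / 2]%classic : set R) z)%:E)%E); last first.
  apply: ge0_le_integral_EFin => //; first exact: measurable_funM.
  by move=> z; exact: bump_lower_bound.
rewrite (@ge0_integral_EFinZ _ _ R leb)// mule_gt0 ?lte_fin ?exprn_gt0 ?expR_gt0//.
have h : - (e / 2) < e / 2 by rewrite gtrN// divr_gt0.
by rewrite integral_indic_itv h lte_fin subr_gt0.
Qed.

End bump_function.

(** * Products of functions of one coordinate *)

Section tensor.
Context {R : realType}.
Local Notation leb := (@lebesgue_measure R).

Definition tensor n (f : 'I_n -> R -> R) (y : 'rV[R]_n) : R := \prod_(i < n) f i (y ord0 i).

Lemma measurable_tensor n (f : 'I_n -> R -> R) : (forall i, measurable_fun setT (f i)) ->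
  measurable_fun setT (tensor f).
Proof.
move=> mf; apply: (@measurable_prod _ _ R _ _ _ (fun i (y : 'rV[R]_n) => f i (y ord0 i))) => i _.
exact: (measurableT_comp (mf i) (measurable_row_coord i)).
Qed.

Lemma tensor_ge0 n (f : 'I_n -> R -> R) y : (forall i z, 0 <= f i z) -> 0 <= tensor f y.
Proof. by move=> f0; apply: prodr_ge0 => i _. Qed.

Lemma tensor_eq0 n (f : 'I_n -> R -> R) (y : 'rV[R]_n) i : f i (y ord0 i) = 0 -> tensor f y = 0.
Proof. by move=> fi0; rewrite /tensor (bigD1 i)//= fi0 mul0r. Qed.

Lemma ge0_integral_tensor n (f : 'I_n -> R -> R) : (forall i, measurable_fun setT (f i)) ->
  (forall i z, 0 <= f i z) ->
  (\int[lebesgue_row n]_y (tensor f y)%:E = \prod_(i < n) \int[leb]_z (f i z)%:E)%E.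
Proof.
elim: n f => [|n IHn] f mf f0.
  rewrite big_ord0; under eq_integral do rewrite /tensor big_ord0.
  rewrite integral_cst// mul1e; exact: diracT.
rewrite ge0_integral_rowS1; last 2 first.
- by apply/measurable_EFinP; exact: measurable_tensor.
- by move=> y; rewrite lee_fin; exact: tensor_ge0.
pose g i := f (lift ord0 i); rewrite big_ord_recl -(IHn g (fun i => mf _) (fun i z => f0 _ z)).
have mg : measurable_fun setT (tensor g) by apply: measurable_tensor => i; exact: mf.
rewrite -ge0_integralZr//; last 3 first.
- by apply/measurable_EFinP; exact: (mf ord0).
- by move=> z _; rewrite lee_fin.
- by apply: integral_ge0 => y _; rewrite lee_fin; apply: tensor_ge0 => i z; exact: f0.
apply: eq_integral => a _; rewrite -ge0_integral_EFinZ//; last first.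
  by move=> y; apply: tensor_ge0 => i z; exact: f0.
apply: eq_integral => v _; rewrite /tensor big_ord_recl row_cons0; congr (_ * _)%:E.
by apply: eq_bigr => i _; rewrite row_consS.
Qed.

Lemma compact_box n (M : R) : compact (@box R n M).
Proof. by apply: (@rV_compact R n (fun=> `[- M, M]%classic)) => i; exact: segment_compact. Qed.

Variable n : nat.
Implicit Types (f : 'I_n -> R -> R) (x y : 'rV[R]_n).

Definition factor_replace f (j : 'I_n) (g : R -> R) (i : 'I_n) : R -> R :=
  if i == j then g else f i.

Lemma tensor_replace f j g y : tensor (factor_replace f j g) y =
  g (y ord0 j) * \prod_(i < n | i != j) f i (y ord0 i).
Proof.
rewrite /tensor (bigD1 j)//= /factor_replace eqxx; congr (_ * _).
by apply: eq_bigr => i ij; rewrite (negPf ij).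
Qed.

Lemma tensor_split f j y :
  tensor f y = f j (y ord0 j) * \prod_(i < n | i != j) f i (y ord0 i).
Proof. by rewrite /tensor (bigD1 j). Qed.

Lemma partial_tensor f j g : (forall z : R, is_derive z (1 : R) (f j) (g z)) ->
  partial j (tensor f) = tensor (factor_replace f j g).
Proof.
move=> fg; apply/funext => y; rewrite tensor_replace /partial.
set c := \prod_(i < n | _) _.
have E : (fun h : R => h^-1 *: (tensor f (h *: delta_mx ord0 j + y) - tensor f y)) =
   (fun h : R => c * (h^-1 *: (f j (h *: 1 + y ord0 j) - f j (y ord0 j)))).
  apply/funext => h; rewrite !(tensor_split f j) -/c.
  have -> : \prod_(i < n | i != j) f i ((h *: delta_mx ord0 j + y) ord0 i) = c.
    by apply: eq_bigr => i ij; rewrite !mxE (negPf ij) andbF mulr0 add0r.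
  by rewrite !mxE !eqxx/= /GRing.scale/=; ring.
have [dj ej] := fg (y ord0 j).
rewrite /derive E mulrC; apply: cvg_lim; first exact: Rhausdorff.
by rewrite -ej; exact: cvgM (cvg_cst c) dj.
Qed.

Lemma differentiable_tensor f y : (forall i z, differentiable (f i) z) ->
  differentiable (tensor f) y.
Proof.
move=> df; rewrite /tensor; elim: (index_enum _) => [|i r IHr].
  have -> : (fun y : 'rV[R]_n => \prod_(i <- [::]) f i (y ord0 i)) = cst 1.
    by apply/funext => z; rewrite big_nil.
  exact: differentiable_cst.
have -> : (fun y : 'rV[R]_n => \prod_(i0 <- i :: r) f i0 (y ord0 i0)) =
    (f i \o (fun y : 'rV[R]_n => y ord0 i)) * (fun y => \prod_(i0 <- r) f i0 (y ord0 i0)).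
  by apply/funext => z; rewrite big_cons.
apply: differentiableM => //; apply: differentiable_comp; last exact: df.
exact: differentiable_coord.
Qed.

(** A partial derivative of a product is a product of the same kind with one factor
    differentiated, so that all iterated derivatives are differentiable. *)
Lemma smooth_tensor f : (forall i, smooth_line (f i)) -> smooth (tensor f).
Proof.
move=> fs s y.
have [g gs ->] : exists2 g, (forall i, smooth_line (g i)) & foldr partial (tensor f) s = tensor g.
  elim: s => [|j s [g gs /= ->]]; first by exists f.
  have [g' g's g'd] := smooth_line_deriv (gs j).
  exists (factor_replace g j g') => [i|]; last exact: partial_tensor.
  by rewrite /factor_replace; case: eqP.
apply: differentiable_tensor => i z; apply/derivable1_diffP.
by have [h _ /(_ z)[]] := smooth_line_deriv (gs i).
Qed.

Lemma test_function_tensor f (M : R) : (forall i, smooth_line (f i)) ->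
  (forall i z, M < `|z| -> f i z = 0) -> test_function (tensor f).
Proof.
move=> fs fM; split; first exact: smooth_tensor.
pose B := @box R n M; have cB : compact B := @compact_box n M.
have clB : closed B by apply: compact_closed => //; exact: norm_hausdorff.
apply: (subclosed_compact _ cB); first exact: closed_closure.
rewrite ((closure_id B).1 clB); apply: closure_subset => y /= /eqP y0 i.
rewrite /= in_itv/= -ler_norml leNgt; apply/negP => h; apply: y0; apply: (@tensor_eq0 _ _ _ i).
exact: fM.
Qed.

End tensor.

(** * Convolution with a nonnegative weight *)

Section convolution.
Context {R : realType} {n : nat}.
Local Notation mu := (@lebesgue_row R n).
Implicit Types (f w : 'rV[R]_n -> R).

Lemma measurable_row_sub :
  measurable_fun setT (fun z : 'rV[R]_n * 'rV[R]_n => z.1 - z.2).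
Proof.
apply: measurable_fun_rowP => i.
apply: (eq_measurable_fun (fun z : 'rV[R]_n * 'rV[R]_n => z.1 ord0 i - z.2 ord0 i)).
  by move=> z _; rewrite !mxE.
apply: measurable_funB.
  exact: (measurableT_comp (measurable_row_coord i) (@measurable_fst _ _ _ _)).
exact: (measurableT_comp (measurable_row_coord i) (@measurable_snd _ _ _ _)).
Qed.

Lemma measurable_row_reflect f x : measurable_fun setT f ->
  measurable_fun setT (fun y : 'rV[R]_n => f (x - y)).
Proof. by move=> mf; have [mt _] := row_subtraction x; exact: (measurableT_comp mf mt). Qed.

Lemma ge0_integral_row_reflect f x : measurable_fun setT f -> (forall y, 0 <= f y) ->
  (\int[mu]_y (f (x - y))%:E = \int[mu]_y (f y)%:E)%E.
Proof.
move=> mf f0; rewrite [RHS](ge0_integral_preserving (row_subtraction x))//.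
exact/measurable_EFinP.
Qed.

(** Because [|f w| <= f^2 + w] when [0 <= w <= 1]. *)
Lemma intg_mul_weight f w : measurable_fun setT f -> mu.-integrable setT (EFin \o (fun x => f x ^+ 2)) ->
  mu.-integrable setT (EFin \o w) -> (forall x, 0 <= w x <= 1) ->
  mu.-integrable setT (EFin \o (fun x => f x * w x)).
Proof.
move=> mf f2 wi w01; have mw := intg_measurable wi.
apply: (intg_le (measurable_funM mf mw) (intgD f2 wi)) => x.
have /andP[w0 w1] := w01 x; rewrite normrM (ger0_norm w0) -(real_normK (num_real (f x))).
move: `|f x| (normr_ge0 (f x)) => p p0; have := sqr_ge0 (p - w x).
have : w x * w x <= w x by rewrite ler_piMr.
nra.
Qed.

Variables (w : 'rV[R]_n -> R) (M : R).
Hypotheses (mw : measurable_fun setT w) (w0 : forall x, 0 <= w x).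
Hypothesis (wM : (\int[mu]_x (w x)%:E = M%:E)%E).

Let M0 : 0 <= M.
Proof. by rewrite -lee_fin -wM integral_ge0// => x _; rewrite lee_fin. Qed.

Let mw2 : measurable_fun setT (fun z : 'rV[R]_n * 'rV[R]_n => w (z.1 - z.2)).
Proof. exact: (measurableT_comp mw measurable_row_sub). Qed.

(** Cauchy-Schwarz with the weight [w (x - y)], followed by Tonelli: each of the two
    integrations of the weight contributes a factor [M]. *)
Lemma convolution_l2 f : measurable_fun setT f ->
  (\int[mu]_x ((\int[mu]_y (f y * w (x - y))) ^+ 2)%:E <=
   (M ^+ 2)%:E * \int[mu]_y (f y ^+ 2)%:E)%E.
Proof.
move=> mf.
pose k (z : 'rV[R]_n * 'rV[R]_n) : R := f z.2 ^+ 2 * w (z.1 - z.2).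
have mf2 : measurable_fun setT (fun y => f y ^+ 2) by exact: measurable_funX.
have mk : measurable_fun setT k.
  by apply: measurable_funM => //; exact: (measurableT_comp mf2 (@measurable_snd _ _ _ _)).
have k0 z : 0 <= k z by rewrite mulr_ge0 ?sqr_ge0.
apply: (@le_trans _ _ (\int[mu]_x (M%:E * \int[mu]_y (k (x, y))%:E))%E).
  apply: ge0_le_integral => //.
  - by move=> x _; rewrite lee_fin sqr_ge0.
  - apply/measurable_EFinP; apply: measurable_funX.
    apply: (measurable_Rintegral2 mu (f := fun z : 'rV[R]_n * 'rV[R]_n => f z.2 * w (z.1 - z.2) : R)).
    by apply: measurable_funM => //; exact: (measurableT_comp mf (@measurable_snd _ _ _ _)).
  - apply: measurable_funeM; apply: (measurable_integral2 mu (f := EFin \o k)).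
    exact/measurable_EFinP.
  - move=> x _; rewrite -wM -(ge0_integral_row_reflect x mw w0).
    by apply: cauchy_schwarz_weight => //; exact: measurable_row_reflect.
rewrite ge0_integralZl//; last 2 first.
- by apply: (measurable_integral2 mu (f := EFin \o k)); exact/measurable_EFinP.
- by move=> x _; apply: integral_ge0 => y _; rewrite lee_fin.
rewrite (fubini_tonelli (m1 := mu) (m2 := mu) (EFin \o k))/=; last 2 first.
- exact/measurable_EFinP.
- by move=> z; rewrite lee_fin.
rewrite expr2 EFinM -muleA lee_wpmul2l ?lee_fin//.
rewrite -ge0_integral_EFinZ//; last by move=> y; rewrite sqr_ge0.
rewrite le_eqVlt; apply/orP; left; apply/eqP; apply: eq_integral => y _.
rewrite /k /= ge0_integral_EFinZ ?sqr_ge0//; last first.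
  by apply: (measurable_row_translate (f := w) (- y)).
by rewrite (ge0_integral_row_translate (- y) mw w0) wM mulrC.
Qed.

Hypothesis (w1 : forall x, w x <= 1).

Let wi : mu.-integrable setT (EFin \o w).
Proof. by apply: intg_ge0P => //; rewrite wM ltry. Qed.

(** The difference is the integral of [(f x - f (x - z)) * w z] over [z], to which
    Cauchy-Schwarz and Tonelli apply as in [convolution_l2]. *)
Lemma convolution_approximation f eta : measurable_fun setT f ->
  mu.-integrable setT (EFin \o (fun x => f x ^+ 2)) -> 0 <= eta ->
  (forall z, w z != 0 -> (\int[mu]_x ((f x - f (x - z)) ^+ 2)%:E <= eta%:E)%E) ->
  (\int[mu]_x ((M * f x - \int[mu]_y (f y * w (x - y))) ^+ 2)%:E <=
   (M ^+ 2 * eta)%:E)%E.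
Proof.
move=> mf f2 eta0 feta.
have mf1 : measurable_fun setT (fun z : 'rV[R]_n * 'rV[R]_n => f z.1 - f (z.1 - z.2)).
  apply: measurable_funB; first exact: (measurableT_comp mf (@measurable_fst _ _ _ _)).
  exact: (measurableT_comp mf measurable_row_sub).
have mw1 : measurable_fun setT (fun z : 'rV[R]_n * 'rV[R]_n => w z.2).
  exact: (measurableT_comp mw (@measurable_snd _ _ _ _)).
pose k (z : 'rV[R]_n * 'rV[R]_n) : R := (f z.1 - f (z.1 - z.2)) ^+ 2 * w z.2.
have mk : measurable_fun setT k by apply: measurable_funM => //; exact: measurable_funX.
have k0 z : 0 <= k z by rewrite mulr_ge0 ?sqr_ge0.
have E x : M * f x - \int[mu]_y (f y * w (x - y)) =
    \int[mu]_z ((f x - f (x - z)) * w z).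
  have fxi : mu.-integrable setT (EFin \o (fun z => f (x - z) ^+ 2)).
    have [+ _] := integrable_preserving (row_subtraction x) (f := EFin \o (fun z => f z ^+ 2))
      (measurable_int _ f2); exact.
  have fwi := intg_mul_weight (measurable_row_reflect x mf) fxi wi (fun z => introT andP (conj (w0 z) (w1 z))).
  have -> : \int[mu]_y (f y * w (x - y)) = \int[mu]_z (f (x - z) * w z).
    rewrite (Rintegral_preserving (row_subtraction x)); last first.
      by apply: measurable_funM => //; exact: measurable_row_reflect.
    by apply: eq_Rintegral => z _ /=; rewrite subKr.
  have -> : M * f x = \int[mu]_z (f x * w z).
    by rewrite RintegralZ// mulrC /Rintegral wM.
  rewrite -RintegralB//; last exact: intgZ.
  by apply: eq_Rintegral => z _; rewrite mulrBl.
apply: (@le_trans _ _ (\int[mu]_x (M%:E * \int[mu]_y (k (x, y))%:E))%E).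
  apply: ge0_le_integral => //.
  - by move=> x _; rewrite lee_fin sqr_ge0.
  - apply/measurable_EFinP; apply: measurable_funX; under eq_fun do rewrite E.
    apply: (measurable_Rintegral2 mu (f := fun z : 'rV[R]_n * 'rV[R]_n => (f z.1 - f (z.1 - z.2)) * w z.2 : R)).
    exact: measurable_funM.
  - apply: measurable_funeM; apply: (measurable_integral2 mu (f := EFin \o k)).
    exact/measurable_EFinP.
  - move=> x _; rewrite E -wM; apply: cauchy_schwarz_weight => //.
    exact: (measurableT_comp mf1 (measurable_pair1 x)).
rewrite ge0_integralZl//; last 2 first.
- by apply: (measurable_integral2 mu (f := EFin \o k)); exact/measurable_EFinP.
- by move=> x _; apply: integral_ge0 => y _; rewrite lee_fin.
rewrite (fubini_tonelli (m1 := mu) (m2 := mu) (EFin \o k))/=; last 2 first.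
- exact/measurable_EFinP.
- by move=> z; rewrite lee_fin.
rewrite expr2 -mulrA EFinM lee_wpmul2l ?lee_fin// mulrC EFinM -wM -ge0_integral_EFinZ//.
apply: ge0_le_integral => //.
- by move=> z _; apply: integral_ge0 => x _; rewrite lee_fin.
- by apply: (measurable_integral1 mu (f := EFin \o k)); exact/measurable_EFinP.
- by apply/measurable_EFinP; exact: measurable_funM.
move=> z _; rewrite /k /=.
have [wz|wz] := eqVneq (w z) 0.
  rewrite (_ : (\int[mu]_x _)%E = 0%E) ?wz ?mulr0//.
  by apply: integral0_eq => x _; rewrite mulr0.
under eq_integral do rewrite mulrC.
rewrite ge0_integral_EFinZ//; last 2 first.
- by apply: measurable_funX; exact: (measurableT_comp mf1 (measurable_pair2 z)).
- by move=> x; rewrite sqr_ge0.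
by rewrite mulrC EFinM lee_wpmul2l ?lee_fin//; exact: feta.
Qed.

End convolution.

(** * Weak derivatives and translations along an axis *)

Section weak_difference.
Context {R : realType} {n : nat}.
Local Notation mu := (@lebesgue_row R n).
Local Notation leb := (@lebesgue_measure R).
Variables (a g : 'rV[R]_n -> R) (j : 'I_n) (E : R).
Hypotheses (ma : measurable_fun setT a) (mg : measurable_fun setT g).
Hypothesis (a2 : mu.-integrable setT (EFin \o (fun x => a x ^+ 2))).
Hypothesis (g2 : (\int[mu]_x (g x ^+ 2)%:E < +oo)%E).
Hypothesis (E0 : 0 <= E).
Hypothesis (modulus : forall t,
  (\int[mu]_x ((a (x + t) - a x) ^+ 2)%:E <= (dot t t * E)%:E)%E).
Hypothesis (weak : forall phi, test_function phi ->
  \int[mu]_x (a x * partial j phi x) = - \int[mu]_x (g x * phi x)).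

(** [rho] is a product of bumps of radius [e]; in [K] the bump of the coordinate [j]
    is replaced by its sliding integral over a window of length [s]. *)
Section fixed_scale.
Variables (s e : R).
Hypotheses (s0 : 0 <= s) (e0 : 0 < e).

Let v : 'rV[R]_n := s *: delta_mx ord0 j.
Let W (x : 'rV[R]_n) : R := a (x + v) - a x.
Let b := bump e.
Let rho : 'rV[R]_n -> R := tensor (fun=> b).
Let k := factor_replace (fun=> b) j (window s b).
Let K : 'rV[R]_n -> R := tensor k.
Let beta := (\int[leb]_z (b z)%:E)%E.
Let m := fine (\int[mu]_y (rho y)%:E)%E.

Let sb : smooth_line b. Proof. exact: smooth_line_bump. Qed.
Let b0 z : 0 <= b z. Proof. exact: bump_ge0. Qed.
Let bi : leb.-integrable setT (EFin \o b). Proof. exact: intg_bump. Qed.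
Let mb : measurable_fun setT b. Proof. exact: smooth_line_measurable. Qed.

Let k_smooth i : smooth_line (k i).
Proof. by rewrite /k /factor_replace; case: eqP => // _; exact: smooth_line_window. Qed.

Let k_ge0 i z : 0 <= k i z.
Proof. by rewrite /k /factor_replace; case: eqP => // _; exact: window_ge0. Qed.

Let k_eq0 i z : e + s <= `|z| -> k i z = 0.
Proof.
move=> h; rewrite /k /factor_replace; case: eqP => _.
  by apply: (window_eq0 (e := e) _ h) => x; exact: (bump_eq0 e0).
by apply: bump_eq0 => //; rewrite (le_trans _ h)// lerDl.
Qed.

Let mrho : measurable_fun setT rho. Proof. by apply: measurable_tensor => i. Qed.
Let rho0 x : 0 <= rho x. Proof. by apply: tensor_ge0 => i z. Qed.
Let mK : measurable_fun setT K.
Proof. by apply: measurable_tensor => i; exact: smooth_line_measurable. Qed.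
Let K0 x : 0 <= K x. Proof. exact: tensor_ge0. Qed.

Let rho1 x : rho x <= 1.
Proof. by apply: prodr_ile1 => i _; rewrite bump_ge0 bump_le1. Qed.

Let beta_fin : beta \is a fin_num.
Proof. by rewrite ge0_fin_numE ?(intg_lty _ bi)//; apply: integral_ge0 => z _; rewrite lee_fin. Qed.

Let rhoE : (\int[mu]_y (rho y)%:E = m%:E)%E.
Proof.
rewrite fineK// (ge0_integral_tensor (f := fun=> b))//.
by apply: (big_ind (fun x : \bar R => x \is a fin_num)) => // *; exact: fin_numM.
Qed.

Let m_gt0 : 0 < m.
Proof.
rewrite -lte_fin -rhoE (ge0_integral_tensor (f := fun=> b))//.
apply: (big_ind (fun x : \bar R => 0 < x)%E) => // *; first exact: mule_gt0.
exact: bump_mass_gt0.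
Qed.

Let KE : (\int[mu]_y (K y)%:E = (s * m)%:E)%E.
Proof.
rewrite EFinM -rhoE !ge0_integral_tensor//; last first.
  by move=> i; exact: smooth_line_measurable.
rewrite (bigD1 j)//= [in RHS](bigD1 j)//= /k {1}/factor_replace eqxx integral_window// muleA.
by congr (_ * _)%E; apply: eq_bigr => i ij; rewrite /factor_replace (negPf ij).
Qed.

Let rhoi : mu.-integrable setT (EFin \o rho).
Proof. by apply: intg_ge0P => //; rewrite rhoE ltry. Qed.

Let mW : measurable_fun setT W.
Proof. by apply: measurable_funB => //; exact: measurable_row_translate. Qed.

Let W2 : mu.-integrable setT (EFin \o (fun x => W x ^+ 2)).
Proof.
apply: intg_ge0P; first exact: measurable_funX.
  by move=> x; rewrite sqr_ge0.
by apply: le_lt_trans (modulus v) _; rewrite ltry.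
Qed.

Let refl_weight x : mu.-integrable setT (EFin \o (fun y => rho (x - y))).
Proof.
have [+ _] := integrable_preserving (row_subtraction x) (f := EFin \o rho) (measurable_int _ rhoi).
exact.
Qed.

Let reflect_partial (x y : 'rV[R]_n) :
  partial j (tensor (fun i z => k i (x ord0 i + (-1) * z))) y = rho (x - y) - rho (x + v - y).
Proof.
have d (z : R) : is_derive z (1 : R) (fun z => k j (x ord0 j + (-1) * z))
    (b (x ord0 j - z) - b (x ord0 j - z + s)).
  have h : is_derive z (1 : R) (fun z : R => x ord0 j + (-1) * z) (-1).
    have := is_deriveD (is_derive_cst (x ord0 j) z (1 : R)) (is_deriveZ (-1) (is_derive_id z (1 : R))).
    by rewrite add0r [_ *: _]mulr1.
  have kw : k j = window s b by rewrite /k /factor_replace eqxx.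
  have := @is_derive1_comp R (window s b) (fun z => x ord0 j + (-1) * z) z _ _
    (window_deriv s0 sb bi _) h.
  by rewrite kw mulN1r mulrN1 opprB; exact.
rewrite (partial_tensor d) tensor_replace mulrBl /rho !(tensor_split _ j) !mxE !eqxx /= mulr1.
rewrite [in b (_ + s - _)]addrAC; congr (_ - _); congr (_ * _); apply: eq_bigr => i ij;
  by rewrite /k /factor_replace (negPf ij) !mxE ?mulN1r// (negPf ij) andbF mulr0 addr0.
Qed.

(** The weak derivative is tested against [y |-> K (x - y)], whose partial
    derivative is given by [reflect_partial]; translating the integral of
    [a * rho (x + v - .)] by [v] moves the increment from [rho] to [a]. *)
Let difference_convolution x :
  \int[mu]_y (W y * rho (x - y)) = \int[mu]_y (g y * K (x - y)).
Proof.
pose f i z := k i (x ord0 i + (-1) * z).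
have tf : test_function (tensor f).
  apply: (@test_function_tensor _ _ _ (enorm x + e + s)) => [i|i z hz].
    exact: smooth_line_affine.
  apply: k_eq0; rewrite mulN1r distrC.
  have := lerB_dist z (x ord0 i); have := coord_le_enorm x i; lra.
have aw y : mu.-integrable setT (EFin \o (fun z => a z * rho (y - z))).
  by apply: intg_mul_weight => // z; rewrite rho0 rho1.
have -> : \int[mu]_y (g y * K (x - y)) = \int[mu]_y (g y * tensor f y).
  apply: eq_Rintegral => y _; congr (_ * _); apply: eq_bigr => i _.
  by rewrite /f !mxE mulN1r.
rewrite -[RHS]opprK -(weak tf).
have -> : \int[mu]_y (a y * partial j (tensor f) y) =
    \int[mu]_y (a y * rho (x - y)) - \int[mu]_y (a y * rho (x + v - y)).
  by rewrite -RintegralB//; apply: eq_Rintegral => y _; rewrite reflect_partial mulrBr.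
rewrite opprB.
have -> : \int[mu]_y (a y * rho (x + v - y)) = \int[mu]_y (a (y + v) * rho (x - y)).
  rewrite (Rintegral_preserving (row_translation v)); last first.
    exact: intg_measurable (aw (x + v)).
  by apply: eq_Rintegral => y _ /=; rewrite opprD addrACA subrr addr0.
rewrite -RintegralB//; first by apply: eq_Rintegral => y _; rewrite -mulrBl.
have := intg_row_translate v (aw (x + v)); apply: eq_integrable => // y _ /=.
by rewrite opprD addrACA subrr addr0.
Qed.

Let W_modulus t : (\int[mu]_x ((W x - W (x - t)) ^+ 2)%:E <= (4 * (dot t t * E))%:E)%E.
Proof.
pose D (x : 'rV[R]_n) : R := (a (x + (- t)) - a x) ^+ 2.
have mD : measurable_fun setT D.
  by apply: measurable_funX; apply: measurable_funB => //; exact: measurable_row_translate.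
have D0 x : 0 <= D x by exact: sqr_ge0.
have mDv := measurable_row_translate v mD.
have dN : dot (- t) (- t) = dot t t by apply: eq_bigr => i _; rewrite !mxE mulrNN.
apply: (@le_trans _ _ (\int[mu]_x (2 * (D (x + v) + D x))%:E)%E).
  apply: ge0_le_integral_EFin.
  - apply: measurable_funX; apply: measurable_funB => //.
    exact: (measurable_row_translate (- t) mW).
  - by apply: measurable_funM => //; apply: measurable_funD.
  - by move=> x; rewrite sqr_ge0.
  - move=> x; rewrite /D /W [x - t + v]addrAC.
    move: (a (x + v - t)) (a (x + v)) (a (x - t)) (a x) => p q r u.
    by have := sqr_ge0 (p - q + (r - u)); lra.
rewrite ge0_integral_EFinZ//; last 2 first.
- exact: measurable_funD.
- by move=> x; rewrite addr_ge0.
rewrite ge0_integral_EFinD// ge0_integral_row_translate//.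
have := modulus (- t); rewrite dN -/(D _) => h.
apply: (@le_trans _ _ (2%:E * ((dot t t * E)%:E + (dot t t * E)%:E))%E).
  by rewrite lee_wpmul2l// leeD.
by rewrite -EFinD -EFinM lee_fin; lra.
Qed.

(** [m W] is split into [W * rho], which equals [g * K], and the remainder, which is
    small since [rho] has support in [|z|_oo < e]. *)
Lemma difference_bound_scale d : 0 < d ->
  (\int[mu]_x (W x ^+ 2)%:E <= ((1 + d) * s ^+ 2)%:E * \int[mu]_x (g x ^+ 2)%:E +
    ((1 + d^-1) * (4 * (n%:R * e ^+ 2 * E)))%:E)%E.
Proof.
move=> d0; pose C x := \int[mu]_y (W y * rho (x - y)).
have mC : measurable_fun setT C.
  apply: (measurable_Rintegral2 mu (f := fun z : 'rV[R]_n * 'rV[R]_n => W z.2 * rho (z.1 - z.2) : R)).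
  apply: measurable_funM; first exact: (measurableT_comp mW (@measurable_snd _ _ _ _)).
  exact: (measurableT_comp mrho measurable_row_sub).
have d1 : 0 <= 1 + d by rewrite addr_ge0// ltW.
have d2 : 0 <= 1 + d^-1 by rewrite addr_ge0// invr_ge0 ltW.
have C2 : (\int[mu]_x (C x ^+ 2)%:E <= ((s * m) ^+ 2)%:E * \int[mu]_x (g x ^+ 2)%:E)%E.
  rewrite /C; under eq_integral do rewrite difference_convolution.
  exact: convolution_l2.
have eta0 : 0 <= 4 * (n%:R * e ^+ 2 * E) by rewrite !mulr_ge0// ltW.
have WC2 : (\int[mu]_x ((m * W x - C x) ^+ 2)%:E <= (m ^+ 2 * (4 * (n%:R * e ^+ 2 * E)))%:E)%E.
  apply: convolution_approximation => // z rz; apply: (le_trans (W_modulus z)).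
  rewrite lee_fin ler_pM2l// ler_wpM2r// dot_le_sup// => i; rewrite leNgt; apply/negP => h.
  by move/eqP: rz; apply; apply: (@tensor_eq0 _ _ _ _ i); apply: bump_eq0 => //; exact: ltW.
have m2 : 0 < m ^+ 2 by rewrite exprn_gt0.
rewrite -(@lee_pmul2l _ (m ^+ 2)%:E)//.
rewrite -ge0_integral_EFinZ ?(ltW m2)//; last 2 first.
- exact: measurable_funX.
- by move=> x; rewrite sqr_ge0.
apply: (@le_trans _ _ (\int[mu]_x ((1 + d) * C x ^+ 2 + (1 + d^-1) * (m * W x - C x) ^+ 2)%:E)%E).
  apply: ge0_le_integral_EFin.
  - by apply: measurable_funM => //; exact: measurable_funX.
  - apply: measurable_funD; apply: measurable_funM => //; apply: measurable_funX => //.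
    by apply: measurable_funB => //; exact: measurable_funM.
  - by move=> x; rewrite mulr_ge0 ?sqr_ge0.
  - move=> x; rewrite -exprMn; move: (m * W x) (C x) => p q.
    have -> : (1 + d) * q ^+ 2 + (1 + d^-1) * (p - q) ^+ 2 =
      p ^+ 2 + d^-1 * (d * q - (p - q)) ^+ 2 by field; rewrite gt_eqF.
    by rewrite lerDl mulr_ge0 ?sqr_ge0// invr_ge0 ltW.
rewrite ge0_integral_EFinD; last 4 first.
- by apply: measurable_funM => //; exact: measurable_funX.
- apply: measurable_funM => //; apply: measurable_funX => //.
  by apply: measurable_funB => //; exact: measurable_funM.
- by move=> x; rewrite mulr_ge0 ?sqr_ge0.
- by move=> x; rewrite mulr_ge0 ?sqr_ge0.
rewrite !ge0_integral_EFinZ//; last 4 first.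
- by apply: measurable_funX; apply: measurable_funB => //; exact: measurable_funM.
- by move=> x; rewrite sqr_ge0.
- exact: measurable_funX.
- by move=> x; rewrite sqr_ge0.
have G0 : (0 <= ((1 + d) * s ^+ 2)%:E * \int[mu]_x (g x ^+ 2)%:E)%E.
  by rewrite mule_ge0 ?integral_sqr_ge0// lee_fin mulr_ge0// sqr_ge0.
have q1 : (0 <= ((1 + d^-1) * (4 * (n%:R * e ^+ 2 * E)))%:E)%E by rewrite lee_fin mulr_ge0.
rewrite (ge0_muleDr _ G0 q1).
apply: leeD.
  apply: (le_trans (lee_wpmul2l _ C2)); rewrite ?lee_fin// !muleA -!EFinM.
  by rewrite (_ : (1 + d) * (s * m) ^+ 2 = m ^+ 2 * ((1 + d) * s ^+ 2))//; ring.
apply: (le_trans (lee_wpmul2l _ WC2)); rewrite ?lee_fin// .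
by rewrite mulrCA.
Qed.

End fixed_scale.

(** [e] is sent to [0] before [d] in [difference_bound_scale]. *)
Lemma weak_difference s :
  (\int[mu]_x ((a (x + s *: delta_mx ord0 j) - a x) ^+ 2)%:E <=
   (s ^+ 2)%:E * \int[mu]_x (g x ^+ 2)%:E)%E.
Proof.
(* translating the integration variable by [s e_j] changes the sign of [s] *)
wlog s0 : s / 0 <= s => [H|].
  have [|/ltW s0] := leP 0 s; first exact: H.
  have := H (- s); rewrite oppr_ge0 sqrrN => /(_ s0); apply: le_trans.
  pose D (x : 'rV[R]_n) : R := (a x - a (x + (- s) *: delta_mx ord0 j)) ^+ 2.
  have mD : measurable_fun setT D.
    by apply: measurable_funX; apply: measurable_funB => //; exact: measurable_row_translate.
  have D0 x : 0 <= D x by exact: sqr_ge0.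
  rewrite le_eqVlt; apply/orP; left; apply/eqP.
  transitivity (\int[mu]_x (D x)%:E)%E.
    rewrite -(ge0_integral_row_translate (s *: delta_mx ord0 j) mD D0).
    by apply: eq_integral => x _; rewrite /D scaleNr addrK.
  by apply: eq_integral => x _; congr EFin; rewrite /D -sqrrN opprB.
have G0 : (0 <= \int[mu]_x (g x ^+ 2)%:E)%E by exact: integral_sqr_ge0.
have Gf : (\int[mu]_x (g x ^+ 2)%:E)%E \is a fin_num by rewrite ge0_fin_numE.
have Gr : 0 <= fine (\int[mu]_x (g x ^+ 2)%:E)%E by exact: fine_ge0.
apply/lee_addgt0Pr => eps eps0.
have H e (e0 : 0 < e) d (d0 : 0 < d) := difference_bound_scale s0 e0 d0.
move: Gr H; rewrite -(fineK Gf) /=; move: (fine _) => G Gr H.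
pose d := eps / (2 * (s ^+ 2 * G + 1)).
have sG : 0 < s ^+ 2 * G + 1 by rewrite ltr_wpDl// mulr_ge0// sqr_ge0.
have d0 : 0 < d by rewrite divr_gt0// mulr_gt0.
pose q := (1 + d^-1) * (4 * (n%:R * E)) + 1.
have q0 : 0 < q.
  by rewrite ltr_wpDl// !mulr_ge0// addr_ge0// invr_ge0 ltW.
have e0 : 0 < Num.sqrt (eps / (2 * q)) by rewrite sqrtr_gt0 divr_gt0// mulr_gt0.
apply: (le_trans (H _ e0 d d0)); rewrite sqr_sqrtr; last first.
  by rewrite divr_ge0 ?(ltW eps0)// mulr_ge0// ltW.
rewrite -!EFinM -!EFinD lee_fin.
have h1 : d * (s ^+ 2 * G) <= eps / 2.
  have -> : d * (s ^+ 2 * G) = eps / 2 * (s ^+ 2 * G / (s ^+ 2 * G + 1)).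
    by rewrite /d; move: sG; move: (s ^+ 2 * G) => z sG; field; rewrite gt_eqF.
  by rewrite ler_piMr ?divr_ge0 ?(ltW eps0)// ler_pdivrMr// mul1r lerDl.
have h2 : (1 + d^-1) * (4 * (n%:R * (eps / (2 * q)) * E)) <= eps / 2.
  have -> : (1 + d^-1) * (4 * (n%:R * (eps / (2 * q)) * E)) = eps / 2 * ((q - 1) / q).
    have -> : q - 1 = (1 + d^-1) * (4 * (n%:R * E)) by rewrite /q addrK.
    by clear e0; move: q q0 (1 + d^-1) => r r0 z; field; rewrite gt_eqF.
  by rewrite ler_piMr ?divr_ge0 ?(ltW eps0)// ler_pdivrMr// mul1r gerDl oppr_le0.
rewrite mulrDl mul1r mulrDl; move: h1 h2; rewrite mulrA; lra.
Qed.

End weak_difference.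

(** * Weak gradients and translations *)

Section gradient_translation.
Context {R : realType} {n : nat}.
Local Notation mu := (@lebesgue_row R n).

Lemma sum_sqr_le (r : 'I_n -> R) : (\sum_i r i) ^+ 2 <= n%:R * \sum_i r i ^+ 2.
Proof.
have := dot_sqr_le (\row_i r i) (const_mx 1).
have -> : dot (\row_i r i) (const_mx 1) = \sum_i r i.
  by apply: eq_bigr => i _; rewrite !mxE mulr1.
have -> : dot (\row_i r i) (\row_i r i) = \sum_i r i ^+ 2.
  by apply: eq_bigr => i _; rewrite !mxE expr2.
have -> : dot (const_mx 1 : 'rV[R]_n) (const_mx 1) = n%:R.
  under [LHS]eq_bigr do rewrite !mxE mulr1.
  by rewrite sumr_const card_ord.
by rewrite mulrC.
Qed.

Section real_part.
Variables (a : 'rV[R]_n -> R) (g : 'I_n -> 'rV[R]_n -> R) (E : R).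
Hypotheses (ma : measurable_fun setT a) (mg : forall j, measurable_fun setT (g j)).
Hypothesis (a2 : mu.-integrable setT (EFin \o (fun x => a x ^+ 2))).
Hypothesis (g2 : forall j, (\int[mu]_x (g j x ^+ 2)%:E < +oo)%E).
Hypothesis (E0 : 0 <= E).
Hypothesis (modulus : forall t,
  (\int[mu]_x ((a (x + t) - a x) ^+ 2)%:E <= (dot t t * E)%:E)%E).
Hypothesis (weak : forall j phi, test_function phi ->
  \int[mu]_x (a x * partial j phi x) = - \int[mu]_x (g j x * phi x)).

(** [a (x + t) - a x] telescopes along the path that changes one coordinate at a
    time; its square is at most [n] times the sum of the squares of the [n]
    increments, each of which is a translate of an increment along one axis. *)
Lemma weak_gradient_translation_real (t : 'rV[R]_n) tau : (forall i, `|t ord0 i| <= tau) ->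
  (\int[mu]_x ((a (x + t) - a x) ^+ 2)%:E <=
   (n%:R * tau ^+ 2)%:E * \sum_j \int[mu]_x (g j x ^+ 2)%:E)%E.
Proof.
move=> ttau.
pose p (k : nat) : 'rV[R]_n := \sum_(i < n | (i < k)%N) t ord0 i *: delta_mx ord0 i.
pose D (k : 'I_n) (x : 'rV[R]_n) : R := a (x + t ord0 k *: delta_mx ord0 k) - a x.
have p0 : p 0%N = 0 by rewrite /p big_pred0.
have pn : p n = t.
  rewrite /p [RHS]row_sum_delta; apply: eq_bigl => i; exact: ltn_ord.
have pS (k : 'I_n) : p k.+1 = p k + t ord0 k *: delta_mx ord0 k.
  rewrite /p (bigD1 k)//= addrC; congr (_ + _); apply: eq_bigl => i.
  by rewrite ltnS [RHS]ltn_neqAle andbC.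
have mD k : measurable_fun setT (D k).
  by apply: measurable_funB => //; exact: measurable_row_translate.
have mD2 k : measurable_fun setT (fun x => D k x ^+ 2) by exact: measurable_funX.
have mDp (k : 'I_n) := measurable_row_translate (p k) (mD2 k).
have split_difference x : a (x + t) - a x = \sum_(k < n) D k (x + p k).
  rewrite -pn -[in a x](addr0 x) -p0 -(telescope_sumr (fun k => a (x + p k)) (leq0n n)).
  by rewrite big_mkord; apply: eq_bigr => k _; rewrite /D pS addrA.
apply: (@le_trans _ _ (\int[mu]_x (n%:R * \sum_k D k (x + p k) ^+ 2)%:E)%E).
  apply: ge0_le_integral_EFin.
  - by apply: measurable_funX; apply: measurable_funB => //; exact: measurable_row_translate.
  - by apply: measurable_funM => //; apply: measurable_sum => k; exact: mDp.
  - by move=> x; rewrite sqr_ge0.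
  - by move=> x; rewrite split_difference; exact: sum_sqr_le.
rewrite ge0_integral_EFinZ//; last 2 first.
- by apply: measurable_sum => k; exact: mDp.
- by move=> x; apply: sumr_ge0 => k _; rewrite sqr_ge0.
rewrite EFinM -muleA lee_wpmul2l ?lee_fin//.
under eq_integral do rewrite -sumEFin.
rewrite ge0_integral_sum//; last 2 first.
- by move=> k; apply/measurable_EFinP; exact: mDp.
- by move=> k x _; rewrite lee_fin sqr_ge0.
rewrite ge0_sume_distrr; last by move=> j _; exact: integral_sqr_ge0.
apply: lee_sum => k _; rewrite (ge0_integral_row_translate (p k) (mD2 k)); last first.
  by move=> x; rewrite sqr_ge0.
apply: (le_trans (weak_difference ma (mg k) a2 (g2 k) E0 modulus (weak k) (t ord0 k))).
rewrite lee_wpmul2r ?integral_sqr_ge0// lee_fin -(real_normK (num_real (t ord0 k))).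
by rewrite lerXn2r ?nnegrE// (le_trans _ (ttau k)).
Qed.

End real_part.

(** The space is a countable union of compact boxes. *)
Lemma locally_integrable_measurable (f : 'rV[R]_n -> R) :
  (forall K, compact K -> mu.-integrable K (EFin \o f)) -> measurable_fun setT f.
Proof.
move=> fi; pose B (m : nat) : set 'rV[R]_n := box m%:R.
have -> : setT = \bigcup_m B m.
  apply/seteqP; split => // x _; exists (Num.bound (enorm x)) => // i.
  rewrite /= in_itv/= -ler_norml (le_trans (coord_le_enorm x i))//.
  by rewrite ltW// archi_boundP// enorm_ge0.
apply/measurable_fun_bigcup => m; first exact: measurable_box.
by have /measurable_int/measurable_EFinP := fi _ (@compact_box _ n m%:R).
Qed.

Variables (U : 'rV[R]_n -> R[i]) (G : 'I_n -> 'rV[R]_n -> R[i]).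
Hypotheses (HU : H1 U) (UG : weak_gradient U G).

Let energy := (\int[mu]_xi ((1 + enorm xi ^+ 2) * Normc.normc (fourier U xi) ^+ 2)%:E)%E.
Let Y : \bar R := (\int[mu]_x (\sum_j sqmod (G j x))%:E)%E.

Lemma sqmodB (z w : R[i]) : sqmod (z - w) =
  (complex.Re z - complex.Re w) ^+ 2 + (complex.Im z - complex.Im w) ^+ 2.
Proof. by case: z w => ? ? []. Qed.

Lemma H1_translation_sup (t : 'rV[R]_n) tau : (forall i, `|t ord0 i| <= tau) ->
  (\int[mu]_x (sqmod (U (x + t) - U x))%:E <= (n%:R * tau ^+ 2)%:E * energy)%E.
Proof.
move=> ttau; under eq_integral do rewrite sqmodB.
apply: (le_trans (H1_translation t HU)); apply: lee_wpmul2r.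
  by apply: integral_ge0 => xi _; rewrite lee_fin mulr_ge0 ?sqr_ge0// addr_ge0 ?sqr_ge0.
by rewrite lee_fin dot_le_sup.
Qed.

Lemma weak_gradient_translation (t : 'rV[R]_n) tau : (Y < +oo)%E -> (forall i, `|t ord0 i| <= tau) ->
  (\int[mu]_x (sqmod (U (x + t) - U x))%:E <= (n%:R * tau ^+ 2)%:E * Y)%E.
Proof.
move=> Yoo ttau.
have [[[ma mb] /L2norm_lty U2] _ H1oo] := HU.
have [Gi UGj] := UG.
have mGr j : measurable_fun setT (fun x => complex.Re (G j x)).
  by apply: locally_integrable_measurable => K /(Gi j)[].
have mGi j : measurable_fun setT (fun x => complex.Im (G j x)).
  by apply: locally_integrable_measurable => K /(Gi j)[].
have en0 : (0 <= energy)%E.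
  by apply: integral_ge0 => xi _; rewrite lee_fin mulr_ge0 ?sqr_ge0// addr_ge0 ?sqr_ge0.
have enoo : (energy < +oo)%E.
  by apply: (@lty_poweRy _ _ 2^-1) => //; rewrite invr_eq0.
have enE : (fine energy)%:E = energy by rewrite fineK// ge0_fin_numE.
have E0 : 0 <= fine energy by exact: fine_ge0.
have modulus (t' : 'rV[R]_n) : (\int[mu]_x ((complex.Re (U (x + t')) - complex.Re (U x)) ^+ 2
    + (complex.Im (U (x + t')) - complex.Im (U x)) ^+ 2)%:E <= (dot t' t' * fine energy)%:E)%E.
  by rewrite EFinM enE; exact: H1_translation.
have U2i := intg_ge0P (measurable_funD (measurable_funX 2 ma) (measurable_funX 2 mb))
  (fun x => sqmod_ge0 (U x)) U2.
have sq_le (f g : 'rV[R]_n -> R) : measurable_fun setT f -> measurable_fun setT g ->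
    (\int[mu]_x (f x ^+ 2)%:E <= \int[mu]_x (f x ^+ 2 + g x ^+ 2)%:E)%E /\
    (\int[mu]_x (g x ^+ 2)%:E <= \int[mu]_x (f x ^+ 2 + g x ^+ 2)%:E)%E.
  move=> mf mg; split; apply: ge0_le_integral_EFin; try exact: measurable_funX;
    try (by apply: measurable_funD; exact: measurable_funX);
    by move=> x; rewrite ?sqr_ge0// ?lerDl ?lerDr sqr_ge0.
have YE : (Y = \sum_j \int[mu]_x (complex.Re (G j x) ^+ 2)%:E +
    \sum_j \int[mu]_x (complex.Im (G j x) ^+ 2)%:E)%E.
  rewrite /Y -big_split/=; under eq_integral do rewrite -sumEFin.
  rewrite ge0_integral_sum//; last 2 first.
  - move=> j; apply/measurable_EFinP; exact: (measurable_sqmod (conj (mGr j) (mGi j))).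
  - by move=> j x _; rewrite lee_fin sqmod_ge0.
  apply: eq_bigr => j _; rewrite -ge0_integral_EFinD//; try exact: measurable_funX;
    by move=> x; rewrite sqr_ge0.
have Yj : (forall j, \int[mu]_x (complex.Re (G j x) ^+ 2)%:E < +oo)%E /\
    (forall j, \int[mu]_x (complex.Im (G j x) ^+ 2)%:E < +oo)%E.
  have mY : measurable_fun setT (fun x => \sum_j sqmod (G j x)).
    by apply: measurable_sum => j; exact: (measurable_sqmod (conj (mGr j) (mGi j))).
  have le_sum j x : sqmod (G j x) <= \sum_j sqmod (G j x).
    by rewrite (bigD1 j)//= lerDl; apply: sumr_ge0 => i _; exact: sqmod_ge0.
  split => j; apply: le_lt_trans Yoo; apply: ge0_le_integral_EFin => //.
  - exact: measurable_funX.
  - by move=> x; rewrite sqr_ge0.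
  - by move=> x; apply: le_trans (le_sum j x); rewrite lerDl sqr_ge0.
  - exact: measurable_funX.
  - by move=> x; rewrite sqr_ge0.
  - by move=> x; apply: le_trans (le_sum j x); rewrite lerDr sqr_ge0.
rewrite YE ge0_muleDr; last 2 first.
- by apply: sume_ge0 => j _; exact: integral_sqr_ge0.
- by apply: sume_ge0 => j _; exact: integral_sqr_ge0.
under eq_integral do rewrite sqmodB.
rewrite ge0_integral_EFinD; last 4 first.
- by apply: measurable_funX; apply: measurable_funB => //; exact: (measurable_row_translate t ma).
- by apply: measurable_funX; apply: measurable_funB => //; exact: (measurable_row_translate t mb).
- by move=> x; rewrite sqr_ge0.
- by move=> x; rewrite sqr_ge0.
have mdr t' : measurable_fun setT (fun x : 'rV[R]_n => complex.Re (U (x + t')) - complex.Re (U x)).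
  by apply: measurable_funB => //; exact: (measurable_row_translate t' ma).
have mdi t' : measurable_fun setT (fun x : 'rV[R]_n => complex.Im (U (x + t')) - complex.Im (U x)).
  by apply: measurable_funB => //; exact: (measurable_row_translate t' mb).
apply: leeD.
- apply: (weak_gradient_translation_real ma mGr (sqr_intgl ma mb U2) Yj.1 E0 _ _ ttau).
    by move=> t'; apply: le_trans (modulus t'); have [] := sq_le _ _ (mdr t') (mdi t').
  move=> j phi tphi; have := UGj phi j tphi => /(congr1 (@complex.Re R)) /= h.
  rewrite (_ : \int[mu]_x (complex.Re (U x) * partial j phi x) =
    \int[mu]_x complex.Re (U x * (partial j phi x)%:C%C)); last first.
    by apply: eq_Rintegral => x _; case: (U x) => p q /=; rewrite mulr0 subr0.
  rewrite h; congr (- _); apply: eq_Rintegral => x _.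
  by case: (G j x) => p q /=; rewrite mulr0 subr0.
- apply: (weak_gradient_translation_real mb mGi (sqr_intgr ma mb U2) Yj.2 E0 _ _ ttau).
    by move=> t'; apply: le_trans (modulus t'); have [] := sq_le _ _ (mdr t') (mdi t').
  move=> j phi tphi; have := UGj phi j tphi => /(congr1 (@complex.Im R)) /= h.
  rewrite (_ : \int[mu]_x (complex.Im (U x) * partial j phi x) =
    \int[mu]_x complex.Im (U x * (partial j phi x)%:C%C)); last first.
    by apply: eq_Rintegral => x _; case: (U x) => p q /=; rewrite mulr0 add0r.
  rewrite h; congr (- _); apply: eq_Rintegral => x _.
  by case: (G j x) => p q /=; rewrite mulr0 add0r.
Qed.

Lemma grad_L2normE : grad_L2norm G = (Y `^ 2^-1)%E.
Proof.
have Y0 : (0 <= Y)%E.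
  by apply: integral_ge0 => x _; rewrite lee_fin sumr_ge0// => j _; exact: sqmod_ge0.
have <- : (grad_L2norm G `^ 2 = Y)%E.
  rewrite /grad_L2norm poweR_Lnorm//; apply: eq_integral => x _ /=.
  rewrite powR_mulrn// ?normr_ge0// real_normK ?num_real// sqr_sqrtr.
    by congr EFin; apply: eq_bigr => j _; exact: normc_sqr.
  by apply: sumr_ge0 => j _; exact: sqr_ge0.
rewrite -poweRrM mulfV// poweRe1//; exact: Lnorm_ge0.
Qed.

End gradient_translation.

(** * Averages over cubes *)

Section cube_averages.
Context {R : realType} {n : nat}.
Local Notation mu := (@lebesgue_row R n).
Implicit Types (c x y t : 'rV[R]_n) (r : R).

Definition cube c r : set 'rV[R]_n :=
  [set x | forall i, `[c ord0 i - r, c ord0 i + r]%classic (x ord0 i)].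

Lemma cubeP c r x : cube c r x <-> forall i, `|x ord0 i - c ord0 i| <= r.
Proof. by split=> h i; have := h i; rewrite /= in_itv/= ler_distl. Qed.

Lemma measurable_cube c r : measurable (cube c r).
Proof.
by apply: (measurable_row_box (A := fun i => `[c ord0 i - r, c ord0 i + r]%classic)) => i;
  exact: measurable_itv.
Qed.

Lemma lebesgue_cube c r : 0 <= r -> mu (cube c r) = ((2 * r) ^+ n)%:E.
Proof.
move=> r0; rewrite /cube (lebesgue_row_box (A := fun i => `[c ord0 i - r, c ord0 i + r]%classic)).
  rewrite (eq_bigr (fun=> (2 * r)%:E)); last first.
    move=> i _; rewrite lebesgue_measure_itv/= lte_fin; case: ifP => h.
      by rewrite -EFinD; congr EFin; ring.
    by congr EFin; move/negbT: h; rewrite -leNgt; lra.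
  by rewrite prodEFin prodr_const card_ord.
by move=> i; exact: measurable_itv.
Qed.

Lemma integral_indic_cube c r : 0 <= r ->
  (\int[mu]_y (\1_(cube c r) y)%:E = ((2 * r) ^+ n)%:E)%E.
Proof.
move=> r0; rewrite integral_indic//; last exact: measurable_cube.
by rewrite -(lebesgue_cube c r0); congr (mu _); exact: setIT.
Qed.

Lemma intg_indic_cube c r : 0 <= r -> mu.-integrable setT (EFin \o (\1_(cube c r) : _ -> R)).
Proof.
move=> r0; apply: intg_ge0P => //.
- exact: measurable_indic (measurable_cube c r).
- by rewrite integral_indic_cube ?ltry.
Qed.

Definition cube_average (a : 'rV[R]_n -> R) c r : R :=
  ((2 * r) ^+ n)^-1 * \int[mu]_y (a y * \1_(cube c r) y).

(** [a x - cube_average a c r] is the average of [a x - a y] over [y] in the cube;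
    Cauchy-Schwarz for the indicator of the cube bounds its square. *)
Lemma cube_average_bound (a : 'rV[R]_n -> R) c r x : 0 < r -> measurable_fun setT a ->
  mu.-integrable setT (EFin \o (fun x => a x ^+ 2)) ->
  (((a x - cube_average a c r) ^+ 2)%:E <=
   ((2 * r) ^+ n)^-1%:E * \int[mu]_y ((a y - a x) ^+ 2 * \1_(cube c r) y)%:E)%E.
Proof.
move=> r0 ma a2; have v0 : 0 < (2 * r) ^+ n by rewrite exprn_gt0// mulr_gt0.
have m1 : measurable_fun setT (\1_(cube c r) : 'rV[R]_n -> R).
  exact: measurable_indic (measurable_cube c r).
have i1 := intg_indic_cube c (ltW r0).
have a1 : mu.-integrable setT (EFin \o (fun y => a y * \1_(cube c r) y)).
  by apply: intg_mul_weight => // y; rewrite indicE; case: (_ \in _); rewrite ?lexx ?ler01.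
have mass := integral_indic_cube c (ltW r0).
have E : (a x - cube_average a c r) ^+ 2 = ((2 * r) ^+ n)^-1 ^+ 2 *
    (\int[mu]_y ((a y - a x) * \1_(cube c r) y)) ^+ 2.
  have -> : \int[mu]_y ((a y - a x) * \1_(cube c r) y) =
      \int[mu]_y (a y * \1_(cube c r) y) - (2 * r) ^+ n * a x.
    have -> : (2 * r) ^+ n * a x = \int[mu]_y (a x * \1_(cube c r) y).
      by rewrite RintegralZ// mulrC /Rintegral mass.
    rewrite -RintegralB//; last exact: intgZ.
    by apply: eq_Rintegral => y _; rewrite mulrBl.
  rewrite /cube_average -exprMn mulrBr mulrA mulVf ?gt_eqF// mul1r.
  by rewrite -sqrrN opprB.
rewrite E expr2 -mulrA EFinM lee_wpmul2l ?lee_fin ?invr_ge0 ?(ltW v0)//.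
rewrite EFinM lee_pdivrMl// -mass.
apply: cauchy_schwarz_weight => //.
exact: measurable_funB.
Qed.

(** The coordinate projections of [A] are contained in intervals of length [h]. *)
Lemma small_diam_center (A : set 'rV[R]_n) h : A !=set0 -> (diam A <= h%:E)%E ->
  exists c : 'rV[R]_n, forall x, A x -> forall i, `|x ord0 i - c ord0 i| <= h / 2.
Proof.
move=> [x0 Ax0] dA.
have dist x y i : A x -> A y -> x ord0 i - y ord0 i <= h.
  move=> Ax Ay; rewrite -lee_fin; apply: le_trans dA.
  apply: (@le_trans _ _ (enorm (x - y))%:E).
    rewrite lee_fin (le_trans _ (coord_le_enorm (x - y) i))// !mxE; exact: ler_norm.
  by apply: ereal_sup_ubound; exists x => //; exists y.
pose S i := [set x ord0 i | x in A].
have S0 i : S i !=set0 by exists (x0 ord0 i), x0.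
have Slb i : has_lbound (S i).
  by exists (x0 ord0 i - h) => _ [x Ax <-]; have := dist _ _ i Ax0 Ax; lra.
exists (\row_i (inf (S i) + h / 2)) => x Ax i; rewrite mxE ler_distl.
have h1 : inf (S i) <= x ord0 i by apply: (ge_inf (Slb i)); exists x.
have h2 : x ord0 i - h <= inf (S i).
  by apply: lb_le_inf => // _ [y Ay <-]; have := dist _ _ i Ax Ay; lra.
apply/andP; split; lra.
Qed.

Lemma measurable_row_add :
  measurable_fun setT (fun z : 'rV[R]_n * 'rV[R]_n => z.1 + z.2).
Proof.
apply: measurable_fun_rowP => i.
apply: (eq_measurable_fun (fun z : 'rV[R]_n * 'rV[R]_n => z.1 ord0 i + z.2 ord0 i)).
  by move=> z _; rewrite !mxE.
apply: measurable_funD.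
  exact: (measurableT_comp (measurable_row_coord i) (@measurable_fst _ _ _ _)).
exact: (measurableT_comp (measurable_row_coord i) (@measurable_snd _ _ _ _)).
Qed.

(** The averaging cubes have radius [h / 4].  The radius [3 * h / 4] of the cube of
    translations is the sum of [h / 4] and of the distance [h / 2] from a point of
    a cell to the centre of its cube, measured in the sup norm. *)
Section complex_average.
Variables (U : 'rV[R]_n -> R[i]) (h : R).
Hypotheses (h0 : 0 < h) (U2 : L2 setT U).

Let a x := complex.Re (U x).
Let b x := complex.Im (U x).
Let r := h / 4.
Let tau := 3 * h / 4.
Let ma : measurable_fun setT a. Proof. by have [[]] := U2. Qed.
Let mb : measurable_fun setT b. Proof. by have [[]] := U2. Qed.
Let ab2 : (\int[mu]_x (a x ^+ 2 + b x ^+ 2)%:E < +oo)%E.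
Proof. by have [_ /L2norm_lty] := U2. Qed.
Let r0 : 0 < r. Proof. by rewrite divr_gt0. Qed.
Let tau0 : 0 < tau. Proof. by rewrite divr_gt0// mulr_gt0. Qed.
Let v0 : 0 < (2 * r) ^+ n. Proof. by rewrite exprn_gt0// mulr_gt0. Qed.

Definition ccube_average c : R[i] := (cube_average a c (h / 4) +i* cube_average b c (h / 4))%C.

Let k (z : 'rV[R]_n * 'rV[R]_n) : R := sqmod (U (z.1 + z.2) - U z.1) * \1_(cube 0 tau) z.2.

Definition oscillation (x : 'rV[R]_n) : \bar R := (\int[mu]_t (k (x, t))%:E)%E.

Let k_ge0 z : 0 <= k z.
Proof. by rewrite mulr_ge0 ?sqmod_ge0// indicE. Qed.

Let mk : measurable_fun setT k.
Proof.
apply: measurable_funM; last first.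
  apply: (measurableT_comp _ (@measurable_snd _ _ _ _)).
  exact: measurable_indic (measurable_cube 0 tau).
have -> : (fun z : 'rV[R]_n * 'rV[R]_n => sqmod (U (z.1 + z.2) - U z.1)) =
    (fun z => (a (z.1 + z.2) - a z.1) ^+ 2 + (b (z.1 + z.2) - b z.1) ^+ 2).
  by apply/funext => z; rewrite sqmodB.
apply: measurable_funD; apply: measurable_funX; apply: measurable_funB.
- exact: (measurableT_comp ma measurable_row_add).
- exact: (measurableT_comp ma (@measurable_fst _ _ _ _)).
- exact: (measurableT_comp mb measurable_row_add).
- exact: (measurableT_comp mb (@measurable_fst _ _ _ _)).
Qed.

Lemma measurable_oscillation : measurable_fun setT oscillation.
Proof. by apply: (measurable_integral2 mu (f := EFin \o k)); exact/measurable_EFinP. Qed.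

Lemma oscillation_ge0 x : (0 <= oscillation x)%E.
Proof. by apply: integral_ge0 => t _; rewrite lee_fin. Qed.

Lemma average_oscillation c x : (forall i, `|x ord0 i - c ord0 i| <= h / 2) ->
  ((sqmod (U x - ccube_average c))%:E <= ((h / 2) ^+ n)^-1%:E * oscillation x)%E.
Proof.
move=> xc; have hr : h / 2 = 2 * r by rewrite /r; field.
have m1 : measurable_fun setT (\1_(cube c r) : 'rV[R]_n -> R).
  exact: measurable_indic (measurable_cube c r).
have i0 y : 0 <= \1_(cube c r) y :> R by rewrite indicE.
have mx (f : 'rV[R]_n -> R) : measurable_fun setT f ->
    measurable_fun setT (fun y => (f y - f x) ^+ 2 * \1_(cube c r) y).
  by move=> mf; apply: measurable_funM => //; apply: measurable_funX; exact: measurable_funB.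
rewrite sqmodB EFinD hr; apply: le_trans (leeD (cube_average_bound c x r0 ma (sqr_intgl ma mb ab2))
  (cube_average_bound c x r0 mb (sqr_intgr ma mb ab2))) _.
rewrite -ge0_muleDr; [|by apply: integral_ge0 => y _; rewrite lee_fin mulr_ge0 ?sqr_ge0..].
rewrite lee_wpmul2l ?lee_fin ?invr_ge0 ?(ltW v0)//.
rewrite -ge0_integral_EFinD; [|exact: mx|exact: mx|by move=> y; rewrite mulr_ge0 ?sqr_ge0..].
pose f (y : 'rV[R]_n) : R := sqmod (U y - U x) * \1_(cube 0 tau) (y - x).
have f0 y : 0 <= f y by rewrite mulr_ge0 ?sqmod_ge0// indicE.
have mf : measurable_fun setT f.
  apply: measurable_funM; last first.
    apply: (measurable_row_translate (- x)).
    exact: measurable_indic (measurable_cube 0 tau).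
  have -> : (fun y : 'rV[R]_n => sqmod (U y - U x)) = (fun y => (a y - a x) ^+ 2 + (b y - b x) ^+ 2).
    by apply/funext => y; rewrite sqmodB.
  by apply: measurable_funD; apply: measurable_funX; exact: measurable_funB.
have -> : oscillation x = (\int[mu]_y (f y)%:E)%E.
  rewrite -(ge0_integral_row_translate x mf f0); apply: eq_integral => t _.
  by rewrite /k /f /= addrK [t + x]addrC.
apply: ge0_le_integral_EFin => //.
- by apply: measurable_funD; exact: mx.
- by move=> y; rewrite addr_ge0// mulr_ge0 ?sqr_ge0.
move=> y; rewrite -mulrDl -sqmodB /f ler_wpM2l ?sqmod_ge0//.
rewrite !indicE; have [yc|_] := boolP (y \in cube c r); last by rewrite ler0n.
rewrite mem_set//; apply/cubeP => i; rewrite !mxE subr0.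
move: yc; rewrite inE => /cubeP/(_ i) h1; have := xc i; move: h1; rewrite /tau /r.
rewrite !ler_norml => /andP[? ?] /andP[? ?]; apply/andP; split; lra.
Qed.

Variable X : \bar R.
Hypothesis X0 : (0 <= X)%E.
Hypothesis translation : forall (t : 'rV[R]_n) s, (forall i, `|t ord0 i| <= s) ->
  (\int[mu]_x (sqmod (U (x + t) - U x))%:E <= (n%:R * s ^+ 2)%:E * X)%E.

(** By Tonelli, integrating over [x] first. *)
Lemma integral_oscillation :
  (\int[mu]_x oscillation x <= ((2 * tau) ^+ n * (n%:R * tau ^+ 2))%:E * X)%E.
Proof.
rewrite /oscillation (fubini_tonelli (m1 := mu) (m2 := mu) (EFin \o k))/=; last 2 first.
- exact/measurable_EFinP.
- by move=> z; rewrite lee_fin.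
have m1 : measurable_fun setT (\1_(cube 0 tau) : 'rV[R]_n -> R).
  exact: measurable_indic (measurable_cube 0 tau).
have c0 : (0 <= (n%:R * tau ^+ 2)%:E * X)%E.
  by rewrite mule_ge0// lee_fin mulr_ge0// sqr_ge0.
apply: (@le_trans _ _ (\int[mu]_t ((\1_(cube 0 tau) t)%:E * ((n%:R * tau ^+ 2)%:E * X)))%E).
  apply: ge0_le_integral => //.
  - by move=> t _; apply: integral_ge0 => x _; rewrite lee_fin.
  - by apply: (measurable_integral1 mu (f := EFin \o k)); exact/measurable_EFinP.
  - by apply: emeasurable_funM => //; exact/measurable_EFinP.
  move=> t _; rewrite /k /=.
  have mU : measurable_fun setT (fun x : 'rV[R]_n => sqmod (U (x + t) - U x)).
    have -> : (fun x : 'rV[R]_n => sqmod (U (x + t) - U x)) =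
        (fun x => (a (x + t) - a x) ^+ 2 + (b (x + t) - b x) ^+ 2).
      by apply/funext => x; rewrite sqmodB.
    apply: measurable_funD; apply: measurable_funX; apply: measurable_funB => //.
      exact: (measurable_row_translate t ma).
    exact: (measurable_row_translate t mb).
  under eq_integral do rewrite mulrC.
  rewrite (ge0_integral_EFinZ mu mU (fun x => sqmod_ge0 _)); last by rewrite indicE.
  rewrite indicE; have [tc|_] := boolP (t \in cube 0 tau); last by rewrite !mul0e.
  rewrite !mul1e; apply: translation => i.
  by move: tc; rewrite inE => /cubeP/(_ i); rewrite mxE subr0.
rewrite ge0_integralZr//; [|exact/measurable_EFinP].
rewrite (integral_indic_cube 0 (ltW tau0)).
by rewrite muleA -EFinM.
Qed.

End complex_average.

End cube_averages.

(** * Orthogonal projections are best approximations *)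

Section l2_projection.
Context {R : realType} {n : nat}.
Local Notation mu := (@lebesgue_row R n).
Variable D : set 'rV[R]_n.
Hypothesis mD : measurable D.
Implicit Types (f g : 'rV[R]_n -> R[i]).

Lemma sqmodB_le (z w : R[i]) : sqmod (z - w) <= 2 * (sqmod z + sqmod w).
Proof.
rewrite sqmodB /sqmod; move: (complex.Re z) (complex.Im z) (complex.Re w) (complex.Im w) => p q r s.
have := sqr_ge0 (p + r); have := sqr_ge0 (q + s); lra.
Qed.

Lemma L2_cmeasurable f : L2 D f -> cmeasurable D f. Proof. by case. Qed.

Lemma L2_integrable f : L2 D f -> mu.-integrable D (EFin \o (fun x => sqmod (f x))).
Proof.
move=> [mf /L2norm_lty foo]; apply/integrableP; split.
  by apply/measurable_EFinP; exact: measurable_sqmod.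
by under eq_integral do rewrite /= ger0_norm ?sqmod_ge0//.
Qed.

Lemma integrable_L2 f : cmeasurable D f ->
  mu.-integrable D (EFin \o (fun x => sqmod (f x))) -> L2 D f.
Proof.
move=> mf /integrableP[_ foo]; split => //; rewrite L2normE poweR_lty//.
by move: foo; under eq_integral do rewrite /= ger0_norm ?sqmod_ge0//.
Qed.

Lemma cmeasurableB f g : cmeasurable D f -> cmeasurable D g -> cmeasurable D (fun x => f x - g x).
Proof.
move=> [fr fi] [gr gi]; split.
  have -> : (fun x => complex.Re (f x - g x)) = (fun x => complex.Re (f x) - complex.Re (g x)).
    by apply/funext => x; case: (f x) (g x) => ? ? [].
  exact: measurable_funB.
have -> : (fun x => complex.Im (f x - g x)) = (fun x => complex.Im (f x) - complex.Im (g x)).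
  by apply/funext => x; case: (f x) (g x) => ? ? [].
exact: measurable_funB.
Qed.

Lemma L2B f g : L2 D f -> L2 D g -> L2 D (fun x => f x - g x).
Proof.
move=> Lf Lg; have mfg := cmeasurableB (L2_cmeasurable Lf) (L2_cmeasurable Lg).
apply: integrable_L2 => //.
have := integrableZl mD 2 (integrableD mD (L2_integrable Lf) (L2_integrable Lg)).
apply: (le_integrable mD); first by apply/measurable_EFinP; exact: measurable_sqmod.
move=> x _; rewrite /= lee_fin ger0_norm ?sqmod_ge0// (le_trans (sqmodB_le _ _))//.
exact: ler_norm.
Qed.

Definition real_product (z w : R[i]) : R := complex.Re (z * conjc w).

Lemma real_productE z w : real_product z w =
  complex.Re z * complex.Re w + complex.Im z * complex.Im w.
Proof. by case: z w => p q [r s]; rewrite /real_product /= mulrN opprK. Qed.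

Lemma integrable_real_product f g : L2 D f -> L2 D g ->
  mu.-integrable D (EFin \o (fun x => real_product (f x) (g x))).
Proof.
move=> Lf Lg; have := integrableD mD (L2_integrable Lf) (L2_integrable Lg).
have [fr fi] := L2_cmeasurable Lf; have [gr gi] := L2_cmeasurable Lg.
apply: (le_integrable mD).
  apply/measurable_EFinP.
  have -> : (fun x => real_product (f x) (g x)) = (fun x =>
      complex.Re (f x) * complex.Re (g x) + complex.Im (f x) * complex.Im (g x)).
    by apply/funext => x; rewrite real_productE.
  by apply: measurable_funD; exact: measurable_funM.
move=> x _; rewrite /= lee_fin real_productE [leRHS]ger0_norm; last by rewrite addr_ge0// sqmod_ge0.
rewrite /sqmod; move: (complex.Re (f x)) (complex.Im (f x)) (complex.Re (g x)) (complex.Im (g x)).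
move=> p q r s; have := sqr_ge0 (p + r); have := sqr_ge0 (q + s).
have := sqr_ge0 (p - r); have := sqr_ge0 (q - s).
rewrite ler_norml => *; apply/andP; split; lra.
Qed.

(** [f - P f] is orthogonal to both [P f] and [v].  Pointwise,
    [|f - v|^2 >= |f - P f|^2 + 2 Re ((f - P f) conj (P f - v))], and the last term
    has integral [0]. *)
Lemma orthogonal_projection_le (V : set ('rV[R]_n -> R[i])) P f v :
  orthogonal_projection D V P -> (forall w, V w -> L2 D w) -> L2 D f -> V v ->
  (\int[mu]_(x in D) (sqmod (f x - P f x))%:E <= \int[mu]_(x in D) (sqmod (f x - v x))%:E)%E.
Proof.
move=> PV V2 Lf Vv; have [VP orth] := PV f Lf.
have LP := V2 _ VP; have Lv := V2 _ Vv; have Lq := L2B Lf LP; have Ld := L2B Lf Lv.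
have c1 := integrable_real_product Lq LP; have c2 := integrable_real_product Lq Lv.
have o1 : \int[mu]_(x in D) real_product (f x - P f x) (P f x) = 0.
  by have /(congr1 (@complex.Re R)) := orth _ VP.
have o2 : \int[mu]_(x in D) real_product (f x - P f x) (v x) = 0.
  by have /(congr1 (@complex.Re R)) := orth _ Vv.
pose c x := real_product (f x - P f x) (P f x) - real_product (f x - P f x) (v x).
have ci : mu.-integrable D (EFin \o c).
  by have := integrableB mD c1 c2; apply: eq_integrable.
have c0 : \int[mu]_(x in D) c x = 0 by rewrite RintegralB// o1 o2 subr0.
have ci2 : mu.-integrable D (EFin \o (fun x => 2 * c x)).
  by have := integrableZl mD 2 ci; apply: eq_integrable.
have e f' : L2 D f' -> (\int[mu]_(x in D) (sqmod (f' x))%:E)%E =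
    (\int[mu]_(x in D) sqmod (f' x))%:E.
  by move=> /L2_integrable h; rewrite /Rintegral fineK//; exact: integrable_fin_num.
rewrite (e _ Lq) (e _ Ld) lee_fin.
have -> : \int[mu]_(x in D) sqmod (f x - v x) =
    \int[mu]_(x in D) (sqmod (f x - v x) - 2 * c x).
  by rewrite RintegralB//; [rewrite RintegralZl// c0 mulr0 subr0|exact: L2_integrable].
apply: le_Rintegral => //; first exact: L2_integrable.
  by have := integrableB mD (L2_integrable Ld) ci2; apply: eq_integrable.
move=> x _; rewrite /c !real_productE /sqmod.
case: (f x) (P f x) (v x) => p q [r s] [t u] /=.
have := sqr_ge0 (r - t); have := sqr_ge0 (s - u); lra.
Qed.

End l2_projection.

(** * Piecewise constant approximation on a mesh *)
Section mesh_approximation.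
Context {R : realType} {n : nat}.
Local Notation mu := (@lebesgue_row R n).
Variables (Omega : set 'rV[R]_n) (J : countType) (T : J -> set 'rV[R]_n) (h : R).
Hypotheses (OmegaP : domain Omega) (h0 : 0 < h) (TP : mesh Omega T).
Hypothesis (Th : forall j, (diam (T j) <= h%:E)%E).

Let mOmega : measurable Omega.
Proof. by have [oO _] := OmegaP; exact: open_measurable_row. Qed.

Let mT j : measurable (T j).
Proof. by have [/(_ j)[[oT _] _ _] _ _] := TP; exact: open_measurable_row. Qed.

Let T_disj i j x : T i x -> T j x -> i = j.
Proof.
move=> Tix Tjx; have [_ dT _] := TP; apply/eqP/negPn/negP => /dT /seteqP[/(_ x)] + _.
by apply; split.
Qed.

Let mTU : measurable (\bigcup_j T j).
Proof. by apply: countable_bigcupT_measurable => //; exact: countableP. Qed.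

(** The index is chosen among the cells that contain [x]; there is only one, because
    cells are disjoint. *)
Definition mesh_function (A : Type) (k : J -> A) (d : A) (x : 'rV[R]_n) : A :=
  if pselect (exists j, T j x) is left e then k (projT1 (cid e)) else d.

Lemma mesh_functionE (A : Type) (k : J -> A) d j x : T j x -> mesh_function k d x = k j.
Proof.
move=> Tjx; rewrite /mesh_function; case: pselect => [e|]; last by case; exists j.
by congr k; apply: T_disj (projT2 (cid e)) Tjx.
Qed.

Lemma mesh_function_out (A : Type) (k : J -> A) d x :
  ~ (\bigcup_j T j) x -> mesh_function k d x = d.
Proof.
by move=> nT; rewrite /mesh_function; case: pselect => // -[j Tj]; case: nT; exists j.
Qed.

Lemma measurable_mesh_function (k : J -> R) d : measurable_fun setT (mesh_function k d).
Proof.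
move=> _ Y mY; rewrite setTI.
have -> : mesh_function k d @^-1` Y =
    (\bigcup_j (if `[< Y (k j) >] then T j else set0)) `|`
    (if `[< Y d >] then ~` (\bigcup_j T j) else set0).
  apply/seteqP; split => x /=.
    have [[j _ Tj]|nT] := pselect ((\bigcup_j T j) x).
      by rewrite (mesh_functionE _ _ Tj) => Yk; left; exists j => //; rewrite asboolT.
    by rewrite mesh_function_out// => Yd; right; rewrite asboolT.
  case=> [[j _]|]; first by case: asboolP => // Yk Tj; rewrite (mesh_functionE _ _ Tj).
  by case: asboolP => // Yd nT; rewrite mesh_function_out.
apply: measurableU.
  by apply: countable_bigcupT_measurable => [|j]; [exact: countableP|case: ifP].
by case: ifP => // _; exact: measurableC.
Qed.

Variables (P : ('rV[R]_n -> R[i]) -> ('rV[R]_n -> R[i])).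
Hypothesis PP : orthogonal_projection Omega (pw_const Omega T) P.
Variables (u U : 'rV[R]_n -> R[i]).
Hypotheses (u2 : L2 Omega u) (U2 : L2 setT U) (Uu : ae_eq mu Omega U u).
Variable X : \bar R.
Hypothesis X0 : (0 <= X)%E.
Hypothesis translation : forall (t : 'rV[R]_n) s, (forall i, `|t ord0 i| <= s) ->
  (\int[mu]_x (sqmod (U (x + t) - U x))%:E <= (n%:R * s ^+ 2)%:E * X)%E.

Let c j : 'rV[R]_n := xget 0 [set c : 'rV[R]_n | forall x : 'rV[R]_n, T j x -> forall i, `|x ord0 i - c ord0 i| <= h / 2].

Let cP j x : T j x -> forall i, `|x ord0 i - c j ord0 i| <= h / 2.
Proof.
have [/(_ j)[[_ T0] _ _] _ _] := TP.
have [c0 c0P] := small_diam_center T0 (Th j).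
exact: (xgetPex (P := [set c : 'rV[R]_n | forall x : 'rV[R]_n, T j x -> forall i, `|x ord0 i - c ord0 i| <= h / 2]) 0 (ex_intro _ c0 c0P)).
Qed.

Let v : 'rV[R]_n -> R[i] := mesh_function (fun j => ccube_average U h (c j)) 0.
Let K : R := 3 ^+ n * (n%:R * (3 * h / 4) ^+ 2).

Let mv : cmeasurable setT v.
Proof.
split.
  have -> : (fun x => complex.Re (v x)) =
      mesh_function (fun j => complex.Re (ccube_average U h (c j))) 0.
    by apply/funext => x; rewrite /v /mesh_function; case: pselect.
  exact: measurable_mesh_function.
have -> : (fun x => complex.Im (v x)) =
    mesh_function (fun j => complex.Im (ccube_average U h (c j))) 0.
  by apply/funext => x; rewrite /v /mesh_function; case: pselect.
exact: measurable_mesh_function.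
Qed.

Let cmeasurableS (f : 'rV[R]_n -> R[i]) : cmeasurable setT f -> cmeasurable Omega f.
Proof. by case=> *; split; exact: measurable_funTS. Qed.

Let mUv : cmeasurable Omega (fun x => U x - v x).
Proof. by apply: cmeasurableB; apply: cmeasurableS => //; have [] := U2. Qed.

(** [average_oscillation] holds at all points of the cells, hence almost everywhere
    in [Omega].  The volumes of the two cubes have ratio [3 ^+ n]. *)
Let approximation : (\int[mu]_(x in Omega) (sqmod (U x - v x))%:E <= K%:E * X)%E.
Proof.
have q0 : 0 < (h / 2) ^+ n by rewrite exprn_gt0// divr_gt0.
have mosc := measurable_oscillation h U2.
apply: (@le_trans _ _ (\int[mu]_(x in Omega) (((h / 2) ^+ n)^-1%:E * oscillation U h x))%E).
  apply: ae_ge0_le_integral => //.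
  - by move=> x _; rewrite lee_fin sqmod_ge0.
  - by apply/measurable_EFinP; exact: measurable_sqmod.
  - by move=> x _; rewrite mule_ge0 ?oscillation_ge0// lee_fin invr_ge0 ltW.
  - by apply: measurable_funeM; exact: measurable_funTS.
  have [_ _ T0] := TP; exists (Omega `\` \bigcup_j T j); split => //; first exact: measurableD.
  move=> x /= /not_implyP[Ox]; move=> nle; split => // -[j _ Tj]; apply: nle.
  by rewrite /v (mesh_functionE _ _ Tj); exact: (average_oscillation h0 U2 (cP Tj)).
apply: (@le_trans _ _ (\int[mu]_x (((h / 2) ^+ n)^-1%:E * oscillation U h x))%E).
  apply: ge0_subset_integral => //; first exact: measurable_funeM.
  by move=> x _; rewrite mule_ge0 ?oscillation_ge0// lee_fin invr_ge0 ltW.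
rewrite ge0_integralZl//; last 2 first.
- by move=> x _; exact: oscillation_ge0.
- by rewrite lee_fin invr_ge0 ltW.
have := integral_oscillation h0 U2 X0 translation.
move=> /(@lee_wpmul2l _ ((h / 2) ^+ n)^-1%:E) => /(_ _)/le_trans; apply.
  by rewrite lee_fin invr_ge0 ltW.
rewrite muleA -EFinM lee_wpmul2r// lee_fin /K [2 * (_ / 4)]mulrC.
rewrite (_ : 3 * h / 4 * 2 = 3 * (h / 2)); last by field.
move: ((3 * h / 4) ^+ 2) => s; rewrite [(3 * (h / 2)) ^+ n]exprMn.
move: ((h / 2) ^+ n) q0 (3 ^+ n) => q q0 w.
rewrite (_ : q^-1 * (w * q * (n%:R * s)) = w * (n%:R * s))//.
by field; rewrite gt_eqF.
Qed.

Hypothesis Xoo : (X < +oo)%E.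

Let v2 : L2 Omega v.
Proof.
have Uv : L2 Omega (fun x => U x - v x).
  apply: integrable_L2 => //; apply/integrableP; split.
    by apply/measurable_EFinP; exact: measurable_sqmod.
  under eq_integral do rewrite /= ger0_norm ?sqmod_ge0//.
  apply: (le_lt_trans approximation); rewrite lte_mul_pinfty// ?lee_fin.
  by rewrite mulr_ge0 ?exprn_ge0// mulr_ge0 ?sqr_ge0.
have U2' : L2 Omega U.
  have [mU _] := U2; apply: integrable_L2; first exact: cmeasurableS.
  apply: (@integrableS _ _ _ mu setT) => //; exact: L2_integrable.
have := L2B mOmega U2' Uv; rewrite (_ : (fun x => U x - (U x - v x)) = v)//.
by apply/funext => x; rewrite subKr.
Qed.

Lemma projection_error : (\int[mu]_(x in Omega) (sqmod (u x - P u x))%:E <= K%:E * X)%E.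
Proof.
have Vv : pw_const Omega T v.
  split; [exact: v2|move=> j]; exists (ccube_average U h (c j)); apply: nearW => x Tj.
  exact: mesh_functionE.
apply: (le_trans (orthogonal_projection_le mOmega PP (fun w => @proj1 _ _) u2 Vv)).
apply: le_trans approximation; rewrite le_eqVlt; apply/orP; left; apply/eqP.
apply: ge0_ae_eq_integral => //.
- apply/measurable_EFinP; apply: measurable_sqmod; apply: cmeasurableB; first by case: u2.
  by case: v2.
- by apply/measurable_EFinP; exact: measurable_sqmod.
- by move=> x _; rewrite lee_fin sqmod_ge0.
- by move=> x _; rewrite lee_fin sqmod_ge0.
- by move: Uu; apply: filterS => x h1 Ox; rewrite h1.
Qed.

End mesh_approximation.

Theorem proposition3p25 (R : realType) (n : nat) (n_gt0 : (0 < n)%N)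
    (Omega : set 'rV[R]_n) (Omega_domain : domain Omega)
    (h : R) (h_gt0 : 0 < h)
    (J : countType) (T : J -> set 'rV[R]_n) (T_mesh : mesh Omega T)
    (T_diam : forall j, (diam (T j) <= h%:E)%E)
    (P : ('rV[R]_n -> R[i]) -> ('rV[R]_n -> R[i]))
    (P_proj : orthogonal_projection Omega (pw_const Omega T) P)
    (u : 'rV[R]_n -> R[i]) (u_H1 : H1_on Omega u) :
  let C : R := 3 `^ (1 + n%:R / 2) * Num.sqrt n%:R / pi in
  (forall U : 'rV[R]_n -> R[i], H1 U -> ae_eq (lebesgue_row n) Omega U u ->
     forall G : 'I_n -> 'rV[R]_n -> R[i], weak_gradient U G ->
       (L2norm Omega (u \- P u)%R <= (C * h)%:E * grad_L2norm G)%E) /\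
  (L2norm Omega (u \- P u)%R <= (C * h)%:E * H1norm_on Omega u)%E.
Proof.
move=> C; have C0 : 0 <= C.
  by rewrite /C divr_ge0 ?pi_ge0// mulr_ge0 ?sqrtr_ge0// powR_ge0.
have Cgt0 : 0 < C.
  by rewrite /C divr_gt0 ?pi_gt0// mulr_gt0 ?sqrtr_gt0 ?ltr0n// powR_gt0.
have Ch0 : 0 < C * h by exact: mulr_gt0.
have C2 : C ^+ 2 = 3 ^+ (2 + n) * n%:R / pi ^+ 2.
  rewrite /C !exprMn exprVn sqr_sqrtr ?ler0n// -(powR_mulrn 2 (powR_ge0 _ _)) -powRrM.
  by rewrite mulrDl mul1r mulfVK// -natrD powR_mulrn.
have KC : 3 ^+ n * (n%:R * (3 * h / 4) ^+ 2) <= (C * h) ^+ 2.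
  have -> : 3 ^+ n * (n%:R * (3 * h / 4) ^+ 2) = 3 ^+ (2 + n) * n%:R * h ^+ 2 / 16.
    by rewrite exprD; move: (3 ^+ n) => w; field.
  rewrite exprMn C2 [leRHS]mulrAC ler_wpM2l//; first by
    rewrite mulr_ge0 ?sqr_ge0// mulr_ge0// exprn_ge0.
  (* [9/16 <= 9/pi^2] because [pi <= 4] *)
  rewrite lef_pV2 ?posrE ?exprn_gt0 ?pi_gt0//.
  have := pihalf_lt2 R; have := pi_gt0 R; move: (pi : R) => p p0 p4.
  by nra.
(* If [X] is infinite there is nothing to prove: this covers weak gradients that
   are not square-integrable. *)
have main U X : H1 U -> ae_eq (lebesgue_row n) Omega U u -> (0 <= X)%E ->
    (forall (t : 'rV[R]_n) s, (X < +oo)%E -> (forall i, `|t ord0 i| <= s) ->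
      (\int[lebesgue_row n]_x (sqmod (U (x + t) - U x))%:E <= (n%:R * s ^+ 2)%:E * X)%E) ->
    (L2norm Omega (u \- P u)%R <= (C * h)%:E * X `^ 2^-1)%E.
  move=> [U2 _ _] Uu X0 HX; have [u2 _] := u_H1.
  apply: L2norm_le => //; first exact: ltW.
  have [Xoo|] := ltP X +oo%E; last first.
    rewrite leye_eq => /eqP ->; rewrite gt0_muley ?leey// lte_fin exprn_gt0//.
  apply: (le_trans (projection_error Omega_domain h_gt0 T_mesh T_diam P_proj u2 U2 Uu X0
    (fun t s => HX t s Xoo) Xoo)).
  by apply: lee_wpmul2r.
split.
  move=> U HU Uu G UG; rewrite grad_L2normE.
  apply: (main U _ HU Uu _ (fun t s => weak_gradient_translation HU UG (t := t) (tau := s))).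
  by apply: integral_ge0 => x _; rewrite lee_fin sumr_ge0// => j _; exact: sqmod_ge0.
rewrite -lee_pdivrMl//; apply: le_ereal_inf_tmp => _ [U [HU Uu] <-].
rewrite lee_pdivrMl//.
apply: (main U _ HU Uu _ (fun t s _ => H1_translation_sup HU (t := t) (tau := s))).
by apply: integral_ge0 => xi _; rewrite lee_fin mulr_ge0 ?sqr_ge0// addr_ge0 ?sqr_ge0.
Qed.
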